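(* Let $(x^*,y^* )\in\mathbb{R}^n\times\mathbb{R}^m$ be a point around which $f,h,g$ are twice continuously differentiable, and let $H,G$ be twice continuously differentiable around $x^*$. Consider the minimax problem $\min_{x\in\Phi}\max_{y\in Y(x)}f(x,y)$ with $\Phi=\{x\in\mathbb{R}^n:H(x)=0,\ G(x)\le0\}$ and $Y(x)=\{y\in\mathbb{R}^m:h(x,y)=0,\ g(x,y)\le0\}$. Assume there exists $(u^*,v^*,\mu^*,\lambda^* )\in\mathbb{R}^{n_1}\times\mathbb{R}^{n_2}\times\mathbb{R}^{m_1}\times\mathbb{R}^{m_2}$ such that $(x^*,u^*,v^*,y^*,\mu^*,\lambda^* )$ satisfies the Karush-Kuhn-Tucker conditions of this problem: $$\nabla_x\mathcal{L}(x^*,y^*,\mu^*,\lambda^* )+\mathcal{J}H(x^* )^Tu^*+\mathcal{J}G(x^* )^Tv^*=0,\quad H(x^* )=0,\quad 0\le v^*\perp G(x^* )\le0,$$ $$\nabla_y\mathcal{L}(x^*,y^*,\mu^*,\lambda^* )=0,\quad h(x^*,y^* )=0,\quad 0\le\lambda^*\perp g(x^*,y^* )\le0.$$ Put $w^*=v^*+G(x^* )$ and $\xi^*=\lambda^*+g(x^*,y^* )$, and let $F$ be the Kojima mapping of the problem (defined in the context). Consider the following four statements: (a) Property A (defined in the context) holds at $(x^*,u^*,v^*,y^*,\mu^*,\lambda^* )$. (b) Every element of the Clarke subdifferential $\partial F(x^*,u^*,w^*,y^*,\mu^*,\xi^* )$ is nonsingular. (c) $F$ is a locally Lipschitz homeomorphism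 near $(x^*,u^*,w^*,y^*,\mu^*,\xi^* )$. (d) The point $(x^*,u^*,v^*,y^*,\mu^*,\lambda^* )$ is a strongly regular solution of the generalized equation $0\in\mathcal{H}(z)+N_{\mathcal{K}}(z)$ (with $\mathcal{H}$, $\mathcal{K}$ and strong regularity defined in the context). Then (a) $\Longrightarrow$ (b) $\Longrightarrow$ (c) $\Longleftrightarrow$ (d).
   Context: Data: $f:\mathbb{R}^n\times\mathbb{R}^m\to\mathbb{R}$, $h:\mathbb{R}^n\times\mathbb{R}^m\to\mathbb{R}^{m_1}$, $g:\mathbb{R}^n\times\mathbb{R}^m\to\mathbb{R}^{m_2}$, $H:\mathbb{R}^n\to\mathbb{R}^{n_1}$, $G:\mathbb{R}^n\to\mathbb{R}^{n_2}$. Lagrangian: $\mathcal{L}(x,y,\mu,\lambda)=f(x,y)+\mu^Th(x,y)-\lambda^Tg(x,y)$. $\mathcal{J}$ denotes Jacobian matrices, $\mathcal{J}_x,\mathcal{J}_y$ partial Jacobians, $\nabla$ gradients (columns); $g_\alpha$ is the subvector of $g$ indexed by $\alpha$; $\mathbf{B}(a,r)=\{a':\|a'-a\|\le r\}$; $0\le a\perp b\le0$ means $a\ge0$, $b\le0$, $a^Tb=0$. For a vector $w$, $w^+$ and $w^-$ have components $\max\{0,w_i\}$ and $\min\{0,w_i\}$. Kojima mapping: $$F(x,u,w,y,\mu,\xi)=\begin{bmatrix}\nabla_x\mathcal{L}(x,y,\mu,\xi^+)+\mathcal{J}H(x)^Tu+\mathcal{J}G(x)^Tw^+\\ H(x)\\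 G(x)-w^-\\ \nabla_y\mathcal{L}(x,y,\mu,\xi^+)\\ h(x,y)\\ -g(x,y)+\xi^-\end{bmatrix}.$$ Clarke subdifferential of a locally Lipschitz map $F$ at $p$: $\partial F(p)=\mathrm{conv}\{V:\exists\,p^k\to p$ with $F$ differentiable at $p^k$ and $\mathcal{J}F(p^k)\to V\}$. $F$ is a locally Lipschitz homeomorphism near $p$ if there is an open neighborhood $U$ of $p$ such that $F(U)$ is open, $F|_U:U\to F(U)$ is bijective, and both $F|_U$ and its inverse are Lipschitz continuous. Generalized equation: with $z=(x,u,v,y,\mu,\lambda)$, $\mathcal{K}=\mathbb{R}^n\times\mathbb{R}^{n_1}\times\mathbb{R}^{n_2}_+\times\mathbb{R}^m\times\mathbb{R}^{m_1}\times\mathbb{R}^{m_2}_+$, $N_{\mathcal{K}}(z)$ the normal cone of convex analysis to $\mathcal{K}$ at $z$ (empty if $z\notin\mathcal{K}$), and $$\mathcal{H}(z)=\begin{bmatrix}\nabla_x\mathcal{L}(x,y,\mu,\lambda)+\mathcal{J}H(x)^Tu+\mathcal{J}G(x)^Tv\\ H(x)\\ -G(x)\\ \nabla_y\mathcal{L}(x,y,\mu,\lambda)\\ h(x,y)\\ -g(x,y)\end{bmatrix}.$$ A solution $z^*$ of $0\in\mathcal{H}(z)+N_{\mathcal{K}}(z)$ is strongly regular if there exist $\delta>0$, $\varepsilon>0$ such that for every $\eta\in\mathbf{B}(0,\delta)$ the linearized generalized equation $\eta\in\mathcal{H}(z^* )+\mathcal{J}\mathcal{H}(z^* )(z-z^*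 )+N_{\mathcal{K}}(z)$ has a unique solution $\widehat z(\eta)$ in $\mathbf{B}(z^*,\varepsilon)$, and $\widehat z:\mathbf{B}(0,\delta)\to\mathbf{B}(z^*,\varepsilon)$ is Lipschitz continuous. Lower-level problem $(\mathrm{P}_{x^*})$: $\max_z\{f(x^*,z):h(x^*,z)=0,\ g(x^*,z)\le0\}$. Its Jacobian uniqueness conditions at $(y^*,\mu^*,\lambda^* )$, where $\alpha=\{i:g_i(x^*,y^* )=0\}$, are: (1) $\nabla_y\mathcal{L}(x^*,y^*,\mu^*,\lambda^* )=0$, $h(x^*,y^* )=0$, $0\le\lambda^*\perp g(x^*,y^* )\le0$; (2) the vectors $\nabla_yh_j(x^*,y^* )$ ($1\le j\le m_1$), $\nabla_yg_i(x^*,y^* )$ ($i\in\alpha$) are linearly independent; (3) $\lambda^*_i-g_i(x^*,y^* )>0$ for $i=1,\dots,m_2$; (4) $\langle\nabla^2_{yy}\mathcal{L}(x^*,y^*,\mu^*,\lambda^* )d_y,d_y\rangle<0$ for all nonzero $d_y$ with $\mathcal{J}_yh(x^*,y^* )d_y=0$, $\nabla_yg_i(x^*,y^* )^Td_y\le0$ ($i\in\alpha$), $\nabla_yf(x^*,y^* )^Td_y\ge0$. With all functions evaluated at $(x^*,y^*,\mu^*,\lambda^* )$, put $$K_\alpha=\begin{bmatrix}\nabla^2_{yy}\mathcal{L}&\mathcal{J}_yh^T&-\mathcal{J}_yg_\alpha^T\\ \mathcal{J}_yh&0&0\\-\mathcal{J}_yg_\alpha&0&0\end{bmatrix},\qquad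 N_\alpha=\begin{bmatrix}M\\ \mathcal{J}_xh\\-\mathcal{J}_xg_\alpha\end{bmatrix},$$ where $M$ is the $m\times n$ matrix with entries $\partial^2\mathcal{L}/\partial y_i\partial x_j$ ($K_\alpha$ is nonsingular under the Jacobian uniqueness conditions of $(\mathrm{P}_{x^*})$). Let $I(x^* )=\{i:G_i(x^* )=0\}$; let $\Lambda(x^* )$ be the set of $(u,v)$ with $\nabla_x\mathcal{L}(x^*,y^*,\mu^*,\lambda^* )+\mathcal{J}H(x^* )^Tu+\mathcal{J}G(x^* )^Tv=0$, $H(x^* )=0$, $0\le v\perp G(x^* )\le0$; and let $\mathcal{C}(x^* )=\{d_x:\mathcal{J}H(x^* )d_x=0;\ \nabla G_i(x^* )^Td_x\le0,\ i\in I(x^* );\ \nabla_x\mathcal{L}(x^*,y^*,\mu^*,\lambda^* )^Td_x\le0\}$, with affine hull $\mathrm{Aff}\,\mathcal{C}(x^* )$. Property A at $(x^*,u^*,v^*,y^*,\mu^*,\lambda^* )$ means: (i) $x^*\in\Phi$ and $(u^*,v^* )\in\Lambda(x^* )$; (ii) the vectors $\nabla H_j(x^* )$ ($1\le j\le n_1$), $\nabla G_i(x^* )$ ($i\in I(x^* )$) are linearly independent; (iii) $y^*\in Y(x^* )$ and $(\mathrm{P}_{x^*})$ satisfies the Jacobian uniqueness conditions at $(y^*,\mu^*,\lambda^* )$; (iv) for every $d_x\in\mathrm{Aff}\,\mathcal{C}(x^* )\setminus\{0\}$, $$\sup_{(u,v)\in\Lambda(x^* )}\Big\langle\Big[\sum_{j=1}^{n_1}u_j\nabla^2H_j(x^*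 )+\sum_{i=1}^{n_2}v_i\nabla^2G_i(x^* )\Big]d_x,d_x\Big\rangle+\big\langle[\nabla^2_{xx}\mathcal{L}(x^*,y^*,\mu^*,\lambda^* )-N_\alpha^TK_\alpha^{-1}N_\alpha]d_x,d_x\big\rangle>0.$$ *)

(* Defs.v *)
From HB Require Import structures.
From mathcomp Require Import all_boot all_order all_algebra.
From mathcomp Require Import all_classical all_reals all_analysis.
Set Implicit Arguments.
Unset Strict Implicit.
Unset Printing Implicit Defensive.
Import Order.TTheory GRing.Theory Num.Theory.
Import numFieldNormedType.Exports.
Local Open Scope classical_set_scope.
Local Open Scope ring_scope.

Section Vectors.
Context {R : realType}.

Definition dotv n (a b : 'cV[R]_n) : R := (a^T *m b) 0 0.

(* Euclidean norm; the library norm on matrices is the sup norm, which induces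
   the same topology. *)
Definition enorm n (a : 'cV[R]_n) : R := Num.sqrt (dotv a a).

Definition eball n (a : 'cV[R]_n) (r : R) : set 'cV[R]_n :=
  [set b | enorm (b - a) <= r].

Definition nonnegv n (a : 'cV[R]_n) := forall i, 0 <= a i 0.
Definition nonposv n (a : 'cV[R]_n) := forall i, a i 0 <= 0.

(* 0 <= a, b <= 0, a orthogonal to b *)
Definition complementary n (a b : 'cV[R]_n) :=
  [/\ nonnegv a, nonposv b & dotv a b = 0].

Definition posv n (w : 'cV[R]_n) : 'cV[R]_n := \col_i Num.max 0 (w i 0).
Definition negv n (w : 'cV[R]_n) : 'cV[R]_n := \col_i Num.min 0 (w i 0).

Definition lipschitz_in n k (A : set 'cV[R]_n) (F : 'cV[R]_n -> 'cV[R]_k) :=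
  exists L : R, forall a b, A a -> A b -> enorm (F a - F b) <= L * enorm (a - b).

Definition affine_hull (V : lmodType R) (C : set V) : set V :=
  [set d | exists k (c : 'I_k -> V) (t : 'I_k -> R),
     [/\ forall i, C (c i), \sum_i t i = 1 & d = \sum_i t i *: c i]].

Definition convex_hull (V : lmodType R) (C : set V) : set V :=
  [set d | exists k (c : 'I_k -> V) (t : 'I_k -> R),
     [/\ forall i, C (c i), forall i, 0 <= t i, \sum_i t i = 1
       & d = \sum_i t i *: c i]].

End Vectors.

Section Derivatives.
Context {R : realType}.

Definition pderiv n (j : 'I_n) (f : 'cV[R]_n -> R) (x : 'cV[R]_n) : R :=
  'D_(delta_mx j 0) f x.

Definition grad n (f : 'cV[R]_n -> R) (x : 'cV[R]_n) : 'cV[R]_n :=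
  \col_j pderiv j f x.

Definition jac n k (F : 'cV[R]_n -> 'cV[R]_k) (x : 'cV[R]_n) : 'M[R]_(k, n) :=
  \matrix_(i, j) pderiv j (fun z => F z i 0) x.

Definition hess n (f : 'cV[R]_n -> R) (x : 'cV[R]_n) : 'M[R]_n :=
  \matrix_(i, j) pderiv j (pderiv i f) x.

(* f is twice continuously differentiable on a neighbourhood of p; in finite
   dimension continuity of the derivatives can be tested direction by
   direction. *)
Definition C2_near (V W : normedModType R) (f : V -> W) (p : V) :=
  \forall q \near p, differentiable f q /\
    forall v, differentiable ('D_v f) q /\
      forall w, {for q, continuous ('D_w ('D_v f))}.

Definition clarke_subdiff n k (F : 'cV[R]_n -> 'cV[R]_k) (p : 'cV[R]_n)
    : set 'M[R]_(k, n) :=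
  convex_hull [set V : 'M[R]_(k, n) | exists q : nat -> 'cV[R]_n,
    [/\ q @ \oo --> p, forall i, differentiable F (q i)
      & (fun i => jac F (q i)) @ \oo --> V]].

Definition locally_lipschitz_homeo n k (F : 'cV[R]_n -> 'cV[R]_k)
    (p : 'cV[R]_n) :=
  exists U : set 'cV[R]_n, [/\ open U, U p, open (F @` U), lipschitz_in U F
    & exists Finv : 'cV[R]_k -> 'cV[R]_n,
        (forall a, U a -> Finv (F a) = a) /\ lipschitz_in (F @` U) Finv].

End Derivatives.

Section GeneralizedEquations.
Context {R : realType} {N : nat}.

Definition normal_cone (K : set 'cV[R]_N) (z : 'cV[R]_N) : set 'cV[R]_N :=
  [set nu | K z /\ forall z', K z' -> dotv nu (z' - z) <= 0].

Definition solves_ge (Hm : 'cV[R]_N -> 'cV[R]_N) (K : set 'cV[R]_N)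
    (eta z : 'cV[R]_N) :=
  exists2 nu, normal_cone K z nu & eta = Hm z + nu.

Definition linearization (Hm : 'cV[R]_N -> 'cV[R]_N) (zs z : 'cV[R]_N)
    : 'cV[R]_N := Hm zs + jac Hm zs *m (z - zs).

Definition strongly_regular (Hm : 'cV[R]_N -> 'cV[R]_N) (K : set 'cV[R]_N)
    (zs : 'cV[R]_N) :=
  solves_ge Hm K 0 zs /\
  exists (delta eps : R) (zhat : 'cV[R]_N -> 'cV[R]_N),
    [/\ 0 < delta, 0 < eps,
        forall eta, eball 0 delta eta ->
          [/\ eball zs eps (zhat eta),
              solves_ge (linearization Hm zs) K eta (zhat eta)
            & forall z, eball zs eps z ->
                solves_ge (linearization Hm zs) K eta z -> z = zhat eta]
      & lipschitz_in (eball 0 delta) zhat].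

End GeneralizedEquations.

Section Minimax.
Context {R : realType} {n m n1 n2 m1 m2 : nat}.
Variables (f : 'cV[R]_n * 'cV[R]_m -> R)
  (h : 'cV[R]_n * 'cV[R]_m -> 'cV[R]_m1)
  (g : 'cV[R]_n * 'cV[R]_m -> 'cV[R]_m2)
  (H : 'cV[R]_n -> 'cV[R]_n1)
  (G : 'cV[R]_n -> 'cV[R]_n2).

Definition Phi : set 'cV[R]_n := [set x | H x = 0 /\ nonposv (G x)].

Definition Y (x : 'cV[R]_n) : set 'cV[R]_m :=
  [set y | h (x, y) = 0 /\ nonposv (g (x, y))].

Definition Lag (x : 'cV[R]_n) (y : 'cV[R]_m) (mu : 'cV[R]_m1)
    (lam : 'cV[R]_m2) : R :=
  f (x, y) + dotv mu (h (x, y)) - dotv lam (g (x, y)).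

Definition gradxL x y mu lam := grad (fun x' => Lag x' y mu lam) x.
Definition gradyL x y mu lam := grad (fun y' => Lag x y' mu lam) y.

Definition stationaryx x u v y mu lam : 'cV[R]_n :=
  gradxL x y mu lam + (jac H x)^T *m u + (jac G x)^T *m v.

Definition lower_kkt x y mu lam :=
  [/\ gradyL x y mu lam = 0, h (x, y) = 0 & complementary lam (g (x, y))].

(* the set Lambda(x), which depends also on (y, mu, lam) *)
Definition multipliers x y mu lam : set ('cV[R]_n1 * 'cV[R]_n2) :=
  [set uv | [/\ stationaryx x uv.1 uv.2 y mu lam = 0, H x = 0
              & complementary uv.2 (G x)]].

Definition kkt x u v y mu lam :=
  [/\ stationaryx x u v y mu lam = 0, H x = 0, complementary v (G x)
    & lower_kkt x y mu lam].

(* R^n x R^n1 x R^n2 x R^m x R^m1 x R^m2 as a space of column vectors *)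
Definition dimz := (n + (n1 + (n2 + (m + (m1 + m2)))))%N.

Definition pack (x : 'cV[R]_n) (u : 'cV[R]_n1) (v : 'cV[R]_n2)
    (y : 'cV[R]_m) (mu : 'cV[R]_m1) (lam : 'cV[R]_m2) : 'cV[R]_dimz :=
  col_mx x (col_mx u (col_mx v (col_mx y (col_mx mu lam)))).

Definition xpart (z : 'cV[R]_dimz) : 'cV[R]_n := usubmx z.
Definition upart (z : 'cV[R]_dimz) : 'cV[R]_n1 := usubmx (dsubmx z).
Definition vpart (z : 'cV[R]_dimz) : 'cV[R]_n2 := usubmx (dsubmx (dsubmx z)).
Definition ypart (z : 'cV[R]_dimz) : 'cV[R]_m :=
  usubmx (dsubmx (dsubmx (dsubmx z))).
Definition mupart (z : 'cV[R]_dimz) : 'cV[R]_m1 :=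
  usubmx (dsubmx (dsubmx (dsubmx (dsubmx z)))).
Definition lampart (z : 'cV[R]_dimz) : 'cV[R]_m2 :=
  dsubmx (dsubmx (dsubmx (dsubmx (dsubmx z)))).

Definition kojima (p : 'cV[R]_dimz) : 'cV[R]_dimz :=
  let x := xpart p in let u := upart p in let w := vpart p in
  let y := ypart p in let mu := mupart p in let xi := lampart p in
  pack (stationaryx x u (posv w) y mu (posv xi))
       (H x)
       (G x - negv w)
       (gradyL x y mu (posv xi))
       (h (x, y))
       (- g (x, y) + negv xi).

Definition ge_map (z : 'cV[R]_dimz) : 'cV[R]_dimz :=
  let x := xpart z in let u := upart z in let v := vpart z in
  let y := ypart z in let mu := mupart z in let lam := lampart z in
  pack (stationaryx x u v y mu lam)
       (H x)
       (- G x)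
       (gradyL x y mu lam)
       (h (x, y))
       (- g (x, y)).

Definition ge_cone : set 'cV[R]_dimz :=
  [set z | nonnegv (vpart z) /\ nonnegv (lampart z)].

Definition jacyh x y := jac (fun y' => h (x, y')) y.
Definition jacyg x y := jac (fun y' => g (x, y')) y.
Definition jacxh x y := jac (fun x' => h (x', y)) x.
Definition jacxg x y := jac (fun x' => g (x', y)) x.
Definition hessyyL x y mu lam := hess (fun y' => Lag x y' mu lam) y.
Definition hessxxL x y mu lam := hess (fun x' => Lag x' y mu lam) x.

Definition alpha x y : {set 'I_m2} := [set i | g (x, y) i 0 == 0]%SET.
Definition active x : {set 'I_n2} := [set i | G x i 0 == 0]%SET.

(* the rows of A indexed by S *)
Definition subrows k l (S : {set 'I_k}) (A : 'M[R]_(k, l)) : 'M[R]_(#|S|, l) :=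
  rowsub (@enum_val _ (mem S)) A.

Definition jacobian_uniqueness x y mu lam :=
  [/\ lower_kkt x y mu lam,
      row_free (col_mx (jacyh x y) (subrows (alpha x y) (jacyg x y))),
      forall i, 0 < lam i 0 - g (x, y) i 0
    & forall d : 'cV[R]_m, d != 0 ->
        jacyh x y *m d = 0 ->
        (forall i, i \in alpha x y ->
           dotv (grad (fun y' => g (x, y') i 0) y) d <= 0) ->
        0 <= dotv (grad (fun y' => f (x, y')) y) d ->
        dotv (hessyyL x y mu lam *m d) d < 0].

Definition Kmx x y mu lam :=
  let A := subrows (alpha x y) (jacyg x y) in
  block_mx (hessyyL x y mu lam) (row_mx (jacyh x y)^T (- A^T))
           (col_mx (jacyh x y) (- A)) 0.

Definition Mmx x y mu lam : 'M[R]_(m, n) :=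
  \matrix_(i, j)
    pderiv i (fun y' => pderiv j (fun x' => Lag x' y' mu lam) x) y.

Definition Nmx x y mu lam :=
  col_mx (Mmx x y mu lam)
    (col_mx (jacxh x y) (- subrows (alpha x y) (jacxg x y))).

Definition critical_cone x y mu lam : set 'cV[R]_n :=
  [set d | [/\ jac H x *m d = 0,
      forall i, i \in active x -> dotv (grad (fun x' => G x' i 0) x) d <= 0
    & dotv (gradxL x y mu lam) d <= 0]].

Definition hessHG x (u : 'cV[R]_n1) (v : 'cV[R]_n2) : 'M[R]_n :=
  \sum_j u j 0 *: hess (fun x' => H x' j 0) x +
  \sum_i v i 0 *: hess (fun x' => G x' i 0) x.

(* The supremum is taken in the extended reals, the set of multipliers being
   a priori unbounded. *)
Definition second_order_condition x y mu lam :=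
  forall d : 'cV[R]_n, affine_hull (critical_cone x y mu lam) d -> d != 0 ->
    (0 < ereal_sup [set (dotv (hessHG x uv.1 uv.2 *m d) d)%:E
                      | uv in multipliers x y mu lam]
         + (dotv ((hessxxL x y mu lam
                   - (Nmx x y mu lam)^T *m invmx (Kmx x y mu lam)
                       *m Nmx x y mu lam) *m d) d)%:E)%E.

Definition propertyA x u v y mu lam :=
  [/\ Phi x /\ multipliers x y mu lam (u, v),
      row_free (col_mx (jac H x) (subrows (active x) (jac G x))),
      Y x y /\ jacobian_uniqueness x y mu lam
    & second_order_condition x y mu lam].

End Minimax.

(* Main.v *)
From HB Require Import structures.
Require Import Defs.
From mathcomp Require Import all_boot all_order all_algebra.
From mathcomp Require Import all_classical all_reals all_analysis.
From mathcomp Require Import ring lra.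
Set Implicit Arguments.
Unset Strict Implicit.
Unset Printing Implicit Defensive.
Import Order.TTheory GRing.Theory Num.Theory.
Import numFieldNormedType.Exports.
Local Open Scope classical_set_scope.
Local Open Scope ring_scope.

(** Let [P] be the projection onto the cone [K] and [Hm] the map of the
    generalized equation.  Up to the sign of its third block, the Kojima map is
    Robinson's normal map [p |-> Hm (P p) + p - P p].

    (c) <-> (d): replacing [Hm] by its linearization at [zs] perturbs the normal
    map by a map whose Lipschitz constant is arbitrarily small near [ps]; by
    Banach's fixed point theorem this does not affect local Lipschitz
    invertibility.  For the linearized normal map the latter is strong
    regularity, through [z = P p] and [p = z + eta - linearization z].

    (b) -> (c): with [A] the Jacobian of [Hm] at [zs], the Clarke
    subdifferential of the normal map at [ps] consists of the matrices
    [1 + (A - 1) diag a], where [a] runs over a face of the unit cube.  If they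
    are all nonsingular, their inverses are uniformly bounded by compactness,
    and the piecewise linear model of the normal map is deformed into a linear
    bijection, in steps too small to destroy bijectivity.

    (a) -> (b): for [d] in the kernel of [1 + (A - 1) diag a], eliminating the
    lower level unknowns with [K_alpha] shows that the quadratic form of (iv)
    at [d_x], increased by [\sum_i a_i (1 - a_i) d_(w_i)^2], vanishes. *)

(** The kinks of the normal map come from the projection alone, and its coordinates are independent
    of each other, so the slopes at [ps] fill a box, a product of points and unit intervals. As
    [Jmx] is affine in the slopes, the convex hull in the Clarke subdifferential merely fills this
    box from its vertices, and the difference of two values of the piecewise linear model is a
    single matrix [Jmx a] applied to the difference of the arguments. Nonsingularity therefore gives
    injectivity with a uniformly Lipschitz inverse at once; surjectivity is what remains in (b) ->
    (c), and the deformation is there for it. In (a) -> (b), strict complementarity freezes the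
    lower level slopes at 0 or 1, so that the lower level block is exactly K_alpha, and the linear
    independence in (ii) leaves a single multiplier, so that the supremum in (iv) is one value. The
    definitions use the Euclidean norm and the estimates the sup norm, whence the dimension factors
    in the constants. *)

HB.instance Definition _ (R : realType) (m n : nat) :=
  Complete.on 'M[R]_(m, n).

(** * Comparison of the Euclidean norm and the sup norm *)

Section MatrixNorms.
Context {R : realType}.

Lemma ler_coord_norm m n (A : 'M[R]_(m, n)) i j : `|A i j| <= `|A|.
Proof.
rewrite [leRHS]/Num.Def.normr /= mx_normrE.
by apply/bigmax_geP; right; exists (i, j).
Qed.

Lemma mx_norm_leP m n (A : 'M[R]_(m, n)) c :
  0 <= c -> (forall i j, `|A i j| <= c) -> `|A| <= c.
Proof.
move=> c0 Ac; rewrite [leLHS]/Num.Def.normr /= mx_normrE.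
by apply/bigmax_leP; split => // -[i j] _; exact: Ac.
Qed.

Lemma ler_sum_const n (f : 'I_n -> R) c :
  (forall i, f i <= c) -> \sum_i f i <= n%:R * c.
Proof.
move=> fc; rewrite mulr_natl -[in leRHS](card_ord n) -sumr_const.
by apply: ler_sum => i _.
Qed.

Lemma ler_norm_mulmx m n p (A : 'M[R]_(m, n)) (B : 'M[R]_(n, p)) :
  `|A *m B| <= n%:R * `|A| * `|B|.
Proof.
apply: mx_norm_leP => [|i j]; first by rewrite !mulr_ge0.
rewrite mxE (le_trans (ler_norm_sum _ _ _))//.
rewrite -mulrA; apply: ler_sum_const => k; rewrite normrM ler_pM ?ler_coord_norm//.
Qed.

Lemma dotvE n (a b : 'cV[R]_n) : dotv a b = \sum_i a i 0 * b i 0.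
Proof. by rewrite /dotv mxE; apply: eq_bigr => i _; rewrite mxE. Qed.

Lemma norm_le_enorm n (a : 'cV[R]_n) : `|a| <= enorm a.
Proof.
apply: mx_norm_leP => [|i j]; first exact: sqrtr_ge0.
rewrite ord1 -sqrtr_sqr ler_sqrt; last first.
  by rewrite dotvE sumr_ge0// => k _; rewrite -expr2 sqr_ge0.
rewrite dotvE (bigD1 i)//= -expr2 lerDl sumr_ge0// => k _.
by rewrite -expr2 sqr_ge0.
Qed.

Lemma enorm_le_norm n (a : 'cV[R]_n) : enorm a <= n%:R * `|a|.
Proof.
rewrite -[leRHS]ger0_norm ?mulr_ge0// -sqrtr_sqr ler_sqrt ?sqr_ge0//.
rewrite dotvE exprMn (@le_trans _ _ (n%:R * `|a| ^+ 2))//.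
  apply: ler_sum_const => k; rewrite -expr2 -real_normK ?num_real//.
  by rewrite lerXn2r ?nnegrE// ler_coord_norm.
rewrite ler_wpM2r ?sqr_ge0// -natrX ler_nat.
by case: n {a} => // n; rewrite expnS expn1 leq_pmulr.
Qed.

(** Norm equivalence only changes the constant. It is made positive here so that later radii can be
    divided by it. *)
Lemma lipschitz_inP n k (A : set 'cV[R]_n) (F : 'cV[R]_n -> 'cV[R]_k) :
  lipschitz_in A F <-> exists2 L : R, 0 < L &
    forall a b, A a -> A b -> `|F a - F b| <= L * `|a - b|.
Proof.
split=> [[L AL]|[L L0 AL]].
- exists (`|L| * n%:R + 1) => [|a b Aa Ab].
    by rewrite ltr_wpDl// mulr_ge0.
  rewrite (le_trans (norm_le_enorm _))// (le_trans (AL _ _ Aa Ab))//.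
  rewrite (@le_trans _ _ (`|L| * enorm (a - b)))//.
    by rewrite ler_wpM2r ?sqrtr_ge0 ?ler_norm.
  rewrite (@le_trans _ _ (`|L| * (n%:R * `|a - b|)))//.
    by rewrite ler_wpM2l ?enorm_le_norm.
  by rewrite mulrA ler_wpM2r// lerDl.
- exists (k%:R * L) => a b Aa Ab.
  rewrite (le_trans (enorm_le_norm _))// -mulrA ler_wpM2l//.
  rewrite (le_trans (AL _ _ Aa Ab))// ler_wpM2l ?(ltW L0)//.
  exact: norm_le_enorm.
Qed.

End MatrixNorms.

(** * Local Lipschitz homeomorphisms and their perturbations *)

Section LocalHomeomorphisms.
Context {R : realType}.

(** A quantitative form of [locally_lipschitz_homeo]: bi-Lipschitz bounds on a closed ball, and an
    image that contains a ball. With neither open sets nor an inverse function in it, it is easy to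
    perturb. *)
Definition lip_homeo_at n k (F : 'cV[R]_n -> 'cV[R]_k) (p : 'cV[R]_n) :=
  exists L rho sigma : R, [/\ 0 < L, 0 < rho, 0 < sigma,
    forall a b, `|a - p| <= rho -> `|b - p| <= rho ->
      `|a - b| <= L * `|F a - F b| /\ `|F a - F b| <= L * `|a - b|
    & forall y, `|y - F p| <= sigma -> exists2 a, `|a - p| <= rho & F a = y].

Lemma lip_homeo_at_shrink n k (F : 'cV[R]_n -> 'cV[R]_k) p :
  lip_homeo_at F p -> exists L rho : R, [/\ 0 < L, 0 < rho &
    forall r, 0 < r -> r <= rho ->
    [/\ forall a b, `|a - p| <= r -> `|b - p| <= r ->
      `|a - b| <= L * `|F a - F b| /\ `|F a - F b| <= L * `|a - b|
    & forall y, `|y - F p| <= r / L -> exists2 a, `|a - p| <= r & F a = y]].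
Proof.
move=> [L [rho [sigma [L0 rho0 sigma0 lipF surF]]]].
exists L, (Num.min rho (L * sigma)); split => // [|r r0].
  by rewrite lt_min rho0 mulr_gt0.
rewrite le_min => /andP[rrho rsigma]; split=> [a b ar br|y yr].
  by apply: lipF; apply: le_trans rrho.
have [|a arho Fay] := surF y.
  by rewrite (le_trans yr)// ler_pdivrMr// mulrC.
exists a => //; have [|+ _] := lipF a p arho.
  by rewrite subrr normr0 ltW.
move=> /le_trans; apply.
by rewrite Fay mulrC -ler_pdivlMr.
Qed.

Lemma locally_lipschitz_homeoP n k (F : 'cV[R]_n -> 'cV[R]_k) p :
  locally_lipschitz_homeo F p <-> lip_homeo_at F p.
Proof.
split.
- move=> [U [oU Up oFU /lipschitz_inP[L1 L10 lipF] [Finv [FinvK]]]].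
  move=> /lipschitz_inP[L2 L20 lipFinv].
  have /nbhs_ballP[r0 /= r00 r0U] : nbhs p U by exact: open_nbhs_nbhs.
  have /nbhs_ballP[s0 /= s00 s0U] : nbhs (F p) (F @` U).
    by apply: open_nbhs_nbhs; split => //; exists p.
  have inU a : `|a - p| <= r0 / 2 -> U a.
    move=> ap; apply: r0U; rewrite -ball_normE /= distrC.
    by rewrite (le_lt_trans ap)// ltr_pdivrMr// mulr_natr mulr2n ltrDr.
  have lip2 a b : U a -> U b -> `|a - b| <= L2 * `|F a - F b|.
    move=> Ua Ub; rewrite -{1}(FinvK a)// -{1}(FinvK b)//.
    by apply: lipFinv; [exists a|exists b].
  exists (L1 + L2), (r0 / 2), (Num.min (s0 / 2) (r0 / 2 / L2)); split.
  + by rewrite addr_gt0.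
  + by rewrite divr_gt0.
  + by rewrite lt_min !divr_gt0.
  + move=> a b /inU Ua /inU Ub; split.
      by rewrite (le_trans (lip2 _ _ Ua Ub))// ler_wpM2r// lerDr ltW.
    by rewrite (le_trans (lipF _ _ Ua Ub))// ler_wpM2r// lerDl ltW.
  + move=> y; rewrite le_min => /andP[ys yr].
    have [|a Ua Fay] := s0U y.
      rewrite -ball_normE /= distrC.
      by rewrite (le_lt_trans ys)// ltr_pdivrMr// mulr_natr mulr2n ltrDr.
    exists a => //; rewrite (le_trans (lip2 _ _ Ua Up))// Fay.
    by rewrite mulrC -ler_pdivlMr.
- move=> [L [rho [sigma [L0 rho0 sigma0 lipF surF]]]].
  (* The second bound puts the preimages strictly inside the ball of radius [rho], which makes [U]
     below open. *)
  pose s := Num.min sigma (rho / 2 / L).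
  have s0 : 0 < s by rewrite lt_min sigma0 !divr_gt0.
  have pp : `|p - p| <= rho by rewrite subrr normr0 ltW.
  have sur y : `|y - F p| < s -> exists a, [/\ `|a - p| < rho & F a = y].
    rewrite lt_min => /andP[/ltW/surF[a ar Fay] yr]; exists a; split => //.
    have [+ _] := lipF _ _ ar pp; move=> /le_lt_trans; apply.
    rewrite mulrC -ltr_pdivlMr// Fay (lt_trans yr)// ltr_pM2r ?invr_gt0//.
    by rewrite ltr_pdivrMr// mulr_natr mulr2n ltrDr.
  (* Cutting the ball down to the preimage of a ball makes the image exactly that ball, hence
     open. *)
  pose U := [set a | `|a - p| < rho /\ `|F a - F p| < s].
  have FU : F @` U = ball (F p) s.
    apply/seteqP; split => y /=; rewrite -ball_normE /= distrC.
      by move=> [a [_ ?] <-].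
    by move=> ys; have [a [ar Fay]] := sur y ys; exists a => //; split => //;
       rewrite Fay.
  exists U; split.
  + rewrite openE => a [ar Fas] /=.
    apply/nbhs_ballP; exists (Num.min (rho - `|a - p|) ((s - `|F a - F p|) / L)).
      by rewrite /= lt_min subr_gt0 ar divr_gt0 ?subr_gt0.
    move=> b; rewrite -ball_normE /= distrC lt_min => /andP[b1 b2].
    have br : `|b - p| < rho.
      rewrite -(subrKA a b (- p)) (le_lt_trans (ler_normD _ _))//.
      by rewrite -ltrBrDr.
    split => //; rewrite -(subrKA (F a)) (le_lt_trans (ler_normD _ _))//.
    rewrite -ltrBrDr; have [_ +] := lipF _ _ (ltW br) (ltW ar).
    by move=> /le_lt_trans; apply; rewrite mulrC -ltr_pdivlMr.
  + by split => //; rewrite subrr normr0.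
  + by rewrite FU; exact: ball_open.
  + apply/lipschitz_inP; exists L => // a b [/ltW ar _] [/ltW br _].
    by have [] := lipF _ _ ar br.
  + pose Finv y := xget p [set a | `|a - p| <= rho /\ F a = y].
    have FinvP a : U a -> `|Finv (F a) - p| <= rho /\ F (Finv (F a)) = F a.
      move=> [/ltW ar _].
      by apply: (@xgetPex _ p [set b | `|b - p| <= rho /\ F b = F a]); exists a.
    exists Finv; split=> [a Ua|].
      have [ar' Fa'] := FinvP _ Ua; have [+ _] := lipF _ _ ar' (ltW Ua.1).
      by rewrite Fa' subrr normr0 mulr0 normr_le0 subr_eq0 => /eqP.
    apply/lipschitz_inP; exists L => // _ _ [a Ua <-] [b Ub <-].
    have [ar' Fa'] := FinvP _ Ua; have [br' Fb'] := FinvP _ Ub.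
    by rewrite -{2}Fa' -{2}Fb'; have [] := lipF _ _ ar' br'.
Qed.

(** The equation is rewritten as [A a = y - e a]; inverting [A] gives a fixed point problem with
    contraction factor [q * L]. The margin [q * r] in the surjectivity of [A] pays for the
    displacement of [y - e a] while [a] runs over the ball. *)
Lemma lipschitz_perturbation_surj n k (A e : 'cV[R]_n -> 'cV[R]_k) p y
    (r L q s : R) :
  0 <= r -> 0 <= L -> 0 <= q -> q * L < 1 ->
  (forall a b, `|a - p| <= r -> `|b - p| <= r ->
    `|a - b| <= L * `|A a - A b|) ->
  (forall z, `|z - A p| <= s + q * r -> exists2 a, `|a - p| <= r & A a = z) ->
  (forall a b, `|a - p| <= r -> `|b - p| <= r ->
    `|e a - e b| <= q * `|a - b|) ->
  `|y - (A p + e p)| <= s -> exists2 a, `|a - p| <= r & A a + e a = y.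
Proof.
move=> r0 L0 q0 qL1 lipA surA lipe ys.
pose U := [set a : 'cV[R]_n | `|a - p| <= r].
have Up : U p by rewrite /U /= subrr normr0.
pose T a := xget p [set b | U b /\ A b = y - e a].
have TP a : U a -> U (T a) /\ A (T a) = y - e a.
  move=> Ua; apply: (@xgetPex _ p [set b | U b /\ A b = y - e a]).
  have [|b Ub Ab] := surA (y - e a); last by exists b.
  rewrite (_ : _ - _ = (y - (A p + e p)) + (e p - e a)); last first.
    by rewrite opprD !addrA subrK [LHS]addrAC.
  rewrite (le_trans (ler_normD _ _))// lerD//.
  rewrite (le_trans (lipe _ _ Up Ua))// ler_wpM2l//.
  by rewrite distrC.
have homT : {homo T : x / U x >-> U x} by move=> a /TP[].
have q0' : 0 <= q * L by rewrite mulr_ge0.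
(* The complete normed structure on matrices registered at the start is what allows this
   application. *)
have [|||a Ua aE] := @banach_fixed_point R 'cV[R]_n U (mkfun homT).
- exists (NngNum q0'); split => //= -[a b] [/= Ua Ub].
  have [UTa ATa] := TP _ Ua; have [UTb ATb] := TP _ Ub.
  rewrite (le_trans (lipA _ _ UTa UTb))// ATa ATb.
  rewrite (_ : y - e a - (y - e b) = e b - e a); last first.
    by rewrite opprB addrC addrA subrK.
  rewrite mulrC [leRHS]mulrAC ler_wpM2r// distrC; exact: lipe.
- rewrite (_ : U = closed_ball_ (fun x => `|x|) p r); last first.
    by apply/seteqP; split => x; rewrite /U /closed_ball_ /= distrC.
  exact: closed_closed_ball_.
- by exists p.
- exists a => //; have [_] := TP _ Ua.
  by rewrite -[T a]/(mkfun homT a) -aE => ->; rewrite subrK.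
Qed.

(** That is, [e] has strict derivative 0 at [p]; the value [e p] is arbitrary. *)
Definition strictly_small n k (e : 'cV[R]_n -> 'cV[R]_k) p :=
  forall eps, 0 < eps -> exists2 rho, 0 < rho & forall a b,
    `|a - p| <= rho -> `|b - p| <= rho -> `|e a - e b| <= eps * `|a - b|.

Lemma strictly_smallN n k (e : 'cV[R]_n -> 'cV[R]_k) p :
  strictly_small e p -> strictly_small (fun a => - e a) p.
Proof.
move=> sme eps /sme[rho rho0 erho]; exists rho => // a b ar br.
by rewrite -opprD normrN; exact: erho.
Qed.

Lemma lip_homeo_at_perturbation n k (F e : 'cV[R]_n -> 'cV[R]_k) p :
  lip_homeo_at F p -> strictly_small e p ->
  lip_homeo_at (fun a => F a + e a) p.
Proof.
move=> /lip_homeo_at_shrink[L [rho [L0 rho0 lhF]]] sme.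
(* With this Lipschitz constant of [e] the contraction factor is 1/2, and the inverse of the
   perturbed map has Lipschitz constant [2 * L]. *)
have q0 : 0 < (2 * L)^-1 by rewrite invr_gt0 mulr_gt0.
set q := (2 * L)^-1 in q0.
have qL : q * L = 2^-1 by rewrite /q invfM mulfVK// gt_eqF.
have [rho1 rho10 lipe] := sme _ q0.
pose r := Num.min rho rho1.
have r0 : 0 < r by rewrite lt_min rho0.
have [||lipF surF] := lhF r => //; first by rewrite ge_min lexx.
have {}lipe a b : `|a - p| <= r -> `|b - p| <= r -> `|e a - e b| <= q * `|a - b|.
  by rewrite !le_min => /andP[_ ?] /andP[_ ?]; exact: lipe.
have addBB a b : (F a + e a) - (F b + e b) = (F a - F b) + (e a - e b).
  by rewrite opprD addrACA.
(* [3 * L + q] dominates both [2 * L] and [L + q]. Half of [r / L] is left for [y], since the other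
   half is the margin [q * r]. *)
exists (3 * L + q), r, (r / L / 2); split => //.
- by rewrite addr_gt0// mulr_gt0.
- by rewrite !divr_gt0.
- move=> a b ar br; have [lo hi] := lipF _ _ ar br; have le := lipe _ _ ar br.
  split; last first.
    rewrite addBB (le_trans (ler_normD _ _))// mulrDl lerD//.
    by rewrite (le_trans hi)// ler_wpM2r// ler_peMl ?ltW// ltr1n.
  have : `|F a - F b| <= `|(F a + e a) - (F b + e b)| + q * `|a - b|.
    rewrite -[F a - F b](addrK (e a - e b)) -addBB.
    by rewrite (le_trans (ler_normB _ _))// lerD2l.
  move=> /(ler_wpM2l (ltW L0)); rewrite mulrDr mulrA (mulrC L q) qL.
  move=> /(le_trans lo) lo'.
  have {}lo' : `|a - b| <= 2 * L * `|(F a + e a) - (F b + e b)| by lra.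
  rewrite (le_trans lo')// ler_wpM2r//.
  by have := L0; have := q0; lra.
- move=> y yr.
  apply: (lipschitz_perturbation_surj (L := L) (q := q) (s := r / L / 2)) => //.
  + exact: ltW.
  + exact: ltW.
  + exact: ltW.
  + by rewrite qL invf_lt1// ltr1n.
  + by move=> a b ar br; have [] := lipF _ _ ar br.
  + move=> z zr; apply: surF; rewrite (le_trans zr)//.
    by rewrite /q invfM le_eqVlt; apply/orP; left; apply/eqP; field; rewrite gt_eqF.
Qed.

End LocalHomeomorphisms.

(** * The normal map and strong regularity *)

Section NormalMap.
Context {R : realType} {N : nat}.
Variable I : pred 'I_N.
Implicit Types (p z nu eta : 'cV[R]_N) (Hm : 'cV[R]_N -> 'cV[R]_N).

Definition orthant : set 'cV[R]_N := [set z | forall i, I i -> 0 <= z i 0].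

Definition projK p : 'cV[R]_N :=
  \col_i (if I i then Num.max 0 (p i 0) else p i 0).

(* Robinson's normal map: its zeros p are in bijection with the solutions
   z = projK p of the generalized equation 0 \in Hm z + N_K z, the inverse
   bijection being z |-> z - Hm z. *)
Definition normal_map Hm p : 'cV[R]_N := Hm (projK p) + (p - projK p).

Lemma projK_lip a b : `|projK a - projK b| <= `|a - b|.
Proof.
apply: mx_norm_leP => // i j; rewrite ord1 !mxE.
have := ler_coord_norm (a - b) i 0; rewrite !mxE; set r := `|a - b|.
case: ifP => // _; move: (a i 0) (b i 0) r => x y r.
rewrite !ler_norml => /andP[? ?].
by apply/andP; split; rewrite !maxEle; case: ifP => ?; case: ifP => ?; lra.
Qed.

Lemma dotv_scale_delta nu (t : R) i : dotv nu (t *: delta_mx i 0) = nu i 0 * t.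
Proof.
rewrite dotvE (bigD1 i)//= big1 ?addr0 => [|j ji].
  by rewrite !mxE !eqxx mulr1.
by rewrite !mxE (negbTE ji) !mulr0.
Qed.

(** The variational characterization of the projection onto a convex set. The orthant is a product,
    so the cone inequality can be tested by moving one coordinate at a time. *)
Lemma normal_cone_orthantP z nu :
  normal_cone orthant z nu <-> projK (z + nu) = z.
Proof.
split=> [[Kz zn]|zE].
- have perturb i (t : R) : (I i -> 0 <= z i 0 + t) -> nu i 0 * t <= 0.
    move=> zt; rewrite -dotv_scale_delta.
    rewrite -[_ *: _](addrK z) [_ *: _ + z]addrC; apply: zn => j Ij.
    rewrite !mxE; have [ji|ji] := eqVneq j i.
      by rewrite mulr1 ji zt// -ji.
    by rewrite mulr0 addr0 Kz.
  apply/matrixP => i j; rewrite ord1 !mxE; case: ifP => Ii.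
    have nu0 : nu i 0 <= 0.
      by have := perturb i 1; rewrite mulr1; apply => _; rewrite addr_ge0 ?Kz.
    have := perturb i (- z i 0) (fun _ => _); rewrite subrr => /(_ (lexx _)).
    have := Kz _ Ii; move: (z i 0) (nu i 0) nu0 => x y y0 x0 xy.
    have : x * y = 0 by nra.
    move=> /eqP; rewrite mulf_eq0 => /orP[/eqP->|/eqP->].
      by rewrite add0r max_l.
    by rewrite addr0 max_r.
  (* A free coordinate may be moved by [nu i 0] itself, and then the square of [nu i 0] is at most
     0. *)
  have := perturb i (nu i 0); rewrite Ii => /(_ (fun F => False_ind _ (notF F))).
  rewrite -expr2 le_eqVlt ltNge sqr_ge0 orbF sqrf_eq0 => /eqP ->.
  by rewrite addr0.
- have zi i : z i 0 = projK (z + nu) i 0 by rewrite zE.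
  split=> [i Ii|z' Kz'].
    by have := zi i; rewrite mxE Ii => ->; rewrite le_max lexx.
  rewrite dotvE sumr_le0// => i _; rewrite !mxE.
  have := zi i; rewrite !mxE; case: ifP => Ii; last first.
    by move=> ?; rewrite (_ : nu i 0 = 0) ?mul0r//; lra.
  have := Kz' _ Ii; move: (z i 0) (z' i 0) (nu i 0) => x x' y x'0.
  by rewrite maxEle; case: ifP => ? ?; nra.
Qed.

Lemma normal_map_solves Hm p : solves_ge Hm orthant (normal_map Hm p) (projK p).
Proof.
by exists (p - projK p) => //; apply/normal_cone_orthantP; rewrite addrC subrK.
Qed.

Lemma solves_normal_map Hm eta z : solves_ge Hm orthant eta z ->
  projK (z + (eta - Hm z)) = z /\ normal_map Hm (z + (eta - Hm z)) = eta.
Proof.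
move=> [nu /normal_cone_orthantP zE ->].
rewrite [Hm z + nu]addrC addrK; split => //.
by rewrite /normal_map zE [z + nu]addrC addrK addrC.
Qed.

Lemma normal_map_eq0 Hm p : normal_map Hm p = 0 -> p = projK p - Hm (projK p).
Proof.
by move=> /eqP; rewrite addr_eq0 opprB => /eqP ->; rewrite subKr.
Qed.

Lemma normal_map_lip Hm (M : R) :
  (forall a b, `|Hm a - Hm b| <= M * `|a - b|) -> 0 <= M ->
  forall a b, `|normal_map Hm a - normal_map Hm b| <= (M + 2) * `|a - b|.
Proof.
move=> lipH M0 a b; rewrite /normal_map.
rewrite (_ : _ - _ = (Hm (projK a) - Hm (projK b))
    + ((a - b) - (projK a - projK b))); last first.
  by apply/matrixP => i j; rewrite !mxE; lra.
have := projK_lip a b; have := lipH (projK a) (projK b).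
have := ler_normD (Hm (projK a) - Hm (projK b)) ((a - b) - (projK a - projK b)).
have := ler_normB (a - b) (projK a - projK b).
have := ler_wpM2l M0 (projK_lip a b).
by lra.
Qed.

(** The solution map is the projection of the local inverse of the normal map. A second solution
    near [zs] would yield a second preimage of [eta] near [ps]. *)
Lemma lip_homeo_strongly_regular (La : 'cV[R]_N -> 'cV[R]_N) (M : R) zs ps :
  0 < M -> (forall a b, `|La a - La b| <= M * `|a - b|) ->
  projK ps = zs -> normal_map La ps = 0 ->
  lip_homeo_at (normal_map La) ps ->
  exists (delta eps : R) (zhat : 'cV[R]_N -> 'cV[R]_N),
    [/\ 0 < delta, 0 < eps,
        forall eta, eball 0 delta eta ->
          [/\ eball zs eps (zhat eta),
              solves_ge La orthant eta (zhat eta)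
            & forall z, eball zs eps z ->
                solves_ge La orthant eta z -> z = zhat eta]
      & lipschitz_in (eball 0 delta) zhat].
Proof.
move=> M0 lipLa pszs nps0 /lip_homeo_at_shrink[L [rho [L0 rho0]]].
move=> /(_ rho rho0 (lexx _))[]; rewrite nps0 => lipn surn.
have NL0 : 0 < N%:R * L + 1 by rewrite ltr_wpDl// mulr_ge0// ltW.
have M10 : 0 < 2 * (1 + M) by lra.
(* A solution [z] corresponds to [z + (eta - La z)], whose distance to [ps] is at most
   [(1 + M) * eps] plus the norm of [eta]; each of these is at most [rho / 2]. *)
pose eps := rho / (2 * (1 + M)).
have eps0 : 0 < eps by rewrite divr_gt0.
(* The three bounds serve, in order, the uniqueness estimate, the existence of a preimage, and the
   membership of [zhat eta] in the Euclidean ball of radius [eps]. *)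
pose delta := Num.min (Num.min (rho / 2) (rho / L)) (eps / (N%:R * L + 1)).
have delta0 : 0 < delta by rewrite !lt_min !divr_gt0.
have epsE : (1 + M) * eps = rho / 2 by rewrite /eps; field; lra.
have ball_delta eta : eball 0 delta eta ->
    [/\ `|eta| <= rho / 2, `|eta| <= rho / L & N%:R * L * `|eta| <= eps].
  rewrite /eball /= subr0 => /(le_trans (norm_le_enorm _)).
  rewrite !le_min -andbA => /and3P[? ? h]; split => //.
  move: h; rewrite ler_pdivlMr// => /(le_trans _); apply.
  by rewrite [_ * L * _]mulrC ler_wpM2l// lerDl.
pose phat eta := xget ps [set p | `|p - ps| <= rho /\ normal_map La p = eta].
have phatP eta : eball 0 delta eta ->
    `|phat eta - ps| <= rho /\ normal_map La (phat eta) = eta.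
  move=> /ball_delta[_ etaL _].
  apply: (@xgetPex _ ps [set p | `|p - ps| <= rho /\ normal_map La p = eta]).
  by have [|p pr pe] := surn eta; [rewrite subr0|exists p].
have psE : ps = zs - La zs by rewrite -pszs; exact: normal_map_eq0.
have psps : `|ps - ps| <= rho by rewrite subrr normr0 ltW.
exists delta, eps, (projK \o phat); split => //= [eta edelta|].
  have [pr pe] := phatP _ edelta; have [e1 e2 e3] := ball_delta _ edelta.
  split=> [||z zeps sz].
  - rewrite /eball /=.
    rewrite (le_trans (enorm_le_norm _))// -pszs.
    rewrite (le_trans _ e3)// -mulrA ler_wpM2l// (le_trans (projK_lip _ _))//.
    by have [+ _] := lipn _ _ pr psps; rewrite pe nps0 subr0.
  - by rewrite -{1}pe; exact: normal_map_solves.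
  - have [Pz nz] := solves_normal_map sz.
    set p := z + _ in Pz nz.
    have prho : `|p - ps| <= rho.
      rewrite /p psE (_ : _ - _ = (z - zs) + (eta - (La z - La zs))); last first.
        by apply/matrixP => i j; rewrite !mxE; lra.
      have zz : `|z - zs| <= eps by rewrite (le_trans (norm_le_enorm _)).
      have := ler_wpM2l (ltW M0) zz; have := lipLa z zs.
      have := ler_normB eta (La z - La zs).
      have := ler_normD (z - zs) (eta - (La z - La zs)).
      by lra.
    have [+ _] := lipn _ _ prho pr.
    rewrite nz pe subrr normr0 mulr0 normr_le0 subr_eq0 => /eqP <-.
    by rewrite Pz.
apply/lipschitz_inP; exists L => // a b /phatP[ar an] /phatP[br bn].
rewrite (le_trans (projK_lip _ _))//; have [+ _] := lipn _ _ ar br.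
by rewrite an bn.
Qed.

(** The map [phat] below inverts the normal map: existence of solutions gives surjectivity, and
    uniqueness identifies every [p] near [ps] with [phat] of its image, which gives the lower
    Lipschitz bound. *)
Lemma strongly_regular_lip_homeo (La : 'cV[R]_N -> 'cV[R]_N) (M : R) zs ps
    (delta eps : R) (zhat : 'cV[R]_N -> 'cV[R]_N) :
  0 < M -> (forall a b, `|La a - La b| <= M * `|a - b|) ->
  projK ps = zs -> normal_map La ps = 0 ->
  0 < delta -> 0 < eps ->
  (forall eta, eball 0 delta eta ->
    [/\ eball zs eps (zhat eta), solves_ge La orthant eta (zhat eta)
      & forall z, eball zs eps z ->
          solves_ge La orthant eta z -> z = zhat eta]) ->
  lipschitz_in (eball 0 delta) zhat ->
  lip_homeo_at (normal_map La) ps.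
Proof.
move=> M0 lipLa pszs nps0 delta0 eps0 zhatP /lipschitz_inP[Lz Lz0 lipz].
have lipn := normal_map_lip lipLa (ltW M0).
pose phat eta := zhat eta + (eta - La (zhat eta)).
have ball0 : eball (0 : 'cV[R]_N) delta 0.
  by rewrite /eball /= subr0 (le_trans (enorm_le_norm _))// normr0 mulr0 ltW.
have psE : ps = zs - La zs by rewrite -pszs; exact: normal_map_eq0.
have zhat0 : zhat 0 = zs.
  have [_ _ uniq0] := zhatP _ ball0; apply/esym/uniq0.
    by rewrite /eball /= subrr (le_trans (enorm_le_norm _))// normr0 mulr0 ltW.
  by rewrite -pszs -{1}nps0; exact: normal_map_solves.
have phat0 : phat 0 = ps by rewrite /phat zhat0 psE sub0r.
pose L1 := Lz + 1 + M * Lz.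
have L10 : 0 < L1 by rewrite !addr_gt0// mulr_gt0.
have lipp a b : eball 0 delta a -> eball 0 delta b ->
    `|phat a - phat b| <= L1 * `|a - b|.
  move=> ad bd; rewrite /phat (_ : _ - _ = (zhat a - zhat b)
    + ((a - b) - (La (zhat a) - La (zhat b)))); last first.
    by apply/matrixP => i j; rewrite !mxE; lra.
  have := ler_wpM2l (ltW M0) (lipz _ _ ad bd).
  have := lipLa (zhat a) (zhat b); have := lipz _ _ ad bd.
  have := ler_normB (a - b) (La (zhat a) - La (zhat b)).
  have := ler_normD (zhat a - zhat b) ((a - b) - (La (zhat a) - La (zhat b))).
  by rewrite /L1; lra.
have NM : 0 < N%:R * (M + 2) + 1 by rewrite ltr_wpDl// mulr_ge0//; lra.
(* Small enough that the normal map sends the ball around [ps] into the Euclidean ball of radius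
   [delta], and the projection sends it into the one of radius [eps] around [zs]. *)
pose rho := Num.min delta eps / (N%:R * (M + 2) + 1).
have rho0 : 0 < rho by rewrite divr_gt0// lt_min delta0.
have rhoE : (N%:R * (M + 2) + 1) * rho = Num.min delta eps.
  by rewrite mulrC divfK// gt_eqF.
have [rhod rhoe] : N%:R * (M + 2) * rho <= delta /\ N%:R * rho <= eps.
  have h : N%:R * (M + 2) * rho <= Num.min delta eps.
    by rewrite -rhoE ler_wpM2r ?lerDl// ltW.
  move: h; rewrite le_min => /andP[-> h]; split => //.
  rewrite (le_trans _ h)// ler_wpM2r ?(ltW rho0)//.
  by rewrite ler_peMr//; lra.
have near_ps p : `|p - ps| <= rho ->
    eball 0 delta (normal_map La p) /\ p = phat (normal_map La p).
  move=> pr; have dp : eball 0 delta (normal_map La p).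
    rewrite /eball /= (le_trans (enorm_le_norm _))// (le_trans _ rhod)//.
    rewrite -mulrA ler_wpM2l// -nps0 (le_trans (lipn _ _))//.
    by rewrite ler_wpM2l//; lra.
  split => //; have [_ _ uni] := zhatP _ dp.
  rewrite /phat -(uni (projK p)); last exact: normal_map_solves.
    by rewrite /normal_map [La _ + _]addrC addrK addrC subrK.
  rewrite /eball /= (le_trans (enorm_le_norm _))// (le_trans _ rhoe)//.
  by rewrite ler_wpM2l// -pszs (le_trans (projK_lip _ _)).
exists (L1 + (M + 2)), rho, (Num.min (delta / (N%:R + 1)) (rho / L1)); split => //.
- by rewrite addr_gt0// addr_gt0.
- by rewrite lt_min (divr_gt0 rho0 L10) (divr_gt0 delta0) ?ltr_wpDl.
- move=> a b /near_ps[ad aE] /near_ps[bd bE]; split.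
    rewrite {1}aE {1}bE (le_trans (lipp _ _ ad bd))// ler_wpM2r//.
    by rewrite lerDl addr_ge0// ltW.
  by rewrite (le_trans (lipn _ _))// ler_wpM2r// lerDr ltW.
- move=> y; rewrite nps0 subr0 le_min => /andP[yd yr].
  have dy : eball 0 delta y.
    rewrite /eball /= subr0 (le_trans (enorm_le_norm _))//.
    move: yd; rewrite ler_pdivlMr ?ltr_wpDl// => /(le_trans _); apply.
    by rewrite mulrC ler_wpM2l// lerDl.
  have [_ sy _] := zhatP _ dy.
  exists (phat y); last by have [] := solves_normal_map sy.
  rewrite -phat0 (le_trans (lipp _ _ dy ball0))// subr0 mulrC.
  by rewrite -ler_pdivlMr.
Qed.

(** The projection is nonexpansive, so a small Lipschitz constant survives the composition even
    where the projection has a kink. *)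
Lemma strictly_small_projK (e : 'cV[R]_N -> 'cV[R]_N) ps :
  strictly_small e (projK ps) -> strictly_small (e \o projK) ps.
Proof.
move=> sme eps eps0; have [rho rho0 erho] := sme _ eps0.
exists rho => // a b ar br /=.
rewrite (le_trans (erho _ _ _ _)) ?(le_trans (projK_lip _ _))//.
by rewrite ler_wpM2l ?(ltW eps0) ?projK_lip.
Qed.

Lemma lip_homeo_normal_map Hm La ps :
  strictly_small (fun z => Hm z - La z) (projK ps) ->
  lip_homeo_at (normal_map Hm) ps <-> lip_homeo_at (normal_map La) ps.
Proof.
move=> /strictly_small_projK sme; split => lh.
  have := lip_homeo_at_perturbation lh (strictly_smallN sme).
  congr (lip_homeo_at _ _); apply/funext => p /=.
  by apply/matrixP => i j; rewrite !mxE; lra.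
have := lip_homeo_at_perturbation lh sme.
congr (lip_homeo_at _ _); apply/funext => p /=.
by apply/matrixP => i j; rewrite !mxE; lra.
Qed.

Lemma lip_homeo_normal_mapP Hm ps zs :
  projK ps = zs -> normal_map Hm ps = 0 ->
  strictly_small (fun z => Hm z - linearization Hm zs z) zs ->
  lip_homeo_at (normal_map Hm) ps <-> strongly_regular Hm orthant zs.
Proof.
move=> pszs n0 sme; set La := linearization Hm zs.
have LaE : La zs = Hm zs by rewrite /La /linearization subrr mulmx0 addr0.
have nLa0 : normal_map La ps = 0.
  by rewrite -n0 /normal_map pszs LaE.
have M0 : 0 < N%:R * `|jac Hm zs| + 1 by rewrite ltr_wpDl// mulr_ge0.
have lipLa a b : `|La a - La b| <= (N%:R * `|jac Hm zs| + 1) * `|a - b|.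
  rewrite /La /linearization.
  rewrite opprD addrACA subrr add0r -mulmxBr opprB addrA subrK.
  by rewrite (le_trans (ler_norm_mulmx _ _))// ler_wpM2r// lerDl.
rewrite (@lip_homeo_normal_map Hm La ps); last by rewrite pszs.
split=> [lh|[_ [delta [eps [zhat [d0 e0 zP lipz]]]]]].
  split; first by rewrite -pszs -n0; exact: normal_map_solves.
  exact: (lip_homeo_strongly_regular M0 lipLa pszs nLa0 lh).
exact: (strongly_regular_lip_homeo M0 lipLa pszs nLa0 d0 e0 zP lipz).
Qed.

End NormalMap.

(** * Strict derivatives, Jacobians and limits of matrices *)

Section StrictDerivatives.
Context {R : realType}.

Lemma strictly_small_near n k (e1 e2 : 'cV[R]_n -> 'cV[R]_k) p :
  (\forall a \near p, e1 a = e2 a) -> strictly_small e1 p ->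
  strictly_small e2 p.
Proof.
move=> /nbhs_ballP[r /= r0 re] sme eps /sme[rho rho0 erho].
have inr a : `|a - p| <= Num.min rho (r / 2) -> `|a - p| <= rho /\ e1 a = e2 a.
  rewrite le_min => /andP[-> ar]; split => //; apply: re.
  rewrite -ball_normE /= distrC (le_lt_trans ar)//.
  by rewrite ltr_pdivrMr// mulr_natr mulr2n ltrDr.
exists (Num.min rho (r / 2)); first by rewrite lt_min rho0 divr_gt0.
by move=> a b /inr[ar <-] /inr[br <-]; exact: erho.
Qed.

Lemma strictly_smallD_cst n k (e : 'cV[R]_n -> 'cV[R]_k) c p :
  strictly_small e p -> strictly_small (fun a => e a + c) p.
Proof.
move=> sme eps /sme[rho rho0 erho]; exists rho => // a b ar br.
by rewrite opprD addrACA subrr addr0; exact: erho.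
Qed.

(** The strict estimate is applied to [p] and its translate by [h] along a basis vector, then
    divided by [h]. *)
Lemma strict_derivative_jac n k (F : 'cV[R]_n -> 'cV[R]_k) A p :
  strictly_small (fun z => F z - A *m z) p -> jac F p = A.
Proof.
move=> smF; apply/matrixP => i j; rewrite mxE /pderiv.
apply: cvg_lim => //; apply/cvgrPdist_le => /= eps eps0.
have [rho rho0 Frho] := smF _ eps0.
near=> h.
have h0 : h != 0 by near: h; exact: nbhs_dnbhs_neq.
have dl1 : `|h *: delta_mx j 0 : 'cV[R]_n| <= `|h|.
  apply: mx_norm_leP => // i' j'; rewrite !mxE normrM ler_piMr//.
  by case: (_ && _); rewrite ?normr1 ?normr0.
have hr : `|h *: delta_mx j 0 + p - p| <= rho.
  rewrite addrK (le_trans dl1)//; near: h; exact: dnbhs0_le.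
have := Frho _ _ hr (_ : `|p - p| <= rho).
rewrite subrr normr0 => /(_ (ltW rho0)); set d := h *: delta_mx j 0.
set D := (X in `|X| <= _) => Dle.
have := ler_coord_norm D i 0; move=> /le_trans/(_ Dle).
rewrite addrK => /le_trans/(_ (ler_wpM2l (ltW eps0) dl1)).
have -> : D i 0 = F (d + p) i 0 - F p i 0 - h * A i j.
  have -> : D = F (d + p) - F p - A *m d.
    by rewrite /D mulmxDr; apply/matrixP => i' j'; rewrite !mxE; lra.
  by rewrite /d -scalemxAr -colE !mxE.
move=> Dh; rewrite distrC.
rewrite (_ : _ - _ = h^-1 * (F (d + p) i 0 - F p i 0 - h * A i j)); last first.
  by rewrite mulrBr mulKf.
rewrite normrM normfV ler_pdivrMl ?normr_gt0 //.
by rewrite [leRHS]mulrC.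
Unshelve. all: by end_near. Qed.

Lemma mulmx_continuous m n p (A : 'M[R]_(m, n)) :
  continuous (fun B : 'M[R]_(n, p) => A *m B).
Proof.
move=> B; apply/(@cvgrPdist_le _ _ _ (nbhs B)) => eps eps0.
have c0 : 0 < n%:R * `|A| + 1 by rewrite ltr_wpDl// mulr_ge0.
apply/nbhs_ballP; exists (eps / (n%:R * `|A| + 1)); first by rewrite /= divr_gt0.
move=> C; rewrite -ball_normE /= => /ltW BC.
rewrite -mulmxBr (le_trans (ler_norm_mulmx _ _))//.
move: BC; rewrite ler_pdivlMr// => /(le_trans _); apply.
by rewrite mulrC ler_wpM2l// lerDl.
Qed.

Lemma strict_derivative_differentiable n k (F : 'cV[R]_n -> 'cV[R]_k) A p :
  strictly_small (fun z => F z - A *m z) p -> differentiable F p.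
Proof.
move=> smF.
have litF : F \o shift p = cst (F p) + (mulmx A : {linear _ -> _}) +o_ 0 id.
  apply/eqaddoP => eps eps0; have [rho rho0 Frho] := smF _ eps0.
  have : \forall d \near (0 : 'cV[R]_n), `|d| <= rho by exact: nbhs0_le.
  apply: filterS => d /= d_rho.
  have dr : `|d + p - p| <= rho by rewrite addrK.
  have := Frho _ _ dr (_ : `|p - p| <= rho).
  rewrite subrr normr0 => /(_ (ltW rho0)); rewrite addrK.
  congr (_ <= _); congr (`| _ |); rewrite -[RHS]/(F (d + p) - (F p + A *m d)).
  by rewrite mulmxDr; apply/matrixP => i j; rewrite !mxE; lra.
have dF : 'd F p = (mulmx A : {linear _ -> _}) :> (_ -> _).
  by apply: diff_unique litF; exact: mulmx_continuous.
by apply/diff_locallyP; rewrite dF; split => //; exact: mulmx_continuous.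
Qed.

Lemma mx_cvg m n (T : Type) (G : set_system T) (FG : Filter G)
    (M : T -> 'M[R]_(m, n)) (L : 'M[R]_(m, n)) :
  (forall i j, M x i j @[x --> G] --> L i j) -> M x @[x --> G] --> L.
Proof.
move=> ML; apply/cvgrPdist_le => /= eps eps0.
have : \forall x \near G, forall ij : 'I_m * 'I_n,
    `|L ij.1 ij.2 - M x ij.1 ij.2| <= eps.
  by apply: filter_forall => -[i j] /=; move/cvgrPdist_le : (ML i j); exact.
apply: filterS => x xe; apply: mx_norm_leP => [|i j]; first exact: ltW.
by rewrite !mxE; exact: (xe (i, j)).
Qed.

Lemma cvg_sum_ord n (T : Type) (G : set_system T) (FG : Filter G)
    (f : 'I_n -> T -> R) (l : 'I_n -> R) :
  (forall i, f i x @[x --> G] --> l i) ->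
  (\sum_i f i x) @[x --> G] --> \sum_i l i.
Proof.
elim: n f l => [|n IH] f l fl.
  rewrite big_ord0 (_ : (fun _ => _) = cst 0); first exact: cvg_cst.
  by apply/funext => x; rewrite big_ord0.
rewrite big_ord_recl (_ : (fun _ => _) =
  (fun x => f ord0 x + \sum_(i < n) f (lift ord0 i) x)); last first.
  by apply/funext => x; rewrite big_ord_recl.
by apply: cvgD; [exact: fl|apply: IH => i; exact: fl].
Qed.

End StrictDerivatives.

(** * Convexity of the convex hull *)

Section ConvexHull.
Context {R : realType} {V : lmodType R}.

Lemma subset_convex_hull (C : set V) : C `<=` convex_hull C.
Proof.
move=> v Cv; exists 1%N, (fun=> v), (fun=> 1); split => //.
  by rewrite big_ord1.
by rewrite big_ord1 scale1r.
Qed.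

Lemma convex_hull_convex (C : set V) (v w : V) (t : R) : 0 <= t -> t <= 1 ->
  convex_hull C v -> convex_hull C w -> convex_hull C (t *: v + (1 - t) *: w).
Proof.
move=> t0 t1 [k [c [s [Cc s0 s1 ->]]]] [k' [c' [s' [Cc' s0' s1' ->]]]].
exists (k + k')%N, (fun i => match fintype.split i with inl j => c j | inr j => c' j end),
  (fun i => match fintype.split i with inl j => t * s j | inr j => (1 - t) * s' j end).
split=> [i|i||].
- by case: (fintype.split i).
- by case: (fintype.split i) => j; rewrite mulr_ge0 ?subr_ge0.
- rewrite big_split_ord /=.
  under eq_bigr do rewrite (unsplitK (inl _)).
  under [X in _ + X]eq_bigr do rewrite (unsplitK (inr _)).
  by rewrite -!mulr_sumr s1 s1' !mulr1 addrC subrK.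
- rewrite big_split_ord /=; congr (_ + _); rewrite scaler_sumr.
    by apply: eq_bigr => i _; rewrite (unsplitK (inl _)) scalerA.
  by apply: eq_bigr => i _; rewrite (unsplitK (inr _)) scalerA.
Qed.

End ConvexHull.

(** * The piecewise linear model of the normal map *)

Section NormalMapPieces.
Context {R : realType} {N : nat}.
Variables (I : pred 'I_N) (A : 'M[R]_N) (ps : 'cV[R]_N).
Implicit Types (p q d : 'cV[R]_N) (a : 'rV[R]_N) (t : R).

(** The coordinates in which the projection has a kink at [ps]. *)
Definition degenerate i := I i && (ps i 0 == 0).

(** The slope of the projection at [ps] in a coordinate without kink. *)
Definition side i : R := (~~ I i || (0 < ps i 0))%:R.

(* The diagonals of the generalized Jacobians of the projection at ps. *)
Definition face : set 'rV[R]_N := [set a | forall i,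
  (if degenerate i then `[0, 1]%classic else [set side i]) (a 0 i)].

(** The chain rule for [normal_map]: if the projection has slope matrix D and the inner map has
    derivative A, the result is A D + 1 - D. *)
Definition Jmx a : 'M[R]_N := 1%:M + (A - 1%:M) *m diag_mx a.

(* Pt 1 coincides with the projection near ps, while Pt 0 is linear. *)
Definition Pt t p : 'cV[R]_N := \col_i
  (if degenerate i then (1 - t) * p i 0 + t * Num.max 0 (p i 0)
   else side i * p i 0).

(** Near [ps], [Psi 1] is the normal map of the linear map given by [A]. *)
Definition Psi t p := p + (A - 1%:M) *m Pt t p.

Lemma faceP a i : face a -> 0 <= a 0 i <= 1 /\ (~~ degenerate i -> a 0 i = side i).
Proof.
move=> /(_ i); case: ifP => _ /=; first by rewrite in_itv /=.
move=> ->; split => //; rewrite /side.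
by case: (_ || _); rewrite ?lexx ?ler01.
Qed.

Lemma max0_secant (x y : R) : exists2 s, 0 <= s <= 1 &
  Num.max 0 x - Num.max 0 y = s * (x - y).
Proof.
have [x0|x0] := leP 0 x; have [y0|y0] := leP 0 y.
- by exists 1; lra.
- exists (x / (x - y)); last by rewrite divfK; lra.
  by rewrite divr_ge0 ?ler_pdivrMr; lra.
- exists (y / (y - x)); last by rewrite -[x - y]opprB mulrN divfK; lra.
  by rewrite divr_ge0 ?ler_pdivrMr; lra.
- by exists 0; lra.
Qed.

Lemma Pt_secant t p q : 0 <= t <= 1 ->
  exists2 a, face a & Pt t p - Pt t q = diag_mx a *m (p - q).
Proof.
move=> t01.
have /choice[s sP] : forall i, exists s : R,
    (if degenerate i then `[0, 1]%classic else [set side i]) s /\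
    Pt t p i 0 - Pt t q i 0 = s * (p i 0 - q i 0).
  move=> i; rewrite !mxE; case: ifP => di; last by exists (side i); rewrite mulrBr.
  have [s s01 sE] := max0_secant (p i 0) (q i 0).
  exists (1 - t + t * s); split.
    case/andP: s01 => s0 s1; case/andP: t01 => t0 t1.
    by rewrite /= in_itv /=; apply/andP; split; nra.
  by rewrite [RHS]mulrDl -[t * s * _]mulrA -sE; ring.
exists (\row_i s i) => [i|]; first by rewrite mxE; have [] := sP i.
apply/matrixP => i j; rewrite ord1 mul_diag_mx mxE [RHS]mxE [in RHS]mxE.
by have [_ E] := sP i; rewrite [X in _ + X]mxE E !mxE.
Qed.

Lemma projK_near : \forall p \near ps, projK I p = Pt 1 p.
Proof.
have : \forall p \near ps, forall i, projK I p i 0 = Pt 1 p i 0.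
  apply: (@filter_forall _ _ (fun i p => projK I p i 0 = Pt 1 p i 0) (nbhs ps) _) => i.
  have ci := @coord_continuous R N 1 i 0 ps.
  have [Ii|nIi] := boolP (I i); last first.
    by apply: nearW => p; rewrite !mxE /degenerate /side (negbTE nIi) /= mul1r.
  have [p0|p0|p0] := ltgtP (ps i 0) 0.
  - have : nbhs ps [set p : 'cV[R]_N | p i 0 < 0] by exact: cvgr_lt ci _ p0.
    apply: filterS => p pi0.
    rewrite !mxE /degenerate /side Ii /= (lt_eqF p0) /= ltNge (ltW p0) /=.
    by rewrite mul0r max_l// ltW.
  - have : nbhs ps [set p : 'cV[R]_N | 0 < p i 0] by exact: cvgr_gt ci _ p0.
    apply: filterS => p pi0.
    by rewrite !mxE /degenerate /side Ii /= (gt_eqF p0) p0 mul1r max_r// ltW.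
  - apply: nearW => p; rewrite !mxE /degenerate Ii p0 eqxx /=.
    by rewrite subrr mul0r add0r mul1r.
apply: filterS => p pE; apply/matrixP => i j; rewrite ord1; exact: pE.
Qed.

(** A mean value formula with one matrix: each coordinate of [Pt] has its secant slopes in the
    corresponding side of the box [face], and the sides can be chosen independently. The formula
    holds for all pairs [p], [q], so the bounds derived from it are global. *)
Lemma Psi_secant t p q : 0 <= t <= 1 ->
  exists2 a, face a & Psi t p - Psi t q = Jmx a *m (p - q).
Proof.
move=> /(Pt_secant p q)[a fa aE]; exists a => //.
rewrite /Jmx mulmxDl mul1mx -mulmxA -aE mulmxBr /Psi.
by rewrite opprD addrACA.
Qed.

Lemma JmxE a i j : Jmx a i j = (i == j)%:R + (A i j - (i == j)%:R) * a 0 j.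
Proof. by rewrite /Jmx mul_mx_diag !mxE. Qed.

Lemma face_compact : compact face.
Proof.
apply: (@rV_compact R N
  (fun i => if degenerate i then `[0, 1]%classic else [set side i])) => i.
by case: ifP => _; [exact: segment_compact|exact: compact_set1].
Qed.

Lemma Jmx_cvg (T : Type) (G : set_system T) (FG : Filter G) (u : T -> 'rV[R]_N)
    a : u x @[x --> G] --> a -> Jmx (u x) @[x --> G] --> Jmx a.
Proof.
move=> ua; apply: mx_cvg => i j; rewrite JmxE.
rewrite (_ : (fun _ => _) =
    fun x => (i == j)%:R + (A i j - (i == j)%:R) * u x 0 j); last first.
  by apply/funext => x; rewrite JmxE.
apply: cvgD; first exact: cvg_cst.
apply: cvgM; first exact: cvg_cst.
exact: (cvg_comp _ _ ua (@coord_continuous R 1 N 0 j a)).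
Qed.

Lemma norm_trmx m n (B : 'M[R]_(m, n)) : `|B^T| = `|B|.
Proof.
apply/eqP; rewrite eq_le; apply/andP; split.
  by apply: mx_norm_leP => // i j; rewrite mxE ler_coord_norm.
by apply: mx_norm_leP => // i j; have := ler_coord_norm B^T j i; rewrite mxE.
Qed.

(** The constant is the minimum of the norm of [Jmx a *m d] over the compact set of pairs of a point
    of the face and a unit vector; it is positive by nonsingularity. *)
Lemma Jmx_lower_bound : (forall a, face a -> Jmx a \in unitmx) ->
  exists2 c : R, 0 < c & forall a d, face a -> c * `|d| <= `|Jmx a *m d|.
Proof.
move=> unitJ.
pose sphere := [set d : 'rV[R]_N | `|d| = 1].
(* The sphere is empty in dimension 0; then every [d] is 0 and any constant serves. *)
have [[d0 d01]|nosphere] := pselect (sphere !=set0); last first.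
  exists 1 => // a d _; have [->|d0] := eqVneq d 0.
    by rewrite mulmx0 !normr0 mulr0.
  exfalso; apply: nosphere; exists (`|d|^-1 *: d^T).
  rewrite /sphere /= normrZ normfV normr_id norm_trmx mulVf//.
  by rewrite normr_eq0.
have cs : compact sphere.
  apply: bounded_closed_compact.
    by exists 1; split => // x x1 d /= ->; exact: ltW.
  apply: (@preimage_closed _ _ (fun d : 'rV[R]_N => `|d|) [set 1]).
    by move=> d _; exact: norm_continuous.
  exact: closed_eq.
pose f (x : 'rV[R]_N * 'rV[R]_N) : R := `|Jmx x.1 *m x.2^T|.
have cf : continuous f.
  move=> [a d]; apply: cvg_norm; apply: mx_cvg => i j /=.
  rewrite mxE (_ : (fun _ => _) = fun x : 'rV[R]_N * 'rV[R]_N =>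
      \sum_k Jmx x.1 i k * x.2 j k); last first.
    by apply/funext => x; rewrite mxE; under eq_bigr do rewrite [_^T _ _]mxE.
  under eq_bigr do rewrite [_^T _ _]mxE.
  apply: cvg_sum_ord => k; apply: cvgM.
    have ja : Jmx x.1 @[x --> nbhs (a, d)] --> Jmx a by apply: Jmx_cvg; exact: cvg_fst.
    exact: (cvg_comp _ _ ja (@coord_continuous R N N i k (Jmx a))).
  have sd : x.2 @[x --> nbhs (a, d)] --> d by exact: cvg_snd.
  exact: (cvg_comp _ _ sd (@coord_continuous R 1 N j k d)).
pose a0 : 'rV[R]_N := \row_i (if degenerate i then 0 else side i).
have fa0 : face a0.
  move=> i; rewrite mxE; case: ifP => //= _.
  by rewrite in_itv /= lexx ler01.
have [|||[a1 d1]] := @compact_EVT_min _ R f (face `*` sphere).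
- by exists (a0, d0).
- by apply: compact_setX => //; exact: face_compact.
- exact: continuous_subspaceT.
rewrite inE => -[/= fa1 d11] minf.
exists (f (a1, d1)).
  rewrite normr_gt0 /=; apply/eqP => /(congr1 (mulmx (invmx (Jmx a1)))).
  rewrite mulKmx ?unitJ// mulmx0 => /(congr1 trmx); rewrite trmxK trmx0 => d10.
  by move: d11; rewrite /sphere /= d10 normr0 => /esym/eqP; rewrite oner_eq0.
move=> a d fa; have [->|d0'] := eqVneq d 0.
  by rewrite mulmx0 !normr0 mulr0.
have dn0 : 0 < `|d| by rewrite normr_gt0.
have : f (a1, d1) <= f (a, `|d|^-1 *: d^T).
  apply: minf; rewrite inE; split => //=.
  rewrite /sphere /= normrZ normfV normr_id norm_trmx mulVf//.
  by rewrite normr_eq0.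
rewrite {2}/f /= linearZ /= trmxK -scalemxAr normrZ normfV normr_id.
by rewrite ler_pdivlMl// mulrC.
Qed.

Lemma Pt_lip t p q : 0 <= t <= 1 -> `|Pt t p - Pt t q| <= `|p - q|.
Proof.
move=> /(Pt_secant p q)[a fa ->]; apply: mx_norm_leP => // i j.
rewrite mul_diag_mx mxE normrM (le_trans _ (ler_coord_norm (p - q) i j))//.
have [/andP[a0 a1] _] := faceP i fa.
by rewrite ler_piMl// ger0_norm.
Qed.

Let kappa := N%:R * `|A - 1%:M|.

Lemma Psi_lip t p q : 0 <= t <= 1 ->
  `|Psi t p - Psi t q| <= (1 + kappa) * `|p - q|.
Proof.
move=> t01; rewrite /Psi opprD addrACA -mulmxBr mulrDl mul1r.
rewrite (le_trans (ler_normD _ _))// lerD2l.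
rewrite (le_trans (ler_norm_mulmx _ _))// ler_wpM2l ?mulr_ge0//.
exact: Pt_lip.
Qed.

(* Continuation in t: Psi 0 is a bijective linear map, and one step of size s
   perturbs Psi t by a map with Lipschitz constant s * kappa, while the inverse
   of Psi t is Lipschitz uniformly in t. *)
Lemma Psi_surj (c : R) : 0 < c ->
  (forall a d, face a -> c * `|d| <= `|Jmx a *m d|) ->
  (forall a, face a -> Jmx a \in unitmx) ->
  forall y, exists p, Psi 1 p = y.
Proof.
move=> c0 lowJ unitJ.
(* The number of steps exceeds [kappa / c], so that one step of size [1 / K] has contraction factor
   [s * kappa / c] below 1. *)
pose K := (Num.trunc (kappa / c)).+1.
have K0 : 0 < K%:R :> R by rewrite ltr0n.
have kappa0 : 0 <= kappa by rewrite mulr_ge0.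
have kK : kappa / c < K%:R by rewrite /K truncnS_gt.
pose s : R := K%:R^-1.
have s0 : 0 < s by rewrite invr_gt0.
suff : forall k : nat, (k <= K)%N -> forall y, exists p, Psi (k%:R / K%:R) p = y.
  by move=> /(_ K (leqnn K)); rewrite divff// gt_eqF.
elim=> [_ y|k IH kK1 y].
  (* With slope 1 in the degenerate coordinates, [Jmx a] is the matrix of [Psi 0]. *)
  pose a : 'rV[R]_N := \row_i (if degenerate i then 1 else side i).
  have fa : face a.
    move=> i; rewrite mxE; case: ifP => //= _.
    by rewrite in_itv /= lexx ler01.
  have [v vE] : exists v, Jmx a *m v = y.
    by exists (invmx (Jmx a) *m y); rewrite mulKVmx ?unitJ.
  exists v; rewrite -vE mul0r /Psi /Jmx mulmxDl mul1mx; congr (_ + _).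
  rewrite -mulmxA; congr (_ *m _); rewrite mul_diag_mx; apply/matrixP => i j.
  rewrite ord1 !mxE; case: ifP => _ //.
  by rewrite subr0 mul0r addr0.
have t01 : (0 <= k%:R / K%:R :> R) && (k%:R / K%:R <= 1 :> R).
  apply/andP; split; first exact: divr_ge0.
  by rewrite ler_pdivrMr// mul1r ler_nat ltnW.
set t := k%:R / K%:R in IH t01.
have tE : k.+1%:R / K%:R = t + s :> R by rewrite -natr1 mulrDl mul1r.
(* The derivative of [Pt t p] with respect to [t]; it is nonexpansive in [p]. *)
pose Q p : 'cV[R]_N :=
  \col_i (if degenerate i then Num.max 0 (p i 0) - p i 0 else 0).
have lipQ p q : `|Q p - Q q| <= `|p - q|.
  apply: mx_norm_leP => // i j; rewrite ord1 !mxE.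
  have := ler_coord_norm (p - q) i 0; rewrite !mxE; set r := `|p - q|.
  case: ifP => _; last by rewrite subrr normr0 => /(le_trans _); apply.
  move: (p i 0) (q i 0) r => x x' r; rewrite !ler_norml => /andP[? ?].
  by apply/andP; split; rewrite !maxEle; case: ifP => ?; case: ifP => ?; lra.
pose e p := s *: ((A - 1%:M) *m Q p).
have PsiE p : Psi (k.+1%:R / K%:R) p = Psi t p + e p.
  rewrite tE /Psi -addrA; congr (_ + _).
  rewrite /e scalemxAr -mulmxDr; congr (_ *m _).
  by apply/matrixP => i j; rewrite ord1 !mxE; case: ifP => _; ring.
have q1 : s * kappa * c^-1 < 1.
  by rewrite -mulrA /s mulrC ltr_pdivrMr// mul1r.
have lowPsi p q : `|p - q| <= c^-1 * `|Psi t p - Psi t q|.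
  have [a' fa' ->] := Psi_secant p q t01.
  by rewrite ler_pdivlMl//; exact: lowJ.
pose sg := `|y - (Psi t 0 + e 0)|.
(* The solution of [r = (sg + s * kappa * r) / c]: the ball of this radius contains all the
   preimages that the fixed point argument requires, however far away [y] is. *)
pose r := c^-1 * sg / (1 - s * kappa * c^-1).
have d0 : 0 < 1 - s * kappa * c^-1 by rewrite subr_gt0.
have r0 : 0 <= r.
  by rewrite divr_ge0 ?(ltW d0)// mulr_ge0 ?normr_ge0// invr_ge0 (ltW c0).
have rE : c^-1 * (sg + s * kappa * r) = r.
  have : r * (1 - s * kappa * c^-1) = c^-1 * sg by rewrite /r divfK// gt_eqF.
  by move=> rE; rewrite mulrDr -rE; ring.
have [||||||||a _ aE] := @lipschitz_perturbation_surj R N N (Psi t) e 0 y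
   r c^-1 (s * kappa) sg.
- exact: r0.
- by rewrite invr_ge0 ltW.
- by rewrite mulr_ge0// ltW.
- exact: q1.
- by move=> a b _ _; exact: lowPsi.
- move=> z zr; have [|a aE] := IH _ z; first exact: ltnW.
  exists a => //; rewrite (le_trans (lowPsi _ _))// aE -[leRHS]rE.
  by rewrite ler_wpM2l// invr_ge0 ltW.
- move=> a b _ _; rewrite /e -scalerBr -mulmxBr normrZ (ger0_norm (ltW s0)) -mulrA.
  rewrite ler_wpM2l ?(ltW s0)// (le_trans (ler_norm_mulmx _ _))//.
  by rewrite ler_wpM2l ?lipQ.
- exact: lexx.
by exists a; rewrite PsiE.
Qed.

Lemma Psi_lip_homeo : (forall a, face a -> Jmx a \in unitmx) ->
  lip_homeo_at (Psi 1) ps.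
Proof.
move=> unitJ; have [c c0 lowJ] := Jmx_lower_bound unitJ.
have surP := Psi_surj c0 lowJ unitJ.
have t01 : (0 <= 1 :> R) && (1 <= 1 :> R) by rewrite ler01 lexx.
have kappa0 : 0 <= kappa by rewrite mulr_ge0.
have low p q : `|p - q| <= c^-1 * `|Psi 1 p - Psi 1 q|.
  have [a' fa' ->] := Psi_secant p q t01.
  by rewrite ler_pdivlMl//; exact: lowJ.
have ci0 : 0 < c^-1 by rewrite invr_gt0.
(* The bounds on [Psi 1] are global, so the radius 1 is arbitrary; preimages of points at distance
   at most [c] then lie at distance at most 1. *)
exists (c^-1 + (1 + kappa)), 1, c; split => //.
- by rewrite addr_gt0// ltr_pwDl.
- move=> a b _ _; split.
    rewrite (le_trans (low a b))// ler_wpM2r// lerDl.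
    by rewrite addr_ge0.
  by rewrite (le_trans (Psi_lip _ _ t01))// ler_wpM2r// lerDr ltW.
- move=> y yc; have [a aE] := surP y; exists a => //.
  by rewrite (le_trans (low _ _))// aE ler_pdivrMl// mulr1.
Qed.

End NormalMapPieces.

(** * The Clarke subdifferential of the normal map *)

Section ClarkeNormalMap.
Context {R : realType} {N : nat}.
Variables (I : pred 'I_N) (Hm : 'cV[R]_N -> 'cV[R]_N) (A : 'M[R]_N)
  (ps : 'cV[R]_N).
Hypothesis smH : strictly_small (fun z => Hm z - A *m z) (projK I ps).

Local Notation nmap := (normal_map I Hm).
Local Notation deg := (degenerate I ps).
Local Notation face := (face I ps).
Local Notation J := (Jmx A).

Let rest (p : 'cV[R]_N) : 'cV[R]_N := nmap p - Psi I A ps 1 p.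

Lemma normal_map_Psi_small : strictly_small rest ps.
Proof.
apply: strictly_small_near (strictly_small_projK smH).
have := projK_near I ps; apply: filterS => p pE.
rewrite /rest /Psi -pE /normal_map /=.
by rewrite mulmxBl mul1mx; apply/matrixP => i j; rewrite !mxE; lra.
Qed.

Lemma unit_lip_homeo : (forall a, face a -> J a \in unitmx) ->
  lip_homeo_at nmap ps.
Proof.
move=> /Psi_lip_homeo lh.
have := lip_homeo_at_perturbation lh normal_map_Psi_small.
by congr (lip_homeo_at _ _); apply/funext => p /=; rewrite /rest addrC subrK.
Qed.

(** The right-hand slopes of the coordinates of [Pt 1] at [q], hence the value 1 at a kink. They are
    defined at every [q], even if the normal map happens to be differentiable at a kink of the
    projection. *)
Definition right_pattern (q : 'cV[R]_N) : 'rV[R]_N :=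
  \row_i (if deg i then (0 <= q i 0)%R%:R else side I ps i).

Lemma right_pattern_face q : face (right_pattern q).
Proof.
move=> i; rewrite mxE; case: ifP => //= _; rewrite in_itv /=.
by case: (0 <= _); rewrite ?lexx ?ler01.
Qed.

(** A short step to the right does not cross the kink, so the increment is exactly linear. *)
Lemma Psi_right_increment (q : 'cV[R]_N) j (h : R) : 0 < h ->
  (q j 0 < 0 -> h <= - q j 0) ->
  Psi I A ps 1 (h *: delta_mx j 0 + q) - Psi I A ps 1 q
    = h *: col j (J (right_pattern q)).
Proof.
move=> h0 hq.
have -> : Psi I A ps 1 (h *: delta_mx j 0 + q) - Psi I A ps 1 q =
    h *: delta_mx j 0 + (A - 1%:M) *m
     (Pt I ps 1 (h *: delta_mx j 0 + q) - Pt I ps 1 q).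
  by rewrite mulmxBr /Psi; apply/matrixP => i k; rewrite !mxE; lra.
have -> : Pt I ps 1 (h *: delta_mx j 0 + q) - Pt I ps 1 q =
    (h * right_pattern q 0 j) *: delta_mx j 0.
  apply/matrixP => i k; rewrite ord1 !mxE eqxx andbT.
  have [->|ij] := eqVneq i j; last first.
    by rewrite !mulr0 add0r subrr.
  rewrite !mulr1; case: ifP => di; last by rewrite mulrDr addrK mulrC.
  rewrite subrr !mul0r !add0r !mul1r; have [q0|q0] := leP 0 (q j 0).
    by rewrite max_r ?addr_ge0// ?(ltW h0)// mulr1 addrK.
  by rewrite max_l ?subrr ?mulr0//; have := hq q0; lra.
rewrite -scalemxAr -colE -scalerA -scalerDr; congr (_ *: _).
apply/matrixP => i k; rewrite ord1 [RHS]mxE JmxE !mxE eqxx andbT.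
by rewrite mulrC eq_sym.
Qed.

(** Where the normal map is differentiable, its partial derivatives are right-hand derivatives. The
    model contributes exactly [J (right_pattern q)], and the difference quotients of [rest] are
    small because its Lipschitz constant is. *)
Lemma jac_normal_map_approx (eps : R) : 0 < eps ->
  \forall q \near ps, differentiable nmap q ->
    `|jac nmap q - J (right_pattern q)| <= eps.
Proof.
move=> eps0; have e20 : 0 < eps / 2 by rewrite divr_gt0.
have [rho rho0 smr] := normal_map_Psi_small e20.
have r20 : 0 < rho / 2 by rewrite divr_gt0.
apply/nbhs_ballP; exists (rho / 2) => // q; rewrite -ball_normE /= distrC => qr.
move=> dq; apply: mx_norm_leP => [|i j]; first exact: ltW.
have : derivable (fun z => nmap z i 0) q (delta_mx j 0).
  have /derivable_mxP dm : derivable nmap q (delta_mx j 0).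
    exact: diff_derivable.
  exact: dm.
have -> : (jac nmap q - J (right_pattern q)) i j =
    'D_(delta_mx j 0) (fun z => nmap z i 0) q - J (right_pattern q) i j.
  by rewrite [LHS]mxE [in LHS]mxE [X in _ + X]mxE.
move=> /cvg_ex[l dl].
have -> : 'D_(delta_mx j 0) (fun z => nmap z i 0) q = l by exact: cvg_lim dl.
move/cvg_dnbhs_at_right : dl => /cvgrPdist_le/(_ _ e20) dl.
near (0 : R)^'+ => h.
have h0 : 0 < h by near: h; exact: nbhs_right_gt.
have hr : h <= rho / 2 by near: h; exact: nbhs_right_le.
have hq : q j 0 < 0 -> h <= - q j 0.
  near: h; have [q0|q0] := ltP (q j 0) 0; last by apply: nearW.
  have : \forall x \near (0 : R)^'+, x <= - q j 0.
    by apply: nbhs_right_le; rewrite oppr_gt0.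
  by apply: filterS.
have : `|l - h^-1 *: (nmap (h *: delta_mx j 0 + q) i 0 - nmap q i 0)|
    <= eps / 2 by near: h.
set d := h *: delta_mx j 0 => dlh.
have dn : `|d| <= h.
  rewrite /d normrZ gtr0_norm// ler_piMr ?(ltW h0)//.
  apply: mx_norm_leP => // i' j'; rewrite !mxE.
  by case: (_ && _); rewrite ?normr1 ?normr0.
have nE p : nmap p = Psi I A ps 1 p + rest p by rewrite /rest addrC subrK.
have inc : nmap (d + q) i 0 - nmap q i 0 =
    h * J (right_pattern q) i j + (rest (d + q) - rest q) i 0.
  rewrite !nE; have := Psi_right_increment h0 hq.
  move=> /matrixP/(_ i 0); rewrite -/d !mxE => E.
  by rewrite -E; lra.
have : `|(rest (d + q) - rest q) i 0| <= eps / 2 * h.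
  rewrite (le_trans (ler_coord_norm _ _ _))//.
  rewrite (le_trans (smr _ _ _ _)) ?addrK//.
  - rewrite -addrA (le_trans (ler_normD _ _))// (splitr rho) lerD//.
      exact: le_trans dn hr.
    exact: ltW.
  - by rewrite (le_trans (ltW qr))// ler_pdivrMr// ler_peMr ?(ltW rho0)// ler1n.
  - by rewrite ler_wpM2l// ltW.
set x := (rest (d + q) - rest q) i 0 in inc *.
set b := J (right_pattern q) i j in inc *.
move: dlh; rewrite inc /= => dlh xle.
have E : h^-1 *: (h * b + x) = b + h^-1 * x.
  by rewrite -[LHS]/(h^-1 * (h * b + x)) mulrDr mulKf// gt_eqF.
move: dlh; rewrite E => dlh.
have xh : `|h^-1 * x| <= eps / 2.
  by rewrite normrM gtr0_norm ?invr_gt0// mulrC ler_pdivrMr.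
rewrite (_ : l - b = (l - (b + h^-1 * x)) + h^-1 * x); last by ring.
by rewrite (le_trans (ler_normD _ _))// (splitr eps) lerD.
Unshelve. all: by end_near. Qed.

Lemma face_convex k (a : 'I_k -> 'rV[R]_N) (t : 'I_k -> R) :
  (forall i, face (a i)) -> (forall i, 0 <= t i) -> \sum_i t i = 1 ->
  face (\sum_i t i *: a i).
Proof.
move=> fa t0 t1 j; rewrite summxE.
under eq_bigr do rewrite mxE.
have [dj|dj] := ifPn; last first.
  rewrite (eq_bigr (fun i => t i * side I ps j)) => [|i _].
    by rewrite -mulr_suml t1 mul1r.
  by have [_ ->] := faceP j (fa i).
rewrite /= in_itv /=; apply/andP; split.
  apply: sumr_ge0 => i _; have [/andP[a0 _] _] := faceP j (fa i).
  by rewrite mulr_ge0.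
rewrite -[leRHS]t1; apply: ler_sum => i _.
by have [/andP[_ a1] _] := faceP j (fa i); rewrite ler_piMr.
Qed.

(** Jacobians at points tending to [ps] approach the image of the face under [J], which is compact,
    hence closed. It also contains convex combinations, because [J] is affine and the weights sum to
    1. *)
Lemma clarke_normal_map_face V : clarke_subdiff nmap ps V ->
  exists2 a, face a & V = J a.
Proof.
move=> [k [W [t [CW t0 t1 ->]]]].
have clJ : closed [set J a | a in face].
  apply: compact_closed; first exact: norm_hausdorff.
  apply: continuous_compact; last exact: face_compact.
  apply: continuous_subspaceT => a.
  by apply: (@Jmx_cvg R N A _ (nbhs a) _ id a); exact: cvg_id.
have /choice[a aP] : forall i, exists a, face a /\ W i = J a.
  move=> i; have [q [qps dq jq]] := CW i.
  suff [a fa aE] : [set J a | a in face] (W i) by exists a.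
  apply: (@closed_cvg _ _ (\oo) _ (fun k => J (right_pattern (q k))) _ clJ).
    by apply: nearW => l; exists (right_pattern (q l)) => //;
      exact: right_pattern_face.
  apply/cvgrPdist_le => eps eps0; have e20 : 0 < eps / 2 by rewrite divr_gt0.
  have near1 := qps _ (jac_normal_map_approx e20).
  move/cvgrPdist_le : jq => /(_ _ e20) near2.
  near=> l.
  have h1 : `|jac nmap (q l) - J (right_pattern (q l))| <= eps / 2.
    by have : differentiable nmap (q l) by []; near: l.
  have h2 : `|W i - jac nmap (q l)| <= eps / 2 by near: l.
  rewrite -(subrKA (jac nmap (q l))) (le_trans (ler_normD _ _))//.
  by rewrite (splitr eps) lerD.
exists (\sum_i t i *: a i); first by apply: face_convex => // i; have [] := aP i.
apply/matrixP => i j; rewrite JmxE [LHS]summxE [in RHS]summxE.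
rewrite (eq_bigr (fun l => t l * (i == j)%:R
    + (A i j - (i == j)%:R) * (t l * a l 0 j))); last first.
  by move=> l _; rewrite mxE (aP l).2 JmxE mulrDr mulrCA.
rewrite big_split /= -mulr_suml t1 mul1r -mulr_sumr; congr (_ + _ * _).
by apply: eq_bigr => l _; rewrite mxE.
Unshelve. all: by end_near. Qed.

Hypothesis diffH : \forall z \near projK I ps, exists B : 'M[R]_N,
  strictly_small (fun z' => Hm z' - B *m z') z.

(** A vertex prescribes the sign of each degenerate coordinate. Approaching [ps] along a direction
    with these signs stays off all kinks, so the normal map is differentiable there with Jacobian
    tending to [J a]. *)
Lemma vertex_clarke a : face a -> (forall i, deg i -> a 0 i = 0 \/ a 0 i = 1) ->
  clarke_subdiff nmap ps (J a).
Proof.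
move=> fa va; apply: subset_convex_hull.
(* Slope 1 becomes sign 1, and slope 0 becomes sign -1. *)
pose s : 'cV[R]_N := \col_i (if deg i then 2 * a 0 i - 1 else 0).
pose q (k : nat) := ps + harmonic k *: s.
have qps : q @ \oo --> ps.
  rewrite -[X in _ --> X]addr0 -(scale0r s).
  apply: cvgD; first exact: cvg_cst.
  by apply: cvgZ; [exact: cvg_harmonic|exact: cvg_cst].
have qdeg i k : deg i -> (a 0 i = 1 /\ 0 < q k i 0) \/ (a 0 i = 0 /\ q k i 0 < 0).
  move=> di; have /andP[_ /eqP pi0] := di.
  have hk : 0 < (harmonic k : R) by exact: harmonic_gt0.
  rewrite /q !mxE di pi0 add0r.
  have [ai|ai] := va i di; [right|left]; rewrite ai; split => //.
    by rewrite mulr0 sub0r mulrN1 oppr_lt0.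
  by rewrite mulr1 (_ : 2 - 1 = 1) ?mulr1//; lra.
have patE k : right_pattern (q k) = a.
  apply/matrixP => z i; rewrite ord1 mxE; case: ifPn => di; last first.
    by have [_ ->] := faceP i fa.
  by have [[-> /ltW->]|[-> q0]] := qdeg i k di; rewrite // leNgt q0.
have projP : \forall p \near ps, exists B : 'M[R]_N,
    strictly_small (fun z' => Hm z' - B *m z') (projK I p).
  have /nbhs_ballP[r /= r0 rB] := diffH.
  apply/nbhs_ballP; exists r => // p; rewrite -ball_normE /= => pr.
  by apply: rB; rewrite -ball_normE /= (le_lt_trans (projK_lip _ _ _)).
have projD : \forall p \near ps, \forall p' \near p, projK I p' = Pt I ps 1 p'.
  by apply: near_join; exact: projK_near.
have diffq k : (exists B : 'M[R]_N,
      strictly_small (fun z' => Hm z' - B *m z') (projK I (q k))) ->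
    (\forall p' \near q k, projK I p' = Pt I ps 1 p') ->
    differentiable nmap (q k).
  move=> [B smB] nearP.
  apply: (@strict_derivative_differentiable _ _ _ _
    (B *m diag_mx a + (1%:M - diag_mx a))).
  apply: strictly_small_near (strictly_small_projK smB).
  have : \forall p' \near q k, Pt I ps 1 p' = diag_mx a *m p'.
    have : \forall p' \near q k, forall i, Pt I ps 1 p' i 0 = (diag_mx a *m p') i 0.
      apply: (@filter_forall _ _ (fun i p' => Pt I ps 1 p' i 0 = (diag_mx a *m p') i 0)
         (nbhs (q k)) _) => i.
      have ci := @coord_continuous R N 1 i 0 (q k).
      have [di|di] := boolP (deg i); last first.
        apply: nearW => p'; rewrite mul_diag_mx !mxE (negbTE di).
        by have [_ ->] := faceP i fa.
      have [[ai q0]|[ai q0]] := qdeg i k di.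
        have : nbhs (q k) [set p : 'cV[R]_N | 0 < p i 0] by exact: cvgr_gt ci _ q0.
        apply: filterS => p' p0; rewrite mul_diag_mx !mxE di ai.
        by rewrite max_r ?(ltW p0)// subrr mul0r add0r.
      have : nbhs (q k) [set p : 'cV[R]_N | p i 0 < 0] by exact: cvgr_lt ci _ q0.
      apply: filterS => p' p0; rewrite mul_diag_mx !mxE di ai.
      by rewrite max_l ?(ltW p0)// subrr !mul0r mulr0 addr0.
    by apply: filterS => p' pE; apply/matrixP => i j; rewrite ord1; exact: pE.
  move: nearP; apply: filterS2 => p' pP pE /=.
  rewrite /normal_map pP pE mulmxDl mulmxBl mul1mx -mulmxA.
  by apply/matrixP => i j; rewrite !mxE; lra.
have [K _ KP] : \forall k \near \oo, differentiable nmap (q k).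
  have n1 : \forall k \near \oo, exists B : 'M[R]_N,
      strictly_small (fun z' => Hm z' - B *m z') (projK I (q k)).
    exact: qps _ projP.
  have n2 : \forall k \near \oo, \forall p' \near q k,
      projK I p' = Pt I ps 1 p'.
    exact: qps _ projD.
  by near=> k; apply: diffq; near: k.
(* [clarke_subdiff] asks for differentiability at every index, so the beginning of the sequence is
   dropped. *)
exists (fun k => q (k + K)%N); split.
- exact: (cvg_comp _ _ (cvg_addnr K) qps).
- by move=> k; apply: KP; rewrite /= leq_addl.
- suff jq : jac nmap (q k) @[k --> \oo] --> J a.
    exact: (cvg_comp _ _ (cvg_addnr K) jq).
  apply/cvgrPdist_le => eps eps0.
  have near1 : \forall k \near \oo, differentiable nmap (q k) ->
      `|jac nmap (q k) - J (right_pattern (q k))| <= eps.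
    exact: qps _ (jac_normal_map_approx eps0).
  have near2 : \forall k \near \oo, differentiable nmap (q k) by exists K.
  near=> k; rewrite distrC -(patE k).
  have dk : differentiable nmap (q k) by near: k.
  by move: dk; near: k.
Unshelve. all: by end_near. Qed.

(** Induction on the list of coordinates allowed to be fractional: a point of the face is the convex
    combination, with weights given by coordinate [j], of the two points whose coordinate [j] is 1
    or 0. *)
Lemma face_clarke a : face a -> clarke_subdiff nmap ps (J a).
Proof.
suff gen (s : seq 'I_N) (b : 'rV[R]_N) : face b ->
    (forall i, i \notin s -> deg i -> b 0 i = 0 \/ b 0 i = 1) ->
    clarke_subdiff nmap ps (J b).
  by move=> fa; apply: (gen (enum 'I_N)) => // i; rewrite mem_enum.
elim: s b => [|j s IH] b fb vb.
  by apply: vertex_clarke => // i; apply: vb.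
have [dj|dj] := boolP (deg j); last first.
  apply: IH => // i si di; apply: vb => //; rewrite inE negb_or si andbT.
  by apply: contraNneq dj => <-.
pose setj (x : R) : 'rV[R]_N := \row_i (if i == j then x else b 0 i).
have fset x : 0 <= x <= 1 -> face (setj x).
  move=> x01 i; rewrite mxE; have [->|_] := eqVneq i j; last exact: fb.
  by rewrite dj /= in_itv.
have cset x : x = 0 \/ x = 1 -> clarke_subdiff nmap ps (J (setj x)).
  move=> x01; apply: IH => [|i si di].
    by apply: fset; case: x01 => ->; rewrite ?lexx ler01.
  rewrite mxE; have [//|ij] := eqVneq i j.
  by apply: vb => //; rewrite inE negb_or ij.
have [/andP[b0 b1] _] := faceP j fb.
have := convex_hull_convex b0 b1 (cset 1 (or_intror erefl)) (cset 0 (or_introl erefl)).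
congr (convex_hull _ _); apply/matrixP => i k.
rewrite [LHS]mxE [X in X + _]mxE [X in _ + X]mxE !JmxE !mxE.
have [->|_] := eqVneq k j; ring.
Qed.

End ClarkeNormalMap.

(** * Strict derivatives *)

Section StrictScalarDerivatives.
Context {R : realType}.
Implicit Types V W : normedModType R.

(* Strict differentiability is used throughout instead of differentiability
   because it passes through the nonsmooth projection. *)
Definition sder V (f : V -> R) (p : V) (D : V -> R) :=
  [/\ forall (k : R) u v, D (k *: u + v) = k * D u + D v,
      exists2 C : R, 0 < C & forall v, `|D v| <= C * `|v|
    & forall eps, 0 < eps -> exists2 rho, 0 < rho & forall a b : V,
        `|a - p| <= rho -> `|b - p| <= rho ->
        `|f a - f b - D (a - b)| <= eps * `|a - b| ].

Lemma sder_near V (f g : V -> R) p D :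
  (\forall q \near p, f q = g q) -> sder f p D -> sder g p D.
Proof.
move=> /nbhs_ballP[r /= r0 rfg] [linD boundD sf]; split => // eps /sf[rho rho0 frho].
have inr a : `|a - p| <= Num.min rho (r / 2) -> `|a - p| <= rho /\ f a = g a.
  rewrite le_min => /andP[-> ar]; split => //; apply: rfg.
  rewrite -ball_normE /= distrC (le_lt_trans ar)//.
  by rewrite ltr_pdivrMr// mulr_natr mulr2n ltrDr.
exists (Num.min rho (r / 2)); first by rewrite lt_min rho0 divr_gt0.
by move=> a b /inr[ar <-] /inr[br <-]; exact: frho.
Qed.

Lemma sder_linear V (L : V -> R) (C : R) p : 0 < C ->
  (forall (k : R) u v, L (k *: u + v) = k * L u + L v) ->
  (forall v, `|L v| <= C * `|v|) -> sder L p L.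
Proof.
move=> C0 linL boundL; split => //; first by exists C.
move=> eps eps0; exists 1 => // a b _ _.
have -> : L (a - b) = L a - L b.
  by rewrite -scaleN1r addrC linL mulN1r addrC.
by rewrite subrr normr0 mulr_ge0// ltW.
Qed.

Lemma sder_cst V (c : R) (p : V) : sder (fun=> c) p (fun=> 0).
Proof.
split=> [k u v||eps eps0]; first by rewrite mulr0 addr0.
  by exists 1 => // v; rewrite normr0 mul1r.
by exists 1 => // a b _ _; rewrite subr0 subrr normr0 mulr_ge0// ltW.
Qed.

Lemma sderD V (f g : V -> R) p Df Dg : sder f p Df -> sder g p Dg ->
  sder (fun q => f q + g q) p (fun v => Df v + Dg v).
Proof.
move=> [linf [Cf Cf0 bf] sf] [ling [Cg Cg0 bg] sg]; split.
- by move=> k u v; rewrite linf ling; ring.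
- exists (Cf + Cg) => [|v]; first exact: addr_gt0.
  by rewrite (le_trans (ler_normD _ _))// mulrDl lerD.
- move=> eps eps0; have e20 : 0 < eps / 2 by rewrite divr_gt0.
  have [r1 r10 h1] := sf _ e20; have [r2 r20 h2] := sg _ e20.
  exists (Num.min r1 r2); first by rewrite lt_min r10.
  move=> a b; rewrite !le_min => /andP[a1 a2] /andP[b1 b2].
  rewrite (_ : _ - _ = (f a - f b - Df (a - b)) + (g a - g b - Dg (a - b)));
    last by ring.
  rewrite (le_trans (ler_normD _ _))// (splitr eps) mulrDl.
  by rewrite lerD ?h1 ?h2.
Qed.

Lemma sderZ V (f : V -> R) p D (c : R) : sder f p D ->
  sder (fun q => c * f q) p (fun v => c * D v).
Proof.
move=> [linD [C C0 bD] sf]; split.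
- by move=> k u v; rewrite linD; ring.
- exists (`|c| * C + 1) => [|v]; first by rewrite ltr_wpDl// mulr_ge0// ltW.
  rewrite normrM mulrDl mul1r (@le_trans _ _ (`|c| * C * `|v|))//.
    by rewrite -mulrA ler_wpM2l.
  by rewrite lerDl.
- move=> eps eps0; have c1 : 0 < `|c| + 1 by rewrite ltr_wpDl.
  have [r r0 h] := sf (eps / (`|c| + 1)) (divr_gt0 eps0 c1).
  exists r => // a b ar br.
  rewrite -!mulrBr normrM; have := h _ _ ar br.
  rewrite mulrAC ler_pdivlMr// => hX; apply: le_trans hX.
  by rewrite mulrDr mulr1 mulrC lerDl.
Qed.

Lemma sderN V (f : V -> R) p D : sder f p D ->
  sder (fun q => - f q) p (fun v => - D v).
Proof.
move=> /(sderZ (-1)); congr (sder _ _ _); apply/funext => v; exact: mulN1r.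
Qed.

Lemma sder_sum V n (f : 'I_n -> V -> R) p D : (forall i, sder (f i) p (D i)) ->
  sder (fun q => \sum_i f i q) p (fun v => \sum_i D i v).
Proof.
elim: n f D => [|n IH] f D fD.
  have := @sder_cst V 0 p; congr (sder _ _ _); apply/funext => v;
  by rewrite big_ord0.
have := sderD (fD ord0) (IH _ _ (fun i => fD (lift ord0 i))).
by congr (sder _ _ _); apply/funext => v; rewrite big_ord_recl.
Qed.

Lemma sder_lip V (f : V -> R) p D : sder f p D ->
  exists C r : R, [/\ 0 < C, 0 < r & forall a b,
    `|a - p| <= r -> `|b - p| <= r -> `|f a - f b| <= C * `|a - b|].
Proof.
move=> [_ [C C0 bD] /(_ 1 ltr01)[r r0 h]]; exists (1 + C), r; split => //.
  by rewrite addr_gt0.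
move=> a b ar br; rewrite -(subrK (D (a - b)) (f a - f b)).
by rewrite (le_trans (ler_normD _ _))// mulrDl lerD// h.
Qed.

Lemma sderM V (f g : V -> R) p Df Dg : sder f p Df -> sder g p Dg ->
  sder (fun q => f q * g q) p (fun v => g p * Df v + f p * Dg v).
Proof.
move=> sf sg; have [lf bf _] := sderZ (g p) sf; have [lg bg _] := sderZ (f p) sg.
have [l b _] := sderD (sderZ (g p) sf) (sderZ (f p) sg); split => //.
move=> eps eps0; have e40 : 0 < eps / 4 by rewrite divr_gt0.
have [Cf [rf [Cf0 rf0 lipf]]] := sder_lip sf.
have [Cg [rg [Cg0 rg0 lipg]]] := sder_lip sg.
have [_ _ /(_ _ e40)[r1 r10 h1]] := sderZ (g p) sf.
have [_ _ /(_ _ e40)[r2 r20 h2]] := sderZ (f p) sg.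
(* Within this radius each of the two mixed terms in the expansion below is at most a quarter of the
   allowed error. *)
pose r3 := eps / 4 / (Cf * Cg).
have r30 : 0 < r3 by rewrite divr_gt0// mulr_gt0.
pose r := Num.min (Num.min (Num.min rf rg) (Num.min r1 r2)) r3.
exists r; first by rewrite !lt_min rf0 rg0 r10 r20.
move=> x y; rewrite !le_min => /andP[/andP[/andP[xf xg] /andP[x1 x2]] x3].
move=> /andP[/andP[/andP[yf yg] /andP[y1 y2]] y3].
have pf : `|p - p| <= rf by rewrite subrr normr0 ltW.
have pg : `|p - p| <= rg by rewrite subrr normr0 ltW.
have -> : f x * g x - f y * g y - (g p * Df (x - y) + f p * Dg (x - y)) =
   (f x - f y) * (g x - g p) + (g p * f x - g p * f y - g p * Df (x - y))
   + ((f y - f p) * (g x - g y) + (f p * g x - f p * g y - f p * Dg (x - y))).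
  by ring.
have := h1 _ _ x1 y1; have := h2 _ _ x2 y2.
set A := _ - _ - _; set B := _ - _ - _ => hA hB.
have small u v (s t Cs Ct : R) : 0 <= s -> 0 <= t -> s <= Cs * u -> t <= Ct * v ->
    Cs * Ct = Cf * Cg -> 0 <= u -> v <= r3 -> 0 <= v -> 0 <= Cs -> 0 <= Ct ->
    s * t <= eps / 4 * u.
  move=> s0 t0 su tv CC u0 vr v0 Cs0 Ct0.
  rewrite (le_trans (ler_pM s0 t0 su tv))//.
  rewrite (_ : Cs * u * (Ct * v) = (Cf * Cg * v) * u); last by rewrite -CC; ring.
  rewrite ler_wpM2r//; move: vr; rewrite /r3 ler_pdivlMr ?mulr_gt0//.
  by rewrite mulrC.
have h3 : `|(f x - f y) * (g x - g p)| <= eps / 4 * `|x - y|.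
  rewrite normrM; apply: (@small _ `|x - p| _ _ Cf Cg) => //;
    rewrite ?(ltW Cf0) ?(ltW Cg0)//.
    exact: lipf.
  exact: lipg.
have h4 : `|(f y - f p) * (g x - g y)| <= eps / 4 * `|x - y|.
  rewrite normrM mulrC; apply: (@small _ `|y - p| _ _ Cg Cf) => //;
    rewrite ?(ltW Cf0) ?(ltW Cg0)//.
  - exact: lipg.
  - exact: lipf.
  - exact: mulrC.
have := ler_normD ((f x - f y) * (g x - g p) + B) ((f y - f p) * (g x - g y) + A).
have := ler_normD ((f x - f y) * (g x - g p)) B.
have := ler_normD ((f y - f p) * (g x - g y)) A.
by lra.
Qed.

Lemma sder_comp V W (L : V -> W) (f : W -> R) p D :
  (forall (k : R) u v, L (k *: u + v) = k *: L u + L v) ->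
  (forall v, `|L v| <= `|v|) ->
  sder f (L p) D -> sder (fun q => f (L q)) p (fun v => D (L v)).
Proof.
move=> linL bL [linD [C C0 bD] sf].
have LB a b : L (a - b) = L a - L b.
  by rewrite -scaleN1r addrC linL scaleN1r addrC.
split=> [k u v||eps eps0]; first by rewrite linL linD.
  by exists C => // v; rewrite (le_trans (bD _))// ler_wpM2l// ltW.
have [r r0 h] := sf _ eps0; exists r => // a b ar br.
rewrite LB (le_trans (h _ _ _ _)) -?LB ?(le_trans (bL _))//.
by rewrite ler_wpM2l ?bL// ltW.
Qed.

Lemma sder_is_derive V (f : V -> R) p D v : sder f p D -> is_derive p v f (D v).
Proof.
move=> [linD _ sf].
have D0 : D 0 = 0.
  have := linD 1 0 0; rewrite scale1r addr0 mul1r => /eqP.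
  by rewrite -subr_eq0 opprD addrA subrr sub0r oppr_eq0 => /eqP.
have lim : h^-1 *: ((f \o shift p) (h *: v) - f p) @[h --> (0 : R)^'] --> D v.
  apply/cvgrPdist_le => eps eps0.
  have v0 : 0 < `|v| + 1 by rewrite ltr_wpDl.
  have [r r0 fr] := sf (eps / (`|v| + 1)) (divr_gt0 eps0 v0).
  near=> h.
  have h0 : h != 0 by near: h; exact: nbhs_dnbhs_neq.
  have hr : `|h| <= r / (`|v| + 1) by near: h; apply: dnbhs0_le; rewrite divr_gt0.
  have hv : `|h *: v| <= r.
    rewrite normrZ; move: hr; rewrite ler_pdivlMr// => /(le_trans _); apply.
    by rewrite ler_wpM2l// lerDl.
  have := fr (h *: v + p) p; rewrite addrK subrr normr0 => /(_ hv (ltW r0)).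
  have -> : D (h *: v) = h * D v by rewrite -[h *: v]addr0 linD D0 addr0.
  move=> le; rewrite distrC.
  rewrite (_ : _ - _ = h^-1 * (f (h *: v + p) - f p - h * D v)); last first.
    by rewrite mulrBr mulKf.
  rewrite normrM normfV ler_pdivrMl ?normr_gt0// (le_trans le)//.
  rewrite normrZ -mulrA [leRHS]mulrC ler_wpM2l ?(ltW eps0)// ler_pdivrMl//.
  by rewrite mulrC ler_wpM2r// lerDl.
by split; [apply/cvg_ex; exists (D v)|exact: cvg_lim lim].
Unshelve. all: by end_near. Qed.

Lemma sder_derive V (f : V -> R) p D v : sder f p D -> 'D_v f p = D v.
Proof. by move=> /(sder_is_derive v) sf; exact: derive_val. Qed.

Lemma sder_derivable V (f : V -> R) p D v : sder f p D -> derivable f p v.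
Proof. by move=> /(sder_is_derive v) sf; exact: ex_derive. Qed.

Lemma line_MVT V (f : V -> R) (a d : V) :
  (forall t : R, 0 <= t <= 1 -> derivable f (t *: d + a) d) ->
  exists2 c : R, 0 <= c <= 1 & f (d + a) - f a = 'D_d f (c *: d + a).
Proof.
move=> df; pose k (t : R) := f (t *: d + a).
have quot (t : R) : (fun h : R => h^-1 *: ((k \o shift t) (h *: (1 : R)) - k t)) =
    (fun h => h^-1 *: ((f \o shift (t *: d + a)) (h *: d) - f (t *: d + a))).
  apply/funext => h; rewrite /k /=; congr (_ *: (f _ - _)).
  by rewrite -[h *: 1]/(h * 1) mulr1 scalerDl addrA.
have kd (t : R) : 0 <= t <= 1 -> is_derive t 1 k ('D_d f (t *: d + a)).
  move=> /df dt; split; first by rewrite /derivable quot.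
  by rewrite /derive quot.
have [||t] := @MVT_segment R k (fun t => 'D_d f (t *: d + a)) 0 1 ler01.
- move=> t; rewrite in_itv /= => /andP[/ltW t0 /ltW t1]; apply: kd.
  by rewrite t0.
- apply: derivable_within_continuous => t; rewrite in_itv /= => t01.
  by have := kd t t01 => dk; exact: ex_derive.
- rewrite in_itv /= => t01; rewrite /k scale1r scale0r add0r subr0 mulr1 => E.
  by exists t.
Qed.

(** Finite dimension in the form needed here: a finite spanning family with coordinates bounded by
    the norm. It covers column vectors as well as the product space on which [f], [g], [h] live. *)
Definition has_coords V := exists (T : finType) (e : T -> V) (c : T -> V -> R),
  forall w, w = \sum_i c i w *: e i /\ forall i, `|c i w| <= `|w|.

(** By the mean value theorem on the segment from [b] to [a], the increment is a directional
    derivative at a nearby point. Only the finitely many directions [e i] have to be controlled,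
    which turns directionwise continuity into a uniform bound. *)
Lemma C1_sder V (f : V -> R) p : has_coords V ->
  (\forall q \near p, (forall w, derivable f q w) /\
     forall (k : R) u v, 'D_(k *: u + v) f q = k * 'D_u f q + 'D_v f q) ->
  (forall w, {for p, continuous ('D_w f)}) ->
  sder f p (fun w => 'D_w f p).
Proof.
move=> [T [e [c cE]]] nearf contf.
have [dp lp] := nbhs_singleton nearf.
have expand q w : (forall (k : R) u v, 'D_(k *: u + v) f q = k * 'D_u f q + 'D_v f q) ->
    'D_w f q = \sum_i c i w * 'D_(e i) f q.
  move=> lq; have [wE _] := cE w; rewrite {1}wE.
  have l0 : 'D_0 f q = 0 by exact: derive0.
  elim/big_rec2 : _ => // i y1 y2 _ <-; exact: lq.
have sumle (a : T -> R) (w : V) (B : R) : (forall i, `|a i| <= B) ->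
    `|\sum_i c i w * a i| <= #|T|%:R * B * `|w|.
  move=> aB; rewrite (le_trans (ler_norm_sum _ _ _))//.
  rewrite -mulrA mulr_natl -sumr_const; apply: ler_sum => i _.
  rewrite normrM mulrC ler_pM//; exact: (cE w).2.
split => //.
- exists (#|T|%:R * (\sum_i `|'D_(e i) f p|) + 1) => [|w].
    by rewrite ltr_wpDl// mulr_ge0// sumr_ge0.
  rewrite (expand p w lp) mulrDl mul1r.
  rewrite (le_trans (sumle _ _ (\sum_i `|'D_(e i) f p|) _))//.
    by move=> i; rewrite (bigD1 i)//= lerDl sumr_ge0.
  by rewrite lerDl.
- move=> eps eps0; have T0 : 0 < #|T|%:R + 1 :> R by rewrite ltr_wpDl.
  pose eta := eps / (#|T|%:R + 1).
  have eta0 : 0 < eta by rewrite divr_gt0.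
  have nearD : \forall q \near p, forall i, `|'D_(e i) f p - 'D_(e i) f q| <= eta.
    apply: (@filter_forall _ _ (fun i q => `|'D_(e i) f p - 'D_(e i) f q| <= eta)
       (nbhs p) _) => i.
    by have /cvgrPdist_le := contf (e i); apply.
  have /nbhs_ballP[r /= r0 rP] : nbhs p [set q |
     ((forall w, derivable f q w) /\
     forall (k : R) u v, 'D_(k *: u + v) f q = k * 'D_u f q + 'D_v f q) /\
     forall i, `|'D_(e i) f p - 'D_(e i) f q| <= eta].
    exact: filterI.
  exists (r / 2); first by rewrite divr_gt0.
  move=> a b ar br.
  have seg (t : R) : 0 <= t <= 1 -> ball p r (t *: (a - b) + b).
    move=> /andP[t0 t1]; rewrite -ball_normE /= distrC.
    rewrite (_ : _ - _ = t *: (a - p) + (1 - t) *: (b - p)); last first.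
      have -> : (1 - t) *: (b - p) = (b - p) - t *: (b - p).
        by rewrite scalerBl scale1r.
      have E : a - p - (b - p) = a - b by rewrite opprB addrA subrK.
      by rewrite addrCA -scalerBr E [RHS]addrC addrA.
    rewrite (le_lt_trans (ler_normD _ _))// !normrZ (ger0_norm t0).
    rewrite [`|1 - t|]ger0_norm ?subr_ge0//.
    have := ler_wpM2l t0 ar; have t10 : 0 <= 1 - t by rewrite subr_ge0.
    by have := ler_wpM2l t10 br; lra.
  have [|s s01 fE] := @line_MVT V f b (a - b).
    by move=> t /seg/rP[[dq _] _]; exact: dq.
  have [[_ lq] Dq] := rP _ (seg _ s01).
  move: fE; rewrite subrK => ->; rewrite (expand _ _ lq) (expand _ _ lp).
  rewrite -sumrB; under eq_bigr do rewrite -mulrBr.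
  rewrite (le_trans (sumle _ _ eta _))//; first by move=> i; rewrite distrC.
  by rewrite ler_wpM2r// /eta mulrCA ler_piMr ?(ltW eps0)// ler_pdivrMr// mul1r lerDl.
Qed.

Lemma has_coords_cV n : has_coords 'cV[R]_n.
Proof.
exists 'I_n, (fun i => delta_mx i 0), (fun i (w : 'cV[R]_n) => w i 0) => w.
split => [|i].
  apply/matrixP => i j; rewrite ord1 summxE (bigD1 i)//= big1 ?addr0.
    by rewrite !mxE !eqxx mulr1.
  by move=> k ki; rewrite !mxE eq_sym (negbTE ki) mulr0.
exact: ler_coord_norm.
Qed.

Lemma has_coords_prod V W : has_coords V -> has_coords W ->
  has_coords (V * W)%type.
Proof.
move=> [T [e [c cE]]] [T' [e' [c' cE']]].
exists (T + T')%type,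
  (fun i => match i with inl j => (e j, 0) | inr j => (0, e' j) end),
  (fun i w => match i with inl j => c j w.1 | inr j => c' j w.2 end).
have sc (k : R) (u : V) (u' : W) (z : V * W) :
    k *: (u, u') + z = (k *: u + z.1, k *: u' + z.2) by case: z.
move=> [v w]; split=> [|i].
  rewrite big_sumType /= {1}(cE v).1 {1}(cE' w).1.
  have -> : \sum_(i in T) c i v *: ((e i, 0) : V * W)
      = (\sum_(i in T) c i v *: e i, 0).
    elim/big_rec2 : _ => // i y1 y2 _ ->.
    by rewrite sc /= scaler0 addr0.
  have -> : \sum_(i in T') c' i w *: ((0, e' i) : V * W)
      = (0, \sum_(i in T') c' i w *: e' i).
    elim/big_rec2 : _ => // i y1 y2 _ ->.
    by rewrite sc /= scaler0 addr0.
  by have := sc 1 (\sum_(i in T) c i v *: e i) 0 (0, \sum_(i in T') c' i w *: e' i);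
    rewrite !scale1r /= addr0 add0r => ->.
case: i => j /=; rewrite prod_normE le_max.
  by rewrite (cE v).2.
by rewrite (cE' w).2 orbT.
Qed.

(** The counterpart of [C2_near] in terms of strict derivatives; being required near [p], it passes
    to nearby points. *)
Definition C2_scalar V (f : V -> R) (p : V) := \forall q \near p,
  sder f q (fun w => 'D_w f q) /\
  forall v, sder ('D_v f) q (fun w => 'D_w ('D_v f) q).

Lemma derive_shiftr V (f : V -> R) (c q v : V) :
  'D_v (fun x => f (x + c)) q = 'D_v f (q + c) /\
  (derivable f (q + c) v -> derivable (fun x => f (x + c)) q v).
Proof.
rewrite /derive /derivable.
suff -> : (fun h : R => h^-1 *: (((fun x => f (x + c)) \o shift q) (h *: v) - f (q + c)))
  = (fun h => h^-1 *: ((f \o shift (q + c)) (h *: v) - f (q + c))) by [].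
by apply/funext => h /=; rewrite addrA.
Qed.

(* The second difference of f along s v and s w is s^2 D_w D_v f(p) + o(s^2)
   and it is symmetric in v and w. *)
Lemma second_difference V (f : V -> R) p v w (eps : R) : C2_scalar f p ->
  0 < eps -> \forall s \near (0 : R)^'+,
  `|f (s *: v + p + s *: w) - f (s *: v + p) - (f (p + s *: w) - f p)
    - s ^+ 2 * 'D_w ('D_v f) p| <= eps * s ^+ 2.
Proof.
move=> C2f eps0; have [_ /(_ v)[linD _ sD]] := nbhs_singleton C2f.
have c0 : 0 < `|w| + 1 by rewrite ltr_wpDl.
have [r1 r10 h1] := sD (eps / (`|w| + 1)) (divr_gt0 eps0 c0).
have /nbhs_ballP[r2 /= r20 h2] := C2f.
have vw0 : 0 < `|v| + `|w| + 1 by rewrite ltr_wpDl// addr_ge0.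
pose r := Num.min r1 (r2 / 2).
have r0 : 0 < r by rewrite lt_min r10 divr_gt0.
near=> s.
have s0 : 0 < s by near: s; exact: nbhs_right_gt.
have sr : s * (`|v| + `|w| + 1) <= r.
  rewrite -ler_pdivlMr//; near: s; apply: nbhs_right_le; rewrite divr_gt0//.
have close (t b : R) : 0 <= t <= 1 -> 0 <= b <= 1 ->
    `|t *: (s *: v) + p + b *: (s *: w) - p| <= r.
  move=> /andP[t0 t1] /andP[b0 b1]; rewrite addrAC addrK.
  rewrite (le_trans (ler_normD _ _))// !normrZ (ger0_norm t0) (ger0_norm b0).
  rewrite (gtr0_norm s0) (le_trans _ sr)// mulrDr mulr1 mulrDr.
  have := ler_wpM2r (mulr_ge0 (ltW s0) (normr_ge0 v)) t1.
  have := ler_wpM2r (mulr_ge0 (ltW s0) (normr_ge0 w)) b1.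
  by move: s0; lra.
have t1 : (0 <= 1 :> R) && (1 <= 1 :> R) by rewrite ler01 lexx.
have t0 : (0 <= 0 :> R) && (0 <= 1 :> R) by rewrite ler01 lexx.
have inball q : `|q - p| <= r -> ball p r2 q.
  rewrite le_min => /andP[_ qr]; rewrite -ball_normE /= distrC.
  by rewrite (le_lt_trans qr)// ltr_pdivrMr// mulr_natr mulr2n ltrDr.
have der q : `|q - p| <= r -> derivable f q (s *: v).
  by move=> /inball/h2[sf _]; exact: sder_derivable sf.
(* The second difference is the increment of [k] along [s *: v]. The mean value theorem reduces it
   to an increment of ['D_v f], to which strict differentiability applies. *)
pose k x := f (x + s *: w) - f x.
have closew (t : R) : 0 <= t <= 1 -> `|t *: (s *: v) + p + s *: w - p| <= r.
  by move=> t01; have := close t 1 t01 t1; rewrite scale1r.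
have closev (t : R) : 0 <= t <= 1 -> `|t *: (s *: v) + p - p| <= r.
  by move=> t01; have := close t 0 t01 t0; rewrite scale0r addr0.
have dk (t : R) : 0 <= t <= 1 -> derivable k (t *: (s *: v) + p) (s *: v).
  move=> t01; apply: derivableB; last exact/der/closev.
  exact/(derive_shiftr _ _ _ _).2/der/closew.
have [c c01] := @line_MVT V k p (s *: v) dk.
rewrite /k => ->; set q := c *: (s *: v) + p.
have -> : 'D_(s *: v) (fun x => f (x + s *: w) - f x) q =
    s * ('D_v f (q + s *: w) - 'D_v f q).
  have dq := der _ (closev _ c01); have dqw := der _ (closew _ c01).
  have -> : 'D_(s *: v) (fun x => f (x + s *: w) - f x) q =
      'D_(s *: v) f (q + s *: w) - 'D_(s *: v) f q.
    rewrite -(derive_shiftr f (s *: w) q (s *: v)).1.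
    have dsh := (derive_shiftr f (s *: w) q (s *: v)).2 dqw.
    by rewrite -(deriveB dsh dq).
  have hom x : `|x - p| <= r -> 'D_(s *: v) f x = s * 'D_v f x.
    move=> /inball/h2[[lf _ _] _]; rewrite -[s *: v]addr0 lf derive0.
    by rewrite addr0.
  by rewrite !hom ?mulrBr//; [exact: closev|exact: closew].
have := h1 (q + s *: w) q; rewrite [q + _ - q]addrAC subrr add0r.
have qr1 : `|q - p| <= r1.
  by rewrite (le_trans (closev _ c01))// ge_min lexx.
have qwr1 : `|q + s *: w - p| <= r1.
  by rewrite (le_trans (closew _ c01))// ge_min lexx.
move=> /(_ qwr1 qr1).
have -> : 'D_(s *: w) ('D_v f) p = s * 'D_w ('D_v f) p.
  by rewrite -[s *: w]addr0 linD derive0 addr0.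
rewrite normrZ (gtr0_norm s0) => le.
rewrite (_ : _ - _ = s * ('D_v f (q + s *: w) - 'D_v f q - s * 'D_w ('D_v f) p));
  last by ring.
rewrite normrM (gtr0_norm s0) (_ : eps * s ^+ 2 = s * (eps * s)); last by ring.
rewrite ler_wpM2l ?(ltW s0)// (le_trans le)//.
rewrite mulrAC ler_pdivrMr// mulrA ler_wpM2l// ?mulr_ge0 ?(ltW eps0) ?(ltW s0)//.
by rewrite lerDl.
Unshelve. all: by end_near. Qed.

Lemma derive_sym V (f : V -> R) p v w : C2_scalar f p ->
  'D_w ('D_v f) p = 'D_v ('D_w f) p.
Proof.
move=> C2f; apply/eqP; rewrite -subr_eq0 -normr_le0; apply/ler_addgt0Pr => eps eps0.
rewrite add0r; have e20 : 0 < eps / 2 by rewrite divr_gt0.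
have near1 := second_difference v w C2f e20.
have near2 := second_difference w v C2f e20.
have [s [[s0 h1] h2]] :=
  filter_ex (filterI (filterI (nbhs_right_gt 0) near1) near2).
have E1 : s *: w + p + s *: v = s *: v + p + s *: w.
  by rewrite addrC addrA addrAC.
rewrite E1 [s *: w + p]addrC [p + s *: v]addrC in h2.
have s20 : 0 < s ^+ 2 by rewrite exprn_gt0.
rewrite -(ler_pM2r s20) -{1}(gtr0_norm s20) -normrM.
move: h1 h2; set X := f _ - f _ - _; set a := 'D_w _ p; set b := 'D_v _ p.
set Y := f _ - f _ - _ => h1 h2.
have XY : X = Y by rewrite /X /Y; ring.
rewrite (_ : (a - b) * _ = (Y - s ^+ 2 * b) - (X - s ^+ 2 * a)); last first.
  by rewrite XY; ring.
apply: (le_trans (ler_normB _ _)); apply: (le_trans (lerD h2 h1)).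
by rewrite -mulrDl -splitr.
Qed.

(** The functional [l] is the identity for [f], and a coordinate for the vector-valued data. *)
Lemma C2_near_scalar V W (l : W -> R) (h : V -> W) p : has_coords V ->
  (forall (k : R) u v, l (k *: u + v) = k * l u + l v) -> continuous l ->
  (forall (F : V -> W) q v, derivable F q v -> derivable (fun x => l (F x)) q v
    /\ 'D_v (fun x => l (F x)) q = l ('D_v F q)) ->
  C2_near h p -> C2_scalar (fun x => l (h x)) p.
Proof.
move=> cV linl contl derl /near_join C2h.
have C1 (F : V -> W) q : (\forall x \near q, differentiable F x) ->
    (forall w, {for q, continuous ('D_w F)}) ->
    sder (fun x => l (F x)) q (fun w => 'D_w (fun x => l (F x)) q).
  move=> dF cF.
  have DF : \forall x \near q, forall v,
      derivable (fun x => l (F x)) x v /\ 'D_v (fun x => l (F x)) x = l ('D_v F x).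
    apply: filterS dF => x dx v; apply: derl; exact: diff_derivable.
  apply: C1_sder => //.
    apply: filterS2 dF DF => x dx Dx; split=> [w|k u v]; first by have [] := Dx w.
    rewrite !(Dx _).2 -linl; congr l.
    by rewrite !deriveE// linearP.
  move=> w; have [_ E] := nbhs_singleton DF w.
  rewrite /prop_for /continuous_at E.
  apply: (@cvg_trans _ (l ('D_w F x) @[x --> q])).
    apply: near_eq_cvg; apply: filterS DF => x Dx; by rewrite (Dx w).2.
  exact: (cvg_comp _ _ (cF w) (contl _)).
move: C2h; apply: filterS => q C2q.
have dh : \forall x \near q, differentiable h x by apply: filterS C2q => x [].
have ddh v : \forall x \near q, differentiable ('D_v h) x.
  by apply: filterS C2q => x [_ /(_ v)[]].
split.
  apply: C1 => // w; have [_ /(_ w)[dw _]] := nbhs_singleton C2q.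
  exact: differentiable_continuous.
move=> v.
have eqv : \forall x \near q, l ('D_v h x) = 'D_v (fun x => l (h x)) x.
  apply: filterS dh => x dx; apply/esym; apply: (derl _ _ _ _).2.
  exact: diff_derivable.
have sv : sder (fun x => l ('D_v h x)) q (fun w => 'D_w (fun x => l ('D_v h x)) q).
  apply: C1 => // w; have [_ /(_ v)[_ /(_ w)]] := nbhs_singleton C2q; exact.
have := sder_near eqv sv.
congr (sder _ _ _); apply/funext => w; exact: near_eq_derive.
Qed.

Lemma C2_near_id V (h : V -> R) p : has_coords V -> C2_near h p -> C2_scalar h p.
Proof.
by move=> cV; apply: (@C2_near_scalar V R id) => // x; exact: cvg_id.
Qed.

Lemma C2_near_coord V m (h : V -> 'cV[R]_m) p i : has_coords V ->
  C2_near h p -> C2_scalar (fun x => h x i 0) p.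
Proof.
move=> cV; apply: (@C2_near_scalar V _ (fun M : 'cV[R]_m => M i 0)) => //.
- by move=> k u v; rewrite !mxE.
- exact: coord_continuous.
- move=> F q v dF; split; first by move/derivable_mxP : dF; exact.
  by rewrite derive_mx// mxE.
Qed.

End StrictScalarDerivatives.

(** * Strict derivatives of vector-valued maps and partial derivatives *)

Section VectorDerivatives.
Context {R : realType}.
Implicit Types V W : normedModType R.

Definition vsder V k (F : V -> 'cV[R]_k) (p : V) (D : V -> 'cV[R]_k) :=
  forall i, sder (fun z => F z i 0) p (fun v => D v i 0).

Lemma vsder_col_mx V k l (F : V -> 'cV[R]_k) (F' : V -> 'cV[R]_l) p D D' :
  vsder F p D -> vsder F' p D' ->
  vsder (fun z => col_mx (F z) (F' z)) p (fun v => col_mx (D v) (D' v)).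
Proof.
move=> sF sF' i; have [j ->|j ->] := split_ordP i.
  have := sF j; congr (sder _ _ _); apply/funext => v; by rewrite col_mxEu.
have := sF' j; congr (sder _ _ _); apply/funext => v; by rewrite col_mxEd.
Qed.

Lemma linear_form_expand n (D : 'cV[R]_n -> R) c :
  (forall (k : R) u v, D (k *: u + v) = k * D u + D v) ->
  D c = \sum_i D (delta_mx i 0) * c i 0.
Proof.
move=> linD; have D0 : D 0 = 0.
  have := linD 1 0 0; rewrite scale1r addr0 mul1r => /eqP.
  by rewrite -subr_eq0 opprD addrA subrr sub0r oppr_eq0 => /eqP.
have {1}-> : c = \sum_i c i 0 *: delta_mx i 0.
  apply/matrixP => i j; rewrite ord1 summxE (bigD1 i)//= big1 ?addr0.
    by rewrite !mxE !eqxx mulr1.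
  by move=> k ki; rewrite !mxE eq_sym (negbTE ki) mulr0.
elim/big_rec2 : _ => // i y1 y2 _ <-; by rewrite linD mulrC.
Qed.

Lemma linear_form_expand2 n m (D : 'cV[R]_n * 'cV[R]_m -> R) c d :
  (forall (k : R) u v, D (k *: u + v) = k * D u + D v) ->
  D (c, d) = \sum_i D (delta_mx i 0, 0) * c i 0
             + \sum_i D (0, delta_mx i 0) * d i 0.
Proof.
move=> linD.
rewrite (_ : (c, d) = 1 *: (c, 0) + (0, d)); last first.
  by rewrite scale1r -[RHS]/(c + 0, 0 + d) addr0 add0r.
rewrite linD mul1r -(@linear_form_expand n (fun c => D (c, 0))); last first.
  by move=> k u v; rewrite -linD -[k *: (_, _) + _]/(_, _) /= scaler0 addr0.
rewrite -(@linear_form_expand m (fun d => D (0, d)))//.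
by move=> k u v; rewrite -linD -[k *: (_, _) + _]/(_, _) /= scaler0 addr0.
Qed.

Lemma vsder_strictly_small n k (F : 'cV[R]_n -> 'cV[R]_k) p D : vsder F p D ->
  exists2 A : 'M[R]_(k, n), strictly_small (fun z => F z - A *m z) p &
    forall c, A *m c = D c.
Proof.
move=> sF; pose A := \matrix_(i, j) D (delta_mx j 0) i 0.
have AD c : A *m c = D c.
  apply/matrixP => i j; rewrite ord1 mxE; have [linD _ _] := sF i.
  by rewrite (linear_form_expand c linD); apply: eq_bigr => l _; rewrite mxE.
exists A => // eps eps0.
have /choice[rho rhoP] : forall i, exists rho, 0 < rho /\ forall a b,
    `|a - p| <= rho -> `|b - p| <= rho ->
    `|F a i 0 - F b i 0 - D (a - b) i 0| <= eps * `|a - b|.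
  by move=> i; have [_ _ /(_ _ eps0)[r r0 h]] := sF i; exists r.
(* The least of the radii of the rows; the default 1 keeps it positive when there is no row. *)
pose r := \big[Num.min/1]_i rho i.
have rle i : r <= rho i by exact: bigmin_le.
exists r.
  by apply: lt_bigmin => // i _; have [] := rhoP i.
move=> a b ar br; apply: mx_norm_leP => [|i j]; first by rewrite mulr_ge0// ltW.
rewrite ord1; have [_ /(_ a b)] := rhoP i.
rewrite !(le_trans _ (rle i))// => /(_ isT isT).
have -> : F a - A *m a - (F b - A *m b) = F a - F b - D (a - b).
  by rewrite -AD mulmxBr; apply/matrixP => i' j'; rewrite !mxE; lra.
by congr (`| _ | <= _); rewrite !mxE.
Qed.

Lemma C2_scalar_sder V (f : V -> R) q :
  C2_scalar f q -> sder f q (fun w => 'D_w f q).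
Proof. by move=> /nbhs_singleton[]. Qed.

Lemma C2_scalar_sder2 V (f : V -> R) q v :
  C2_scalar f q -> sder ('D_v f) q (fun w => 'D_w ('D_v f) q).
Proof. by move=> /nbhs_singleton[_]. Qed.

(** The difference quotients coincide. Partial derivatives thus become directional derivatives on
    the product space, where all the calculus takes place. *)
Lemma derive_partial1 V W (f : V * W -> R) x y v :
  'D_v (fun x' => f (x', y)) x = 'D_(v, 0) f (x, y).
Proof.
rewrite /derive.
suff -> : (fun t : R => t^-1 *: (((fun x' => f (x', y)) \o shift x) (t *: v) - f (x, y)))
  = (fun t => t^-1 *: ((f \o shift (x, y)) (t *: (v, 0)) - f (x, y))) by [].
apply/funext => t /=; congr (_ *: (f _ - _)).
by rewrite -[RHS]/(t *: v + x, t *: 0 + y) scaler0 add0r.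
Qed.

Lemma derive_partial2 V W (f : V * W -> R) x y w :
  'D_w (fun y' => f (x, y')) y = 'D_(0, w) f (x, y).
Proof.
rewrite /derive.
suff -> : (fun t : R => t^-1 *: (((fun y' => f (x, y')) \o shift y) (t *: w) - f (x, y)))
  = (fun t => t^-1 *: ((f \o shift (x, y)) (t *: (0, w)) - f (x, y))) by [].
apply/funext => t /=; congr (_ *: (f _ - _)).
by rewrite -[RHS]/(t *: 0 + x, t *: w + y) scaler0 add0r.
Qed.

End VectorDerivatives.

(** * Derivatives of the minimax data *)

Section MinimaxDerivatives.
Context {R : realType} {n m n1 n2 m1 m2 : nat}.
Variables (f : 'cV[R]_n * 'cV[R]_m -> R)
  (h : 'cV[R]_n * 'cV[R]_m -> 'cV[R]_m1)
  (g : 'cV[R]_n * 'cV[R]_m -> 'cV[R]_m2)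
  (H : 'cV[R]_n -> 'cV[R]_n1)
  (G : 'cV[R]_n -> 'cV[R]_n2).
Local Notation Z := 'cV[R]_(@dimz n m n1 n2 m1 m2).
Local Notation X := ('cV[R]_n * 'cV[R]_m)%type.

Implicit Types (x : 'cV[R]_n) (y : 'cV[R]_m) (mu : 'cV[R]_m1) (lam : 'cV[R]_m2).

Definition regular_xy (q : X) := [/\ C2_scalar f q,
  forall i, C2_scalar (fun q => h q i 0) q &
  forall i, C2_scalar (fun q => g q i 0) q].

Definition regular_x (x : 'cV[R]_n) :=
  (forall i, C2_scalar (fun x => H x i 0) x) /\
  (forall i, C2_scalar (fun x => G x i 0) x).

(** The derivative of the Lagrangian along [v], with the multipliers explicit so that it can also be
    differentiated in them. *)
Definition LagD (mu : 'cV[R]_m1) (lam : 'cV[R]_m2) (v q : X) : R :=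
  'D_v f q + \sum_i mu i 0 * 'D_v (fun q => h q i 0) q
  - \sum_i lam i 0 * 'D_v (fun q => g q i 0) q.

Definition Lagq mu lam (q : X) := Lag f h g q.1 q.2 mu lam.

Lemma LagqE mu lam : Lagq mu lam = fun q => f q + \sum_i mu i 0 * h q i 0
  - \sum_i lam i 0 * g q i 0.
Proof. by apply/funext => -[x y]; rewrite /Lagq /Lag !dotvE. Qed.

Lemma Lagq_sder mu lam q : regular_xy q -> sder (Lagq mu lam) q (fun v => LagD mu lam v q).
Proof.
move=> [rf rh rg]; rewrite LagqE; apply: sderD.
  apply: sderD; first exact: C2_scalar_sder.
  by apply: sder_sum => i; apply: sderZ; exact: C2_scalar_sder (rh i).
by apply/sderN/sder_sum => i; apply: sderZ; exact: C2_scalar_sder (rg i).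
Qed.

Lemma regular_xy_near q : regular_xy q -> \forall q' \near q, regular_xy q'.
Proof.
move=> [rf rh rg].
have nh : \forall q' \near q, forall i, C2_scalar (fun q => h q i 0) q'.
  apply: (@filter_forall _ _ (fun i q' => C2_scalar (fun q => h q i 0) q') (nbhs q) _) => i.
  exact: near_join (rh i).
have ng : \forall q' \near q, forall i, C2_scalar (fun q => g q i 0) q'.
  apply: (@filter_forall _ _ (fun i q' => C2_scalar (fun q => g q i 0) q') (nbhs q) _) => i.
  exact: near_join (rg i).
have nf : \forall q' \near q, C2_scalar f q' by exact: near_join.
by apply: filterS3 nf nh ng => q' *; split.
Qed.

Lemma regular_x_near x : regular_x x -> \forall x' \near x, regular_x x'.
Proof.
move=> [rH rG].
have nH : \forall x' \near x, forall i, C2_scalar (fun x => H x i 0) x'.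
  apply: (@filter_forall _ _ (fun i x' => C2_scalar (fun x => H x i 0) x') (nbhs x) _) => i.
  exact: near_join (rH i).
have nG : \forall x' \near x, forall i, C2_scalar (fun x => G x i 0) x'.
  apply: (@filter_forall _ _ (fun i x' => C2_scalar (fun x => G x i 0) x') (nbhs x) _) => i.
  exact: near_join (rG i).
by apply: filterS2 nH nG => x' *; split.
Qed.

Definition LagDD mu lam (v w q : X) : R :=
  'D_w ('D_v f) q + \sum_i mu i 0 * 'D_w ('D_v (fun q => h q i 0)) q
  - \sum_i lam i 0 * 'D_w ('D_v (fun q => g q i 0)) q.

Lemma LagD_sder mu lam v q : regular_xy q ->
  sder (LagD mu lam v) q (fun w => LagDD mu lam v w q).
Proof.
move=> [rf rh rg]; apply: sderD.
  apply: sderD; first exact: C2_scalar_sder2.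
  by apply: sder_sum => i; apply: sderZ; exact: C2_scalar_sder2 (rh i).
by apply/sderN/sder_sum => i; apply: sderZ; exact: C2_scalar_sder2 (rg i).
Qed.

Lemma DLagq_sder mu lam v q : regular_xy q ->
  sder ('D_v (Lagq mu lam)) q (fun w => LagDD mu lam v w q).
Proof.
move=> rq; apply: sder_near (LagD_sder mu lam v rq).
apply: filterS (regular_xy_near rq) => q' rq'.
by rewrite (sder_derive v (Lagq_sder mu lam rq')).
Qed.

Lemma Lagq_C2 mu lam q : regular_xy q -> C2_scalar (Lagq mu lam) q.
Proof.
move=> /regular_xy_near; apply: filterS => q' rq'; split.
  have := Lagq_sder mu lam rq'; congr (sder _ _ _); apply/funext => v.
  by rewrite (sder_derive v (Lagq_sder mu lam rq')).
move=> v; have := DLagq_sder mu lam v rq'; congr (sder _ _ _); apply/funext => w.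
by rewrite (sder_derive w (DLagq_sder mu lam v rq')).
Qed.

(** Reconciles [Mmx], which differentiates in x and then in y, with the derivative in x of the
    y-gradient in the fourth block of [ge_map]. *)
Lemma LagDD_sym mu lam v w q : regular_xy q ->
  LagDD mu lam v w q = LagDD mu lam w v q.
Proof.
move=> rq; rewrite -(sder_derive w (DLagq_sder mu lam v rq)).
rewrite -(sder_derive v (DLagq_sder mu lam w rq)).
exact/derive_sym/Lagq_C2.
Qed.

Lemma gradxLE x y mu lam j : regular_xy (x, y) ->
  gradxL f h g x y mu lam j 0 = LagD mu lam (delta_mx j 0, 0) (x, y).
Proof.
move=> rq; rewrite mxE /pderiv.
rewrite (derive_partial1 (Lagq mu lam) x y (delta_mx j 0)).
exact: sder_derive (Lagq_sder mu lam rq).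
Qed.

Lemma gradyLE x y mu lam j : regular_xy (x, y) ->
  gradyL f h g x y mu lam j 0 = LagD mu lam (0, delta_mx j 0) (x, y).
Proof.
move=> rq; rewrite mxE /pderiv.
rewrite (derive_partial2 (Lagq mu lam) x y (delta_mx j 0)).
exact: sder_derive (Lagq_sder mu lam rq).
Qed.

Lemma hessxxLE x y mu lam j k : regular_xy (x, y) ->
  hessxxL f h g x y mu lam j k =
  LagDD mu lam (delta_mx j 0, 0) (delta_mx k 0, 0) (x, y).
Proof.
move=> rq; rewrite mxE /pderiv.
rewrite (_ : 'D_(delta_mx j 0) _ = fun x' =>
    'D_(delta_mx j 0, 0) (Lagq mu lam) (x', y)); last first.
  by apply/funext => x'; exact: (derive_partial1 (Lagq mu lam)).
rewrite (derive_partial1 ('D_(delta_mx j 0, 0) (Lagq mu lam))).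
exact: sder_derive (DLagq_sder mu lam _ rq).
Qed.

Lemma hessyyLE x y mu lam j k : regular_xy (x, y) ->
  hessyyL f h g x y mu lam j k =
  LagDD mu lam (0, delta_mx j 0) (0, delta_mx k 0) (x, y).
Proof.
move=> rq; rewrite mxE /pderiv.
rewrite (_ : 'D_(delta_mx j 0) _ = fun y' =>
    'D_(0, delta_mx j 0) (Lagq mu lam) (x, y')); last first.
  by apply/funext => y'; exact: (derive_partial2 (Lagq mu lam)).
rewrite (derive_partial2 ('D_(0, delta_mx j 0) (Lagq mu lam))).
exact: sder_derive (DLagq_sder mu lam _ rq).
Qed.

Lemma MmxE x y mu lam i j : regular_xy (x, y) ->
  Mmx f h g x y mu lam i j =
  LagDD mu lam (delta_mx j 0, 0) (0, delta_mx i 0) (x, y).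
Proof.
move=> rq; rewrite mxE /pderiv.
rewrite (_ : (fun y' => _) = fun y' =>
    'D_(delta_mx j 0, 0) (Lagq mu lam) (x, y')); last first.
  by apply/funext => y'; exact: (derive_partial1 (Lagq mu lam)).
rewrite (derive_partial2 ('D_(delta_mx j 0, 0) (Lagq mu lam))).
exact: sder_derive (DLagq_sder mu lam _ rq).
Qed.

Lemma sub_part_bounds (z : Z) :
  [/\ `|xpart z| <= `|z|, `|upart z| <= `|z|, `|vpart z| <= `|z| &
   [/\ `|ypart z| <= `|z|, `|mupart z| <= `|z| & `|lampart z| <= `|z| ]].
Proof.
by split; [| | |split]; apply: mx_norm_leP => // i j; rewrite !mxE ler_coord_norm.
Qed.

Definition xy (z : Z) : X := (xpart z, ypart z).

Lemma sder_xy (F : X -> R) D z : sder F (xy z) D ->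
  sder (fun z => F (xy z)) z (fun c => D (xy c)).
Proof.
apply: sder_comp => [k u v|v].
  by rewrite /xy -[RHS]/(_, _) /= /xpart /ypart !linearP.
by have [? _ _ [? _ _]] := sub_part_bounds v; rewrite prod_normE ge_max; apply/andP.
Qed.

Lemma sder_x (F : 'cV[R]_n -> R) D z : sder F (xpart z) D ->
  sder (fun z : Z => F (xpart z)) z (fun c => D (xpart c)).
Proof.
apply: sder_comp => [k u v|v]; first by rewrite /xpart linearP.
by have [] := sub_part_bounds v.
Qed.

Lemma sder_part k (P : Z -> 'cV[R]_k) i z :
  (forall (k : R) u v, P (k *: u + v) = k *: P u + P v) ->
  (forall z, `|P z| <= `|z|) -> sder (fun z => P z i 0) z (fun z => P z i 0).
Proof.
move=> linP bP; apply: (@sder_linear _ _ _ 1) => // [t u v|v].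
  by rewrite linP !mxE.
by rewrite mul1r (le_trans (ler_coord_norm _ _ _)).
Qed.

Lemma sder_u i z : sder (fun z : Z => upart z i 0) z (fun z => upart z i 0).
Proof.
apply: sder_part => [k u v|v]; first by rewrite /upart !linearP.
by have [] := sub_part_bounds v.
Qed.

Lemma sder_v i z : sder (fun z : Z => vpart z i 0) z (fun z => vpart z i 0).
Proof.
apply: sder_part => [k u v|v]; first by rewrite /vpart !linearP.
by have [] := sub_part_bounds v.
Qed.

Lemma sder_mu i z : sder (fun z : Z => mupart z i 0) z (fun z => mupart z i 0).
Proof.
apply: sder_part => [k u v|v]; first by rewrite /mupart !linearP.
by have [_ _ _ []] := sub_part_bounds v.
Qed.

Lemma sder_lam i z : sder (fun z : Z => lampart z i 0) z (fun z => lampart z i 0).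
Proof.
apply: sder_part => [k u v|v]; first by rewrite /lampart !linearP.
by have [_ _ _ []] := sub_part_bounds v.
Qed.

Lemma xy_near (z : Z) (P : set X) : nbhs (xy z) P -> nbhs z [set z' | P (xy z')].
Proof.
move=> /nbhs_ballP[r /= r0 rP]; apply/nbhs_ballP; exists r => // z'.
rewrite -ball_normE /= => zr; apply: rP; rewrite -ball_normE /=.
have -> : xy z - xy z' = xy (z - z').
  by rewrite /xy -[LHS]/(_, _) /= /xpart /ypart !linearB.
have [b1 _ _ [b2 _ _]] := sub_part_bounds (z - z').
by rewrite prod_normE gt_max !(le_lt_trans _ zr).
Qed.

Lemma xpart_near (z : Z) (P : set 'cV[R]_n) : nbhs (xpart z) P ->
  nbhs z [set z' | P (xpart z')].
Proof.
move=> /nbhs_ballP[r /= r0 rP]; apply/nbhs_ballP; exists r => // z'.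
rewrite -ball_normE /= => zr; apply: rP; rewrite -ball_normE /=.
have -> : xpart z - xpart z' = xpart (z - z') by rewrite /xpart linearB.
have [b1 _ _ _] := sub_part_bounds (z - z').
exact: le_lt_trans zr.
Qed.

Definition regular (z : Z) := regular_xy (xy z) /\ regular_x (xpart z).

Lemma regular_near z : regular z -> \forall z' \near z, regular z'.
Proof.
move=> [/regular_xy_near/xy_near near1 /regular_x_near/xpart_near near2].
by apply: filterS2 near1 near2 => z'; split.
Qed.

(** Serves both gradient blocks of [ge_map], with [v] a basis vector in the x or in the y
    directions. *)
Lemma LagD_part_sder z (v : X) : regular_xy (xy z) ->
  sder (fun z' : Z => LagD (mupart z') (lampart z') v (xy z')) z
   (fun c => LagDD (mupart z) (lampart z) v (xy c) (xy z)
     + \sum_i 'D_v (fun q => h q i 0) (xy z) * mupart c i 0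
     - \sum_i 'D_v (fun q => g q i 0) (xy z) * lampart c i 0).
Proof.
move=> [rf rh rg].
have sh i := sderM (sder_mu i z) (sder_xy (C2_scalar_sder2 v (rh i))).
have sg i := sderM (sder_lam i z) (sder_xy (C2_scalar_sder2 v (rg i))).
have := sderD (sderD (sder_xy (C2_scalar_sder2 v rf)) (sder_sum sh)) (sderN (sder_sum sg)).
congr (sder _ _ _); apply/funext => c; rewrite /LagDD !big_split /=; ring.
Qed.

Lemma ge_map_sder z : regular z ->
  let x := xpart z in let u := upart z in let v := vpart z in
  let y := ypart z in let mu := mupart z in let lam := lampart z in
  vsder (ge_map f h g H G) z (fun c =>
    let cx := xpart c in let cu := upart c in let cv := vpart c in
    let cy := ypart c in let cmu := mupart c in let clam := lampart c in
    pack (hessxxL f h g x y mu lam *m cx + (Mmx f h g x y mu lam)^T *m cy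
          + (jacxh h x y)^T *m cmu - (jacxg g x y)^T *m clam
          + hessHG H G x u v *m cx + (jac H x)^T *m cu + (jac G x)^T *m cv)
         (jac H x *m cx)
         (- (jac G x *m cx))
         (Mmx f h g x y mu lam *m cx + hessyyL f h g x y mu lam *m cy
          + (jacyh h x y)^T *m cmu - (jacyg g x y)^T *m clam)
         (jacxh h x y *m cx + jacyh h x y *m cy)
         (- (jacxg g x y *m cx + jacyg g x y *m cy))).
Proof.
move=> rz x u v y mu lam; have [rxy [rH rG]] := rz.
have [rf rh rg] := rxy.
have jacx k (F : 'cV[R]_n -> 'cV[R]_k) i c :
    C2_scalar (fun x => F x i 0) x -> 'D_c (fun x => F x i 0) x = (jac F x *m c) i 0.
  move=> /C2_scalar_sder[lF _ _].
  rewrite (linear_form_expand c lF) mxE; apply: eq_bigr => l _; by rewrite !mxE.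
have jacxy k (F : X -> 'cV[R]_k) i c d :
    C2_scalar (fun q => F q i 0) (x, y) -> 'D_(c, d) (fun q => F q i 0) (x, y) =
    (jac (fun x' => F (x', y)) x *m c + jac (fun y' => F (x, y')) y *m d) i 0.
  move=> /C2_scalar_sder[lF _ _]; rewrite (linear_form_expand2 c d lF) !mxE.
  congr (_ + _); apply: eq_bigr => l _; rewrite mxE /pderiv.
    by rewrite (derive_partial1 (fun q => F q i 0)).
  by rewrite (derive_partial2 (fun q => F q i 0)).
have near_z := regular_near rz.
have mxD k (A B : 'cV[R]_k) i : (A + B) i 0 = A i 0 + B i 0 by rewrite mxE.
have mxN k (A : 'cV[R]_k) i : (- A) i 0 = - A i 0 by rewrite mxE.
have mulT k l (A : 'M[R]_(k, l)) d j : (A^T *m d) j 0 = \sum_i A i j * d i 0.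
  by rewrite mxE; apply: eq_bigr => i _; rewrite mxE.
apply: vsder_col_mx; last apply: vsder_col_mx; last apply: vsder_col_mx;
  last apply: vsder_col_mx; last apply: vsder_col_mx.
- move=> j.
  have sH i := sderM (sder_u i z) (sder_x (C2_scalar_sder2 (delta_mx j 0) (rH i))).
  have sG i := sderM (sder_v i z) (sder_x (C2_scalar_sder2 (delta_mx j 0) (rG i))).
  have := sderD (sderD (LagD_part_sder (delta_mx j 0, 0) rxy) (sder_sum sH))
    (sder_sum sG).
  have -> : (fun c : Z => LagDD mu lam (delta_mx j 0, 0) (xy c) (xy z)
     + \sum_i 'D_(delta_mx j 0, 0) (fun q => h q i 0) (xy z) * mupart c i 0
     - \sum_i 'D_(delta_mx j 0, 0) (fun q => g q i 0) (xy z) * lampart c i 0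
     + \sum_i ('D_(delta_mx j 0) (fun x => H x i 0) x * upart c i 0
         + u i 0 * 'D_(xpart c) ('D_(delta_mx j 0) (fun x => H x i 0)) x)
     + \sum_i ('D_(delta_mx j 0) (fun x => G x i 0) x * vpart c i 0
         + v i 0 * 'D_(xpart c) ('D_(delta_mx j 0) (fun x => G x i 0)) x)) =
    (fun c : Z => (hessxxL f h g x y mu lam *m xpart c
      + (Mmx f h g x y mu lam)^T *m ypart c
      + (jacxh h x y)^T *m mupart c - (jacxg g x y)^T *m lampart c
      + hessHG H G x u v *m xpart c + (jac H x)^T *m upart c
      + (jac G x)^T *m vpart c) j 0).
    apply/funext => c.
    have [lD _ _] := LagD_sder mu lam (delta_mx j 0, 0) rxy.
    rewrite /xy (linear_form_expand2 (xpart c) (ypart c) lD).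
    have eL1 : (hessxxL f h g x y mu lam *m xpart c) j 0 =
        \sum_i LagDD mu lam (delta_mx j 0, 0) (delta_mx i 0, 0) (x, y) * xpart c i 0.
      by rewrite mxE; apply: eq_bigr => i _; rewrite hessxxLE.
    have eL2 : ((Mmx f h g x y mu lam)^T *m ypart c) j 0 =
        \sum_i LagDD mu lam (delta_mx j 0, 0) (0, delta_mx i 0) (x, y) * ypart c i 0.
      by rewrite mulT; apply: eq_bigr => i _; rewrite MmxE.
    have eh : ((jacxh h x y)^T *m mupart c) j 0 =
        \sum_i 'D_(delta_mx j 0, 0) (fun q => h q i 0) (x, y) * mupart c i 0.
      rewrite mulT; apply: eq_bigr => i _; rewrite mxE /pderiv.
      by rewrite (derive_partial1 (fun q => h q i 0)).
    have eg : ((jacxg g x y)^T *m lampart c) j 0 =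
        \sum_i 'D_(delta_mx j 0, 0) (fun q => g q i 0) (x, y) * lampart c i 0.
      rewrite mulT; apply: eq_bigr => i _; rewrite mxE /pderiv.
      by rewrite (derive_partial1 (fun q => g q i 0)).
    have eJ k (F : 'cV[R]_n -> 'cV[R]_k) d : ((jac F x)^T *m d) j 0 =
        \sum_i 'D_(delta_mx j 0) (fun x => F x i 0) x * d i 0.
      by rewrite mulT; apply: eq_bigr => i _; rewrite mxE.
    have exch k (F : 'cV[R]_n -> 'cV[R]_k) (w : 'cV[R]_k) :
      (forall i, C2_scalar (fun x => F x i 0) x) ->
      ((\sum_i w i 0 *: hess (fun x' => F x' i 0) x) *m xpart c) j 0 =
      \sum_i w i 0 * 'D_(xpart c) ('D_(delta_mx j 0) (fun x => F x i 0)) x.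
      move=> rF; rewrite mulmx_suml summxE; apply: eq_bigr => i _.
      have [lF _ _] := C2_scalar_sder2 (delta_mx j 0) (rF i).
      rewrite (linear_form_expand (xpart c) lF) -scalemxAl mxE; congr (_ * _).
      by rewrite mxE; apply: eq_bigr => l _; rewrite mxE.
    rewrite !mxD mxN eL1 eL2 eh eg !eJ /hessHG mulmxDl mxD (exch _ _ _ rH).
    rewrite (exch _ _ _ rG) !big_split /=.
    by rewrite -/x -/y; ring.
  (* The formula for the gradient is needed on a neighbourhood of [z], since it is differentiated;
     regularity persists there. *)
  apply: sder_near; apply: filterS near_z => z' [rxy' [rH' rG']].
  rewrite /stationaryx !mxD gradxLE//; congr (_ + _ + _).
    by rewrite mulT; apply: eq_bigr => i _; rewrite [RHS]mulrC [jac _ _ _ _]mxE.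
  by rewrite mulT; apply: eq_bigr => i _; rewrite [RHS]mulrC [jac _ _ _ _]mxE.
- move=> i; have := sder_x (C2_scalar_sder (rH i)).
  by congr (sder _ _ _); apply/funext => c; rewrite jacx.
- move=> i; have := sderN (sder_x (C2_scalar_sder (rG i))).
  congr (sder _ _ _); apply/funext => c; last by rewrite mxN jacx.
  by rewrite mxN.
- move=> j; have := LagD_part_sder (0, delta_mx j 0) rxy.
  have -> : (fun c : Z => LagDD mu lam (0, delta_mx j 0) (xy c) (xy z)
     + \sum_i 'D_(0, delta_mx j 0) (fun q => h q i 0) (xy z) * mupart c i 0
     - \sum_i 'D_(0, delta_mx j 0) (fun q => g q i 0) (xy z) * lampart c i 0) =
    (fun c : Z => (Mmx f h g x y mu lam *m xpart c
      + hessyyL f h g x y mu lam *m ypart c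
      + (jacyh h x y)^T *m mupart c - (jacyg g x y)^T *m lampart c) j 0).
    apply/funext => c.
    have [lD _ _] := LagD_sder mu lam (0, delta_mx j 0) rxy.
    rewrite /xy (linear_form_expand2 (xpart c) (ypart c) lD).
    rewrite !mxD mxN !mulT [in RHS]mxE [X in _ = _ + X + _ - _]mxE.
    congr (_ + _ + _ - _); apply: eq_bigr => i _.
    + rewrite (MmxE mu lam j i rxy).
      by rewrite (LagDD_sym mu lam (0, delta_mx j 0) (delta_mx i 0, 0) rxy).
    + by rewrite (hessyyLE mu lam j i rxy).
    + congr (_ * _); rewrite [RHS]mxE /pderiv.
      by rewrite (derive_partial2 (fun q => h q i 0)).
    + congr (_ * _); rewrite [RHS]mxE /pderiv.
      by rewrite (derive_partial2 (fun q => g q i 0)).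
  apply: sder_near; apply: filterS near_z => z' [rxy' [rH' rG']].
  by rewrite gradyLE.
- move=> i; have := sder_xy (C2_scalar_sder (rh i)).
  congr (sder _ _ _); apply/funext => c.
  exact: (jacxy _ h i (xpart c) (ypart c) (rh i)).
- move=> i; have := sderN (sder_xy (C2_scalar_sder (rg i))).
  congr (sder _ _ _); apply/funext => c; first by rewrite mxN.
  by rewrite mxN -(jacxy _ g i (xpart c) (ypart c) (rg i)).
Qed.

End MinimaxDerivatives.

(** * Kernels, row selections and inner products *)

Section LinearAlgebra.
Context {R : realType}.

Lemma unitmx_inj n (M : 'M[R]_n) :
  (forall d : 'cV[R]_n, M *m d = 0 -> d = 0) -> M \in unitmx.
Proof.
move=> injM; rewrite -unitmx_tr -row_free_unit -kermx_eq0; apply/eqP/row_matrixP => i.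
rewrite row0; apply: trmx_inj; rewrite trmx0; apply: injM.
by apply: trmx_inj; rewrite trmx_mul trmxK trmx0 -row_mul mulmx_ker row0.
Qed.

Lemma row_free_col_mx_inj k l n (A : 'M[R]_(k, n)) (B : 'M[R]_(l, n))
    (u : 'cV[R]_k) (w : 'cV[R]_l) :
  row_free (col_mx A B) -> A^T *m u + B^T *m w = 0 -> u = 0 /\ w = 0.
Proof.
move=> rf uw.
have : row_mx u^T w^T *m col_mx A B = 0 *m col_mx A B.
  rewrite mul0mx mul_row_col -[A]trmxK -[B]trmxK -!trmx_mul -linearD /=.
  by rewrite uw trmx0.
move=> /(row_free_inj rf); rewrite -row_mx0 => /eq_row_mx[u0 w0].
by split; apply: trmx_inj; rewrite trmx0.
Qed.

Lemma row_free_col_mx_solve k l n (A : 'M[R]_(k, n)) (B : 'M[R]_(l, n)) (w : 'cV[R]_l) :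
  row_free (col_mx A B) -> exists d, A *m d = 0 /\ B *m d = w.
Proof.
move=> /row_freeP[C CE]; exists (C *m col_mx 0 w).
have : col_mx A B *m (C *m col_mx 0 w) = col_mx 0 w by rewrite mulmxA CE mul1mx.
by rewrite mul_col_mx => /eq_col_mx.
Qed.

Lemma subrowsE k l (S : {set 'I_k}) (A : 'M[R]_(k, l)) i j :
  subrows S A i j = A (enum_val i) j.
Proof. by rewrite mxE. Qed.

Lemma subrows_mul k l p (S : {set 'I_k}) (A : 'M[R]_(k, l)) (B : 'M[R]_(l, p)) :
  subrows S A *m B = subrows S (A *m B).
Proof. by apply/matrixP => i j; rewrite !mxE; apply: eq_bigr => t _; rewrite mxE. Qed.

Lemma subrows_eq0 k (S : {set 'I_k}) (w : 'cV[R]_k) :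
  (forall i, i \notin S -> w i 0 = 0) -> subrows S w = 0 -> w = 0.
Proof.
move=> wS w0; apply/matrixP => i j; rewrite ord1 [RHS]mxE.
have [iS|/wS//] := boolP (i \in S).
have := congr1 (fun M : 'cV[R]_#|S| => M (enum_rank_in iS i) 0) w0.
by rewrite subrowsE mxE enum_rankK_in.
Qed.

Lemma subrows_supp k l (S : {set 'I_k}) (A : 'M[R]_(k, l)) (w : 'cV[R]_k) :
  (forall i, i \notin S -> w i 0 = 0) ->
  A^T *m w = (subrows S A)^T *m subrows S w.
Proof.
move=> wS; apply/matrixP => i j; rewrite ord1 !mxE.
under [RHS]eq_bigr do rewrite mxE !subrowsE.
rewrite -(big_enum_val (fun t => A t i * w t 0)) /= [LHS](bigID (mem S)) /=.
rewrite [X in _ + X]big1 ?addr0 => [|t tS].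
  by apply: eq_bigr => t _; rewrite mxE.
by rewrite (wS t tS) mulr0.
Qed.

Lemma colDE n (a b : 'cV[R]_n) i : (a + b) i 0 = a i 0 + b i 0.
Proof. by rewrite mxE. Qed.

Lemma colNE n (a : 'cV[R]_n) i : (- a) i 0 = - a i 0.
Proof. by rewrite mxE. Qed.

Lemma dotvC n (a b : 'cV[R]_n) : dotv a b = dotv b a.
Proof. by rewrite !dotvE; apply: eq_bigr => i _; rewrite mulrC. Qed.

Lemma dotvDl n (a b c : 'cV[R]_n) : dotv (a + b) c = dotv a c + dotv b c.
Proof.
by rewrite !dotvE -big_split /=; apply: eq_bigr => i _; rewrite mxE mulrDl.
Qed.

Lemma dotvNl n (a c : 'cV[R]_n) : dotv (- a) c = - dotv a c.
Proof.
by rewrite !dotvE -sumrN; apply: eq_bigr => i _; rewrite mxE mulNr.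
Qed.

Lemma dotv0l n (c : 'cV[R]_n) : dotv 0 c = 0.
Proof. by rewrite dotvE big1// => i _; rewrite mxE mul0r. Qed.

Lemma dotv0r n (c : 'cV[R]_n) : dotv c 0 = 0.
Proof. by rewrite dotvC dotv0l. Qed.

Lemma dotv_trmx k n (A : 'M[R]_(k, n)) (u : 'cV[R]_k) (d : 'cV[R]_n) :
  dotv (A^T *m u) d = dotv u (A *m d).
Proof. by rewrite /dotv trmx_mul trmxK mulmxA. Qed.

Lemma complementaryP n (a b : 'cV[R]_n) : complementary a b ->
  forall i, [/\ 0 <= a i 0, b i 0 <= 0 & a i 0 * b i 0 = 0].
Proof.
move=> [a0 b0]; rewrite dotvE => ab i; split => //.
have := @psumr_eq0P R 'I_n predT (fun i => - (a i 0 * b i 0)).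
rewrite sumrN ab oppr0 => /(_ _ erefl i isT) E.
apply/eqP; rewrite -oppr_eq0; apply/eqP/E => j _.
by rewrite oppr_ge0 mulr_ge0_le0.
Qed.

Lemma dotv_grad_jac n k (F : 'cV[R]_n -> 'cV[R]_k) x i d :
  dotv (grad (fun x' => F x' i 0) x) d = (jac F x *m d) i 0.
Proof. by rewrite dotvE mxE; apply: eq_bigr => j _; rewrite !mxE. Qed.

End LinearAlgebra.

(** * Consequences of Property A *)

Section PropertyA.
Context {R : realType} {n m n1 n2 m1 m2 : nat}.
Variables (f : 'cV[R]_n * 'cV[R]_m -> R)
  (h : 'cV[R]_n * 'cV[R]_m -> 'cV[R]_m1)
  (g : 'cV[R]_n * 'cV[R]_m -> 'cV[R]_m2)
  (H : 'cV[R]_n -> 'cV[R]_n1)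
  (G : 'cV[R]_n -> 'cV[R]_n2)
  (x : 'cV[R]_n) (u : 'cV[R]_n1) (v : 'cV[R]_n2)
  (y : 'cV[R]_m) (mu : 'cV[R]_m1) (lam : 'cV[R]_m2).
Hypothesis rxy : regular_xy f h g (x, y).
Hypothesis pA : propertyA f h g H G x u v y mu lam.

Local Notation Lxx := (hessxxL f h g x y mu lam).
Local Notation Lyy := (hessyyL f h g x y mu lam).
Local Notation M := (Mmx f h g x y mu lam).
Local Notation K := (Kmx f h g x y mu lam).
Local Notation Nm := (Nmx f h g x y mu lam).
Local Notation jxh := (jacxh h x y).
Local Notation jyh := (jacyh h x y).
Local Notation jxg := (jacxg g x y).
Local Notation jyg := (jacyg g x y).
Local Notation JH := (jac H x).
Local Notation JG := (jac G x).
Local Notation al := (alpha g x y).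
Local Notation act := (active G x).

Lemma gradyL_vec :
  gradyL f h g x y mu lam = grad (fun y' => f (x, y')) y + jyh^T *m mu - jyg^T *m lam.
Proof.
apply/matrixP => j k; rewrite ord1 gradyLE//.
have mulT k' l (A : 'M[R]_(k', l)) d i : (A^T *m d) i 0 = \sum_t A t i * d t 0.
  by rewrite mxE; apply: eq_bigr => t _; rewrite mxE.
rewrite [RHS]mxE [X in _ = _ + X]mxE [X in _ = X + _]mxE !mulT /LagD.
congr (_ + _ - _).
- by rewrite mxE /pderiv derive_partial2.
- by apply: eq_bigr => i _; rewrite mulrC !mxE /pderiv
    (derive_partial2 (fun q => h q i 0)).
- by apply: eq_bigr => i _; rewrite mulrC !mxE /pderiv
    (derive_partial2 (fun q => g q i 0)).
Qed.

(** Strict complementarity keeps every component of [lam + g] away from 0, so the lower level has no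
    degenerate coordinate. *)
Lemma lower_strict i : (i \in al -> 0 < lam i 0 + g (x, y) i 0) /\
  (i \notin al -> lam i 0 = 0 /\ lam i 0 + g (x, y) i 0 < 0).
Proof.
have [_ _ [_ [[_ _ /complementaryP/(_ i)[l0 g0 lg] _ /(_ i) sc] _]] _] := pA.
rewrite inE; split=> [/eqP g00|gn0]; first by move: sc; rewrite g00; lra.
have l00 : lam i 0 = 0.
  by apply/eqP; move/eqP: lg; rewrite mulf_eq0 (negbTE gn0) orbF.
by split => //; rewrite l00 add0r lt_neqAle gn0.
Qed.

Lemma upper_complementarity i : (i \notin act -> v i 0 = 0 /\ v i 0 + G x i 0 < 0) /\
  (i \in act -> 0 <= v i 0 /\ G x i 0 = 0).
Proof.
have [[_ [_ _ /complementaryP/(_ i)[/= v0 G0 vG]]] _ _ _] := pA.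
rewrite inE; split=> [Gn0|/eqP//].
have v00 : v i 0 = 0.
  by apply/eqP; move/eqP: vG; rewrite mulf_eq0 (negbTE Gn0) orbF.
by split => //; rewrite v00 add0r lt_neqAle Gn0.
Qed.

Lemma Kmx_mul (dy : 'cV[R]_m) (a : 'cV[R]_m1) b :
  K *m col_mx dy (col_mx a b) =
  col_mx (Lyy *m dy + jyh^T *m a - (subrows al jyg)^T *m b)
    (col_mx (jyh *m dy) (- (subrows al jyg *m dy))).
Proof.
rewrite /Kmx mul_block_col mul0mx addr0 mul_row_col mul_col_mx !mulNmx.
by rewrite addrA.
Qed.

(** For a kernel vector, pairing the first block with [dy] shows that the quadratic form vanishes at
    [dy], which lies in the critical cone of the lower level; the second order condition forces
    [dy = 0]. Linear independence then removes the multiplier part. *)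
Lemma Kmx_unit : K \in unitmx.
Proof.
have [_ _ [_ [lk rf _ soc]] _] := pA; have [gy0 _ _] := lk.
apply: unitmx_inj => d; rewrite -[d]vsubmxK; set dy := usubmx d.
rewrite -[dsubmx d]vsubmxK; set a := usubmx _; set b := dsubmx _.
rewrite Kmx_mul -!col_mx0 => /eq_col_mx[E1 /eq_col_mx[E2 E3]].
have sg0 : subrows al jyg *m dy = 0 by apply/eqP; rewrite -oppr_eq0 E3.
have g0 i : i \in al -> (jyg *m dy) i 0 = 0.
  move=> ia; move: sg0; rewrite subrows_mul => /matrixP/(_ (enum_rank_in ia i) 0).
  by rewrite subrowsE enum_rankK_in// => ->; rewrite mxE.
have dy0 : dy = 0.
  apply/eqP/negPn/negP => dyn0.
  have := soc dy dyn0 E2.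
  (* Stationarity expresses the gradient of [f] through constraint gradients orthogonal to [dy], the
     multiplier being 0 off the active set. *)
  have -> : dotv (grad (fun y' => f (x, y')) y) dy = 0.
    have := congr1 (fun w => dotv w dy) gy0; rewrite gradyL_vec /= dotv0l.
    rewrite !dotvDl dotvNl !dotv_trmx E2 dotv0r addr0 => /eqP.
    rewrite subr_eq0 => /eqP ->; rewrite dotvE big1// => i _.
    have [ia|/(lower_strict i).2[-> _]] := boolP (i \in al).
      by rewrite g0 ?mulr0.
    by rewrite mul0r.
  have -> : dotv (Lyy *m dy) dy = 0.
    have := congr1 (fun w => dotv w dy) E1; rewrite /= dotv0l.
    rewrite !dotvDl dotvNl !dotv_trmx E2 sg0 !dotv0r addr0 subr0.
    by [].
  move=> contra; have : 0 < 0 :> R; last by rewrite ltxx.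
  apply: contra => // i ia.
  by rewrite (dotv_grad_jac (fun y' => g (x, y'))) g0.
move: E1; rewrite dy0 mulmx0 add0r -mulmxN => /(row_free_col_mx_inj rf)[-> b0].
by rewrite (_ : b = 0) ?col_mx0//; apply/eqP; rewrite -oppr_eq0 b0.
Qed.

(** The difference of two multipliers is supported on the active set, where the gradients are
    independent. *)
Lemma multiplier_unique (uv : 'cV[R]_n1 * 'cV[R]_n2) :
  multipliers f h g H G x y mu lam uv -> uv = (u, v).
Proof.
have [[_ [st _ _]] rf _ _] := pA.
case: uv => u' v' [/= st' _ cp'].
have E : JH^T *m (u' - u) + JG^T *m (v' - v) = 0.
  have : stationaryx f h g H G x u' v' y mu lam - stationaryx f h g H G x u v y mu lam = 0.
    by rewrite st st' subrr.
  rewrite /stationaryx !mulmxBr => <-.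
  by apply/matrixP => i j; rewrite !mxE; lra.
have vS i : i \notin act -> (v' - v) i 0 = 0.
  move=> ia; have [-> _] := (upper_complementarity i).1 ia.
  have [_ _ vG] := complementaryP cp' i; rewrite !mxE.
  have := upper_complementarity i; move: ia; rewrite inE => Gn0 [/(_ Gn0)[v0 _] _].
  apply/eqP; rewrite v0 subr0; move/eqP: vG; rewrite mulf_eq0 (negbTE Gn0) orbF.
  by [].
rewrite (subrows_supp _ vS) in E.
have [u0 w0] := row_free_col_mx_inj rf E.
have v0 := subrows_eq0 vS w0.
by congr (_, _); apply/eqP; rewrite -subr_eq0 ?u0 ?v0.
Qed.

(** The critical cone adds to these equations only inequalities on the active constraints with zero
    multiplier. Linear independence gives a critical direction [d0] that strictly decreases all of
    these, and a large multiple of [d0] brings [dx] into the cone. *)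
Lemma critical_affine (dx : 'cV[R]_n) : JH *m dx = 0 ->
  (forall i, 0 < v i 0 -> (JG *m dx) i 0 = 0) ->
  affine_hull (critical_cone f h g H G x y mu lam) dx.
Proof.
move=> H0 Gv0; have [[_ [st _ _]] rf _ _] := pA.
pose target : 'cV[R]_n2 := \col_i (if 0 < v i 0 then 0 else -1).
have [d0 [Hd0 Gd0]] := row_free_col_mx_solve (subrows act target) rf.
have Gd i : i \in act -> (JG *m d0) i 0 = if 0 < v i 0 then 0 else -1.
  move=> ia; move: Gd0; rewrite subrows_mul => /matrixP/(_ (enum_rank_in ia i) 0).
  by rewrite !subrowsE enum_rankK_in// => ->; rewrite mxE.
have crit d : JH *m d = 0 ->
    (forall i, i \in act -> (JG *m d) i 0 <= 0 /\ (0 < v i 0 -> (JG *m d) i 0 = 0)) ->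
    critical_cone f h g H G x y mu lam d.
  move=> Hd Gdle; split => // [i ia|].
    by rewrite dotv_grad_jac; have [] := Gdle i ia.
  (* Stationarity makes the last inequality of the cone an equality, since each term of the pairing
     of [v] with [JG *m d] vanishes. *)
  have := congr1 (fun w => dotv w d) st; rewrite /stationaryx /= dotv0l.
  rewrite !dotvDl !dotv_trmx Hd dotv0r addr0.
  rewrite [dotv v _]dotvE big1 ?addr0 => [->//|i _].
  have [ia|/(upper_complementarity i).1[-> _]] := boolP (i \in act); last first.
    by rewrite mul0r.
  have [v0 _] := (upper_complementarity i).2 ia.
  move: v0; rewrite le_eqVlt => /predU1P[<-|v0]; first by rewrite mul0r.
  by rewrite (Gdle i ia).2// mulr0.
pose t := `|JG *m dx|.
(* [dx] is the shifted vector minus [t *: d0]; the vertex 0 takes the weight [t] that makes the sum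
   1. *)
exists 3%N, (fun i : 'I_3 => nth 0 [:: dx + t *: d0; d0; 0] i),
  (fun i : 'I_3 => nth 0 [:: 1; - t; t] i); split.
- case=> -[|[|[|//]]] ? /=; apply: crit.
  + by rewrite mulmxDr H0 add0r -scalemxAr Hd0 scaler0.
  + move=> i ia; rewrite mulmxDr -scalemxAr mxE [X in _ + X]mxE (Gd i ia); split=> [|v0].
      case: ifP => [v0|_]; first by rewrite Gv0// mulr0 addr0.
      have := ler_coord_norm (JG *m dx) i 0; rewrite -/t => /(le_trans (ler_norm _)).
      lra.
    by rewrite v0 Gv0// mulr0 addr0.
  + exact: Hd0.
  + move=> i ia; rewrite (Gd i ia); split => [|->//].
    by case: ifP => _; rewrite ?lexx ?oppr_le0 ?ler01.
  + by rewrite mulmx0.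
  + by move=> i ia; rewrite mulmx0 mxE.
- by rewrite !big_ord_recl big_ord0 /=; ring.
- rewrite !big_ord_recl big_ord0 /= scale1r scaler0 !addr0 scaleNr.
  by rewrite addrK.
Qed.

(** The hypotheses are the blocks of [A *m c = c - d] with [c = diag_mx a *m d]; [cv] and [cl] are
    the sign-constrained blocks of [c], and [a], [b] their slopes. *)
Lemma propertyA_kernel (dx : 'cV[R]_n) (du : 'cV[R]_n1) (dv cv : 'cV[R]_n2)
    (dy : 'cV[R]_m) (dmu : 'cV[R]_m1) (dl cl : 'cV[R]_m2) (a : 'I_n2 -> R) (b : 'I_m2 -> R) :
  (forall i, cv i 0 = a i * dv i 0) -> (forall i, cl i 0 = b i * dl i 0) ->
  (forall i, 0 <= a i <= 1) ->
  (forall i, 0 < v i 0 + G x i 0 -> a i = 1) ->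
  (forall i, v i 0 + G x i 0 < 0 -> a i = 0) ->
  (forall i, 0 < lam i 0 + g (x, y) i 0 -> b i = 1) ->
  (forall i, lam i 0 + g (x, y) i 0 < 0 -> b i = 0) ->
  Lxx *m dx + M^T *m dy + jxh^T *m dmu - jxg^T *m cl
    + hessHG H G x u v *m dx + JH^T *m du + JG^T *m cv = 0 ->
  JH *m dx = 0 -> - (JG *m dx) = cv - dv ->
  M *m dx + Lyy *m dy + jyh^T *m dmu - jyg^T *m cl = 0 ->
  jxh *m dx + jyh *m dy = 0 -> - (jxg *m dx + jyg *m dy) = cl - dl ->
  [/\ dx = 0, du = 0, dv = 0 & [/\ dy = 0, dmu = 0 & dl = 0]].
Proof.
move=> cvE clE a01 a1 a0 b1 b0 E1 E2 E3 E4 E5 E6.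
have [_ rf _ soc] := pA.
have clS i : i \notin al -> cl i 0 = 0.
  by move=> /(lower_strict i).2[_ /b0 bi]; rewrite clE bi mul0r.
have cvS i : i \notin act -> cv i 0 = 0.
  by move=> /(upper_complementarity i).1[_ /a0 ai]; rewrite cvE ai mul0r.
have E6' : subrows al (jxg *m dx) + subrows al (jyg *m dy) = 0.
  apply/matrixP => k j; rewrite ord1 colDE !subrowsE [RHS]mxE.
  have ia : enum_val k \in al by exact: enum_valP.
  have := congr1 (fun w : 'cV[R]_m2 => w (enum_val k) 0) E6.
  rewrite !(colDE, colNE) clE (b1 _ ((lower_strict _).1 ia)) mul1r subrr.
  by move=> /eqP; rewrite oppr_eq0 => /eqP.
pose e := col_mx dy (col_mx dmu (subrows al cl)).
(* On the active set the lower slopes are 1, so the equations E4, E5, E6 form a linear system for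
   [e] with matrix [K]. *)
have Ke : K *m e = - (Nm *m dx).
  rewrite /e Kmx_mul /Nmx !mul_col_mx !opp_col_mx; congr col_mx.
    rewrite -(subrows_supp _ clS); apply/eqP; rewrite -subr_eq0 opprK.
    by apply/eqP; rewrite -[RHS]E4; apply/matrixP => i j; rewrite !mxE; lra.
  congr col_mx; first by apply/eqP; rewrite -addr_eq0 addrC E5.
  rewrite mulNmx !subrows_mul; congr (- _); apply/eqP.
  by rewrite -addr_eq0 addrC E6'.
have eE : e = - (invmx K *m (Nm *m dx)).
  by rewrite -mulmxN -Ke mulKmx// Kmx_unit.
have Ne : M^T *m dy + jxh^T *m dmu - jxg^T *m cl
    = - (Nm^T *m invmx K *m Nm *m dx).
  rewrite -!mulmxA -[RHS]mulmxN -eE /e /Nmx !tr_col_mx !mul_row_col linearN /= mulNmx.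
  by rewrite -(subrows_supp _ clS) addrA.
have E1' : (Lxx - Nm^T *m invmx K *m Nm) *m dx + hessHG H G x u v *m dx
    + JH^T *m du + JG^T *m cv = 0.
  rewrite mulmxBl -Ne -[RHS]E1.
  by apply/matrixP => i j; rewrite !mxE; lra.
have dx0 : dx = 0.
  apply/eqP/negPn/negP => dxn0.
  (* A positive multiplier forces slope 1, so the third block vanishes there and [dx] lies in the
     affine hull required by (iv). *)
  have Gv0 i : 0 < v i 0 -> (JG *m dx) i 0 = 0.
    move=> v0; have ia : i \in act.
      by apply/negPn/negP => /(upper_complementarity i).1[vi0 _]; rewrite vi0 ltxx in v0.
    have [_ G0] := (upper_complementarity i).2 ia.
    have := congr1 (fun w : 'cV[R]_n2 => w i 0) E3.
    rewrite !(colDE, colNE) cvE a1 ?G0 ?addr0//.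
    by rewrite mul1r subrr => /eqP; rewrite oppr_eq0 => /eqP.
  have := soc dx (critical_affine E2 Gv0) dxn0.
  set q := dotv (_ *m dx) dx.
  pose c := dotv (hessHG H G x u v *m dx) dx.
  have supc : (ereal_sup [set (dotv (hessHG H G x uv.1 uv.2 *m dx) dx)%:E
      | uv in multipliers f h g H G x y mu lam] <= c%:E)%E.
    apply: ge_ereal_sup => _ [uv /multiplier_unique -> <-]; exact: lexx.
  move=> /lt_le_trans/(_ (leeD2r q%:E supc)); rewrite lte_fin.
  have := congr1 (fun w => dotv w dx) E1'; rewrite /= dotv0l.
  rewrite !dotvDl !dotv_trmx E2 dotv0r addr0 -/q -/c.
  (* Each term is [a i * (1 - a i)] times a square, which is where the slopes in the unit interval
     enter. *)
  have : 0 <= dotv cv (JG *m dx).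
    rewrite dotvE sumr_ge0// => i _.
    have := congr1 (fun w : 'cV[R]_n2 => w i 0) E3.
    rewrite !(colDE, colNE) cvE => E.
    have -> : (JG *m dx) i 0 = (1 - a i) * dv i 0 by lra.
    rewrite mulrACA mulr_ge0//; last by rewrite -expr2 sqr_ge0.
    by have := a01 i => /andP[? ?]; rewrite mulr_ge0// subr_ge0.
  by lra.
have e0 : e = 0 by rewrite eE dx0 !mulmx0 oppr0.
move: e0; rewrite /e -!col_mx0 => /eq_col_mx[dy0 /eq_col_mx[dmu0 scl0]].
have cl0 := subrows_eq0 clS scl0.
have dl0 : dl = 0.
  move: E6; rewrite dx0 dy0 cl0 !mulmx0 addr0 oppr0 sub0r => /eqP.
  by rewrite eq_sym oppr_eq0 => /eqP.
move: E1'; rewrite dx0 !mulmx0 !add0r (subrows_supp _ cvS).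
move=> /(row_free_col_mx_inj rf)[du0 /(subrows_eq0 cvS) cv0].
have dv0 : dv = 0.
  move: E3; rewrite dx0 cv0 mulmx0 oppr0 sub0r => /eqP.
  by rewrite eq_sym oppr_eq0 => /eqP.
by [].
Qed.

End PropertyA.

(** * Invariance under multiplication by a diagonal sign matrix *)

Section SignChanges.
Context {R : realType} {N : nat}.
Variable s : 'rV[R]_N.
Hypothesis s1 : forall i, `|s 0 i| = 1.
Local Notation S := (diag_mx s).

Lemma sign_mulE k (A : 'M[R]_(N, k)) i j : (S *m A) i j = s 0 i * A i j.
Proof. by rewrite mul_diag_mx mxE. Qed.

Lemma sign_norm k (A : 'M[R]_(N, k)) : `|S *m A| = `|A|.
Proof.
have E i j : `|(S *m A) i j| = `|A i j| by rewrite sign_mulE normrM s1 mul1r.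
apply/eqP; rewrite eq_le; apply/andP; split; apply: mx_norm_leP => // i j.
  by rewrite E ler_coord_norm.
by rewrite -E ler_coord_norm.
Qed.

Lemma sign_mulK k (A : 'M[R]_(N, k)) : S *m (S *m A) = A.
Proof.
apply/matrixP => i j; rewrite !sign_mulE mulrA -expr2 -real_normK ?num_real//.
by rewrite s1 expr1n mul1r.
Qed.

Lemma lip_homeo_sign (F : 'cV[R]_N -> 'cV[R]_N) p :
  lip_homeo_at F p -> lip_homeo_at (fun z => S *m F z) p.
Proof.
move=> [L [rho [sigma [L0 rho0 sigma0 lipF surF]]]].
exists L, rho, sigma; split => // [a b ar br|y].
  by rewrite -mulmxBr sign_norm; exact: lipF.
move=> yr; have [|a ar aE] := surF (S *m y).
  by rewrite -[F p]sign_mulK -mulmxBr sign_norm.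
by exists a => //; rewrite aE sign_mulK.
Qed.

Lemma clarke_sign (F : 'cV[R]_N -> 'cV[R]_N) p V : clarke_subdiff F p V ->
  clarke_subdiff (fun z => S *m F z) p (S *m V).
Proof.
move=> [k [W [t [CW t0 t1 ->]]]].
exists k, (fun i => S *m W i), t; split => //; last first.
  by rewrite mulmx_sumr; apply: eq_bigr => i _; rewrite scalemxAr.
move=> i; have [q [qp dq jq]] := CW i; exists q; split => // [l|].
  apply: (@differentiable_comp _ _ _ _ F (mulmx S)); first exact: dq.
  by apply: linear_differentiable; exact: mulmx_continuous.
rewrite (_ : (fun l => jac _ (q l)) = fun l => S *m jac F (q l)).
  exact: (cvg_comp _ _ jq (@mulmx_continuous R N N N S (W i))).
apply/funext => l; apply/matrixP => a b; rewrite sign_mulE !mxE /pderiv.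
have dF : derivable (fun z => F z a 0) (q l) (delta_mx b 0).
  have /derivable_mxP dm : derivable F (q l) (delta_mx b 0).
    exact: diff_derivable.
  exact: dm.
rewrite -[RHS]/(s 0 a *: 'D_(delta_mx b 0) (fun z => F z a 0) (q l)) -deriveZ//.
by congr ('D_ _ _ _); apply/funext => z; rewrite sign_mulE.
Qed.

End SignChanges.

(** * The Kojima map as a normal map *)

Section MinimaxNormalMap.
Context {R : realType} {n m n1 n2 m1 m2 : nat}.
Local Notation dz := (@dimz n m n1 n2 m1 m2).
Local Notation Z := 'cV[R]_dz.

Lemma part_pack (x : 'cV[R]_n) (u : 'cV[R]_n1) (v : 'cV[R]_n2)
    (y : 'cV[R]_m) (mu : 'cV[R]_m1) (lam : 'cV[R]_m2) :
  [/\ xpart (pack x u v y mu lam) = x, upart (pack x u v y mu lam) = u,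
      vpart (pack x u v y mu lam) = v &
  [/\ ypart (pack x u v y mu lam) = y, mupart (pack x u v y mu lam) = mu
    & lampart (pack x u v y mu lam) = lam]].
Proof.
by split; [| | |split]; rewrite /xpart /upart /vpart /ypart /mupart /lampart
  /pack ?col_mxKd ?col_mxKu.
Qed.

Lemma pack_part (z : Z) :
  pack (xpart z) (upart z) (vpart z) (ypart z) (mupart z) (lampart z) = z.
Proof. by rewrite /pack !vsubmxK. Qed.

Definition ix (i : 'I_n) : 'I_dz := lshift _ i.
Definition iu (i : 'I_n1) : 'I_dz := rshift n (lshift _ i).
Definition iv (i : 'I_n2) : 'I_dz := rshift n (rshift n1 (lshift _ i)).
Definition iy (i : 'I_m) : 'I_dz := rshift n (rshift n1 (rshift n2 (lshift _ i))).
Definition imu (i : 'I_m1) : 'I_dz :=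
  rshift n (rshift n1 (rshift n2 (rshift m (lshift _ i)))).
Definition ilam (i : 'I_m2) : 'I_dz :=
  rshift n (rshift n1 (rshift n2 (rshift m (rshift m1 i)))).

Lemma dimz_ind (P : 'I_dz -> Prop) : (forall i, P (ix i)) -> (forall i, P (iu i)) ->
  (forall i, P (iv i)) -> (forall i, P (iy i)) -> (forall i, P (imu i)) ->
  (forall i, P (ilam i)) -> forall i, P i.
Proof.
move=> Px Pu Pv Py Pm Pl i.
have [j ->|j ->] := split_ordP i; first exact: Px.
have [k ->|k ->] := split_ordP j; first exact: Pu.
have [l ->|l ->] := split_ordP k; first exact: Pv.
have [e ->|e ->] := split_ordP l; first exact: Py.
by have [t ->|t ->] := split_ordP e; [exact: Pm|exact: Pl].
Qed.

(** The entry type is arbitrary so that the rule also reads the boolean vector [signed_index]. *)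
Lemma packE T (x : 'cV[T]_n) (u : 'cV[T]_n1) (v : 'cV[T]_n2)
    (y : 'cV[T]_m) (mu : 'cV[T]_m1) (lam : 'cV[T]_m2) :
  let p := col_mx x (col_mx u (col_mx v (col_mx y (col_mx mu lam)))) in
  (forall i, p (ix i) 0 = x i 0) * (forall i, p (iu i) 0 = u i 0) *
  (forall i, p (iv i) 0 = v i 0) * (forall i, p (iy i) 0 = y i 0) *
  (forall i, p (imu i) 0 = mu i 0) * (forall i, p (ilam i) 0 = lam i 0).
Proof.
by (split; [split; [split; [split; [split|]|]|]|]) => i;
  rewrite !(col_mxEd, col_mxEu).
Qed.

Lemma partE (z : Z) :
  (forall i, xpart z i 0 = z (ix i) 0) * (forall i, upart z i 0 = z (iu i) 0) *
  (forall i, vpart z i 0 = z (iv i) 0) * (forall i, ypart z i 0 = z (iy i) 0) *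
  (forall i, mupart z i 0 = z (imu i) 0) * (forall i, lampart z i 0 = z (ilam i) 0).
Proof.
by (split; [split; [split; [split; [split|]|]|]|]) => i;
  rewrite !mxE.
Qed.

Definition signed_index : 'cV[bool]_dz :=
  col_mx (const_mx false) (col_mx (const_mx false) (col_mx (const_mx true)
    (col_mx (const_mx false) (col_mx (const_mx false) (const_mx true))))).

Definition Iz : pred 'I_dz := fun i => signed_index i 0.

Lemma IzE : (forall i, Iz (ix i) = false) * (forall i, Iz (iu i) = false) *
  (forall i, Iz (iv i) = true) * (forall i, Iz (iy i) = false) *
  (forall i, Iz (imu i) = false) * (forall i, Iz (ilam i) = true).
Proof.
by (split; [split; [split; [split; [split|]|]|]|]) => i;
  rewrite /Iz /signed_index packE mxE.
Qed.

Lemma ge_cone_orthant : @ge_cone R n m n1 n2 m1 m2 = orthant Iz.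
Proof.
apply/seteqP; split=> z.
  move=> [zv zl]; apply: dimz_ind => i; rewrite IzE // => _.
    by have := zv i; rewrite partE.
  by have := zl i; rewrite partE.
by move=> zI; split => i; rewrite partE; apply: zI; rewrite IzE.
Qed.

Lemma projK_pack (p : Z) : projK Iz p = pack (xpart p) (upart p)
  (posv (vpart p)) (ypart p) (mupart p) (posv (lampart p)).
Proof.
apply/matrixP => i j; rewrite ord1; move: i.
by apply: dimz_ind => i; rewrite mxE IzE /pack packE ?mxE.
Qed.

(** The third block of the normal map is [- G x + negv w], the opposite of the one in [kojima]; the
    other blocks agree. *)
Definition flip : 'rV[R]_dz :=
  (pack (const_mx 1) (const_mx 1) (const_mx (-1)) (const_mx 1) (const_mx 1)
    (const_mx 1))^T.

Lemma flipE : (forall i, flip 0 (ix i) = 1) * (forall i, flip 0 (iu i) = 1) *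
  (forall i, flip 0 (iv i) = -1) * (forall i, flip 0 (iy i) = 1) *
  (forall i, flip 0 (imu i) = 1) * (forall i, flip 0 (ilam i) = 1).
Proof.
by (split; [split; [split; [split; [split|]|]|]|]) => i;
  rewrite /flip mxE packE mxE.
Qed.

Lemma flip_norm i : `|flip 0 i| = 1.
Proof.
by move: i; apply: dimz_ind => i; rewrite flipE ?normrN normr1.
Qed.

Lemma negvE k (w : 'cV[R]_k) : negv w = w - posv w.
Proof.
apply/matrixP => i j; rewrite ord1 !mxE.
by have := addr_min_max 0 (w i 0); lra.
Qed.

Variables (f : 'cV[R]_n * 'cV[R]_m -> R)
  (h : 'cV[R]_n * 'cV[R]_m -> 'cV[R]_m1)
  (g : 'cV[R]_n * 'cV[R]_m -> 'cV[R]_m2)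
  (H : 'cV[R]_n -> 'cV[R]_n1)
  (G : 'cV[R]_n -> 'cV[R]_n2).

Lemma kojimaE (p : Z) : kojima f h g H G p =
  diag_mx flip *m normal_map Iz (ge_map f h g H G) p.
Proof.
apply/matrixP => i j; rewrite ord1 sign_mulE /normal_map colDE colDE colNE.
rewrite projK_pack /kojima /ge_map.
have [-> -> -> [-> -> ->]] := part_pack (xpart p) (upart p)
  (posv (vpart p)) (ypart p) (mupart p) (posv (lampart p)).
rewrite !negvE; move: i.
by apply: dimz_ind => i; rewrite flipE /pack !packE ?(colDE, colNE) ?partE; ring.
Qed.

End MinimaxNormalMap.

(** * Nonsingularity under Property A, and the zero of the normal map given by the KKT conditions *)

Section PropertyAJacobians.
Context {R : realType} {n m n1 n2 m1 m2 : nat}.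
Variables (f : 'cV[R]_n * 'cV[R]_m -> R)
  (h : 'cV[R]_n * 'cV[R]_m -> 'cV[R]_m1)
  (g : 'cV[R]_n * 'cV[R]_m -> 'cV[R]_m2)
  (H : 'cV[R]_n -> 'cV[R]_n1)
  (G : 'cV[R]_n -> 'cV[R]_n2)
  (x : 'cV[R]_n) (u : 'cV[R]_n1) (v : 'cV[R]_n2)
  (y : 'cV[R]_m) (mu : 'cV[R]_m1) (lam : 'cV[R]_m2).
Local Notation zs := (pack x u v y mu lam).
Local Notation ps := (pack x u (v + G x) y mu (lam + g (x, y))).

Lemma ge_map_strict_derivative (z : 'cV[R]_(@dimz n m n1 n2 m1 m2)) :
  regular f h g H G z -> exists B : 'M[R]_dimz,
    strictly_small (fun z' => ge_map f h g H G z' - B *m z') z.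
Proof. by move=> /ge_map_sder/vsder_strictly_small[B smB _]; exists B. Qed.

(** A kernel vector [d] satisfies [A *m c = c - d] with [c] its image under the slopes. In the free
    blocks [c] and [d] agree, so the right-hand side vanishes there, and [propertyA_kernel]
    applies. *)
Lemma propertyA_unit a : regular f h g H G zs ->
  propertyA f h g H G x u v y mu lam ->
  face Iz ps a -> Jmx (jac (ge_map f h g H G) zs) a \in unitmx.
Proof.
move=> rz pA fa; have [A smA AE] := vsder_strictly_small (ge_map_sder rz).
rewrite (strict_derivative_jac smA); apply: unitmx_inj => d Jd0.
pose c := diag_mx a *m d.
have Ac : A *m c = c - d.
  move: Jd0; rewrite /Jmx mulmxDl mul1mx -mulmxA -/c mulmxBl mul1mx => E.
  by apply/eqP; rewrite -subr_eq0 -E; apply/eqP/matrixP => i j; rewrite !mxE; lra.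
have cE i : c i 0 = a 0 i * d i 0 by rewrite /c sign_mulE.
have free i : ~~ Iz i -> c i 0 = d i 0.
  move=> nI; rewrite cE; have [_ ->] := faceP i fa; last first.
    by rewrite /degenerate (negbTE nI).
  by rewrite /side nI mul1r.
have [px pu pv [py pm pl]] := part_pack x u v y mu lam.
have cx : xpart c = xpart d.
  by apply/matrixP => i j; rewrite ord1 !partE free ?IzE.
have cu : upart c = upart d.
  by apply/matrixP => i j; rewrite ord1 !partE free ?IzE.
have cy : ypart c = ypart d.
  by apply/matrixP => i j; rewrite ord1 !partE free ?IzE.
have cm : mupart c = mupart d.
  by apply/matrixP => i j; rewrite ord1 !partE free ?IzE.
have := AE c; rewrite Ac px pu pv py pm pl cx cu cy cm -[c - d]pack_part.
rewrite /pack => /eq_col_mx[E1 /eq_col_mx[E2 /eq_col_mx[E3 /eq_col_mx[E4]]]].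
move=> /eq_col_mx[E5 E6].
have sgn i (t : R) : Iz i -> ps i 0 = t ->
    [/\ 0 <= a 0 i <= 1, 0 < t -> a 0 i = 1 & t < 0 -> a 0 i = 0].
  move=> Ii <-; have [a01 aE] := faceP i fa; split => // t0.
    by rewrite aE /side ?t0 ?orbT// /degenerate Ii gt_eqF.
  by rewrite aE /side /degenerate Ii ?lt_eqF//= ltNge (ltW t0).
have sgnv i := sgn (iv i) (v i 0 + G x i 0).
have sgnl i := sgn (ilam i) (lam i 0 + g (x, y) i 0).
have {}sgnv i : [/\ 0 <= a 0 (iv i) <= 1, 0 < v i 0 + G x i 0 -> a 0 (iv i) = 1
    & v i 0 + G x i 0 < 0 -> a 0 (iv i) = 0].
  by apply: sgnv; rewrite ?IzE// /pack packE colDE.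
have {}sgnl i : [/\ 0 <= a 0 (ilam i) <= 1,
    0 < lam i 0 + g (x, y) i 0 -> a 0 (ilam i) = 1
    & lam i 0 + g (x, y) i 0 < 0 -> a 0 (ilam i) = 0].
  by apply: sgnl; rewrite ?IzE// /pack packE colDE.
have rxy : regular_xy f h g (x, y) by have [] := rz; rewrite /xy px py.
have := @propertyA_kernel R n m n1 n2 m1 m2 f h g H G x u v y mu lam rxy pA
  (xpart d) (upart d) (vpart d) (vpart c) (ypart d) (mupart d) (lampart d)
  (lampart c) (fun i => a 0 (iv i)) (fun i => a 0 (ilam i)).
case.
- by move=> i; rewrite !partE cE.
- by move=> i; rewrite !partE cE.
- by move=> i; have [] := sgnv i.
- by move=> i; have [] := sgnv i.
- by move=> i; have [] := sgnv i.
- by move=> i; have [] := sgnl i.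
- by move=> i; have [] := sgnl i.
- by rewrite -E1 /xpart linearB /= -/(xpart c) -/(xpart d) cx subrr.
- by rewrite -E2 /upart !linearB /= -/(upart c) -/(upart d) cu subrr.
- by rewrite -E3 /vpart !linearB.
- by rewrite -E4 /ypart !linearB /= -/(ypart c) -/(ypart d) cy subrr.
- by rewrite -E5 /mupart !linearB /= -/(mupart c) -/(mupart d) cm subrr.
- by rewrite -E6 /lampart !linearB.
move=> dx du dv [dy dm dl].
by rewrite -[d]pack_part dx du dv dy dm dl /pack !col_mx0.
Qed.

Lemma kkt_projK : kkt f h g H G x u v y mu lam -> projK Iz ps = zs.
Proof.
move=> [_ _ cv [_ _ cl]]; rewrite projK_pack.
have [-> -> -> [-> -> ->]] := part_pack x u (v + G x) y mu (lam + g (x, y)).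
have posE k (a b : 'cV[R]_k) : complementary a b -> posv (a + b) = a.
  move=> /complementaryP ab; apply/matrixP => i j; rewrite ord1 !mxE.
  have [a0 b0 /eqP] := ab i; rewrite mulf_eq0 => /orP[/eqP->|/eqP->].
    by rewrite add0r max_l.
  by rewrite addr0 max_r.
by rewrite !posE.
Qed.

Lemma kkt_normal_map : kkt f h g H G x u v y mu lam ->
  normal_map Iz (ge_map f h g H G) ps = 0.
Proof.
move=> ks; rewrite /normal_map (kkt_projK ks); case: ks => st H0 _ [gy h0 _].
rewrite /ge_map; have [-> -> -> [-> -> ->]] := part_pack x u v y mu lam.
rewrite st H0 gy h0; apply/matrixP => i j; rewrite ord1 [RHS]mxE.
rewrite !(colDE, colNE); move: i.
by apply: dimz_ind => i; rewrite /pack !packE ?(colDE, colNE) ?[(0 : 'cV[R]__) _ _]mxE; ring.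
Qed.

End PropertyAJacobians.

Theorem theorem4p1 (R : realType) (n m n1 n2 m1 m2 : nat)
  (f : 'cV[R]_n * 'cV[R]_m -> R)
  (h : 'cV[R]_n * 'cV[R]_m -> 'cV[R]_m1)
  (g : 'cV[R]_n * 'cV[R]_m -> 'cV[R]_m2)
  (H : 'cV[R]_n -> 'cV[R]_n1)
  (G : 'cV[R]_n -> 'cV[R]_n2)
  (xs : 'cV[R]_n) (us : 'cV[R]_n1) (vs : 'cV[R]_n2)
  (ys : 'cV[R]_m) (mus : 'cV[R]_m1) (lams : 'cV[R]_m2)
  (f_C2 : C2_near f (xs, ys)) (h_C2 : C2_near h (xs, ys))
  (g_C2 : C2_near g (xs, ys)) (H_C2 : C2_near H xs) (G_C2 : C2_near G xs)
  (kkts : kkt f h g H G xs us vs ys mus lams) :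
  let F := kojima f h g H G in
  let ws := vs + G xs in
  let xis := lams + g (xs, ys) in
  let ps := pack xs us ws ys mus xis in
  let zs := pack xs us vs ys mus lams in
  let a := propertyA f h g H G xs us vs ys mus lams in
  let b := forall V, clarke_subdiff F ps V -> V \in unitmx in
  let c := locally_lipschitz_homeo F ps in
  let d := strongly_regular (ge_map f h g H G) ge_cone zs in
  [/\ a -> b, b -> c & c <-> d].
Proof.
move=> F ws xis ps zs a b c d.
pose Hm := ge_map f h g H G.
pose nm := normal_map Iz Hm.
have FE : F = fun p => diag_mx flip *m nm p.
  by apply/funext => p; exact: kojimaE.
have nmE : nm = fun p => diag_mx flip *m F p.
  by apply/funext => p; rewrite FE sign_mulK//; exact: flip_norm.
have xy_coords : has_coords ('cV[R]_n * 'cV[R]_m)%type.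
  by apply: has_coords_prod; exact: has_coords_cV.
have x_coords : has_coords 'cV[R]_n by exact: has_coords_cV.
have rz : regular f h g H G zs.
  have [px _ _ [py _ _]] := part_pack xs us vs ys mus lams.
  rewrite /regular /xy px py; split.
    split=> [|i|i]; first exact: (C2_near_id xy_coords f_C2).
      exact: (C2_near_coord i xy_coords h_C2).
    exact: (C2_near_coord i xy_coords g_C2).
  split=> i; first exact: (C2_near_coord i x_coords H_C2).
  exact: (C2_near_coord i x_coords G_C2).
have pszs : projK Iz ps = zs by exact: (kkt_projK kkts).
have nm0 : nm ps = 0 by exact: (kkt_normal_map kkts).
have [A smA _] := vsder_strictly_small (ge_map_sder rz).
have AE : jac Hm zs = A by exact: strict_derivative_jac smA.
have smH : strictly_small (fun z => Hm z - jac Hm zs *m z) (projK Iz ps).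
  by rewrite pszs AE.
have diffH : \forall z \near projK Iz ps, exists B : 'M[R]_dimz,
    strictly_small (fun z' => Hm z' - B *m z') z.
  rewrite pszs; apply: filterS (regular_near rz) => z.
  exact: ge_map_strict_derivative.
(* The linearization differs from the linear map only by a constant, which leaves increments
   unchanged. *)
have smL : strictly_small (fun z => Hm z - linearization Hm zs z) zs.
  have := strictly_smallD_cst (jac Hm zs *m zs - Hm zs) smA.
  congr (strictly_small _ _); apply/funext => z.
  rewrite /linearization mulmxBr AE.
  by apply/matrixP => i j; rewrite !mxE; lra.
have lhF : lip_homeo_at F ps <-> lip_homeo_at nm ps.
  split=> lh; [rewrite nmE|rewrite FE]; apply: lip_homeo_sign lh; exact: flip_norm.
split.
- move=> pA V CV.
  have : clarke_subdiff nm ps (diag_mx flip *m V).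
    by rewrite nmE; exact: clarke_sign.
  move=> /(clarke_normal_map_face smH)[t ft VE].
  have : diag_mx flip *m V \in unitmx by rewrite VE; exact: propertyA_unit.
  by rewrite unitmx_mul => /andP[].
- move=> hb; apply/locally_lipschitz_homeoP/lhF; apply: (unit_lip_homeo smH) => t ft.
  have : clarke_subdiff F ps (diag_mx flip *m Jmx (jac Hm zs) t).
    (* Every matrix of the face, up to the sign change, is in the subdifferential of [F], so (b)
       gives the nonsingularity that [unit_lip_homeo] requires. *)
    rewrite FE; apply: clarke_sign => //; exact: face_clarke.
  by move=> /hb; rewrite unitmx_mul => /andP[].
- rewrite /c locally_lipschitz_homeoP lhF /d ge_cone_orthant.
  exact: lip_homeo_normal_mapP.
Qed.
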